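(* Let $2\le n<p<p_0<\infty$. There exists a constant $c$ depending only on $n$ and $p_0$ such that $$\|f\|_{B^{n/p}_{p,n}}\le c\Big(1-\frac np\Big)^{-1/n}\|\nabla f\|_{L^n}$$ for every $f$ in the homogeneous Sobolev space $\dot W^1_n(\mathbb{R}^n)$.
   Context: $\dot W^1_n$ denotes the space of locally integrable $f$ (vanishing at infinity in the sense that its level sets $\{|f|>t\}$, $t>0$, have finite measure) with weak gradient $\nabla f\in L^n$. $\omega_n=|B^n|$, $\Delta_hf(x)=f(x+h)-f(x)$, $\omega(f,t)_p=(\frac{1}{t^n\omega_n}\int_{|h|<t}\|\Delta_hf\|^p_{L^p}dh)^{1/p}$, and $\|f\|_{B^{s}_{p,q}}=(\int_0^\infty t^{-sq}\omega(f,t)_p^q\frac{dt}{t})^{1/q}$. *)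

(* Defs.v *)
From HB Require Import structures.
From mathcomp Require Import all_boot all_order all_algebra.
From mathcomp Require Import all_classical all_reals all_analysis.
Set Implicit Arguments. Unset Strict Implicit. Unset Printing Implicit Defensive.
Import Order.TTheory GRing.Theory Num.Theory.
Import numFieldNormedType.Exports.
Local Open Scope classical_set_scope.
Local Open Scope ring_scope.

(* R^n is modelled by n.-tuple R for
   measure theory (with the library's product Borel sigma-algebra) and by
   'rV[R]_n for the vector-space/derivative structure; [rowt] identifies them. *)

Section Defs.
Context {R : realType} (n : nat).

Definition rowt (x : n.-tuple R) : 'rV[R]_n := \row_i tnth x i.

Definition enorm (v : 'rV[R]_n) : R := Num.sqrt (\sum_i v 0 i ^+ 2).

(* mu is the n-dimensional Lebesgue measure (on the Borel sets of R^n):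
   it gives every half-open box its volume; this characterizes it uniquely. *)
Definition is_lebesgue_n (mu : {measure set (n.-tuple R) -> \bar R}) : Prop :=
  forall a b : 'I_n -> R, (forall i, a i <= b i) ->
    mu [set x | forall i, a i <= tnth x i < b i] = (\prod_i (b i - a i))%:E.

Definition test_fun (phi : 'rV[R]_n -> R) : Prop :=
  continuous phi /\
  (forall i x, derivable phi x (delta_mx 0 i)) /\
  (forall i, continuous (fun x => derive phi x (delta_mx 0 i))) /\
  (exists M : R, forall x, M < enorm x -> phi x = 0).

Local Open Scope ereal_scope.

Definition in_Wdot1n (mu : {measure set (n.-tuple R) -> \bar R})
    (f : 'rV[R]_n -> R) (g : 'I_n -> 'rV[R]_n -> R) : Prop :=
  measurable_fun setT (f \o rowt) /\
      (forall r : R, (0 < r)%R ->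
         \int[mu]_(x in [set x | (enorm (rowt x) < r)%R]) (`|f (rowt x)|%R)%:E < +oo) /\
      (forall t : R, (0 < t)%R -> mu [set x | (t < `|f (rowt x)|)%R ] < +oo) /\
      (forall i, measurable_fun setT (g i \o rowt)) /\
      \int[mu]_x ((enorm (\row_i g i (rowt x))) `^ n%:R)%R%:E < +oo /\
      (forall phi, test_fun phi -> forall i,
         \int[mu]_x (f (rowt x) * derive phi (rowt x) (delta_mx 0 i))%R%:E
         = - \int[mu]_x (g i (rowt x) * phi (rowt x))%R%:E).

Definition gradLn (mu : {measure set (n.-tuple R) -> \bar R})
    (g : 'I_n -> 'rV[R]_n -> R) : R :=
  ((fine (\int[mu]_x ((enorm (\row_i g i (rowt x))) `^ n%:R)%R%:E)) `^ (n%:R^-1))%R.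

Definition omega_n (mu : {measure set (n.-tuple R) -> \bar R}) : R :=
  fine (mu [set x | (enorm (rowt x) < 1)%R]).

Definition diffLp (mu : {measure set (n.-tuple R) -> \bar R})
    (f : 'rV[R]_n -> R) (p : R) (h : 'rV[R]_n) : \bar R :=
  \int[mu]_x ((`|f (rowt x + h) - f (rowt x)|) `^ p)%R%:E.

Definition modulus (mu : {measure set (n.-tuple R) -> \bar R})
    (f : 'rV[R]_n -> R) (p t : R) : \bar R :=
  (((t ^+ n * omega_n mu)^-1)%R%:E *
     \int[mu]_(h in [set h | (enorm (rowt h) < t)%R]) diffLp mu f p (rowt h))
  `^ (p^-1).

Definition besov (mu : {measure set (n.-tuple R) -> \bar R})
    (f : 'rV[R]_n -> R) (s p q : R) : \bar R :=
  (\int[lebesgue_measure]_(t in `]0%R, +oo[)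
      ((t `^ (- (s * q)))%R%:E * (modulus mu f p t) `^ q * (t^-1)%R%:E))
  `^ (q^-1).

End Defs.

(* Main.v *)
Require Import Defs.
From HB Require Import structures.
From mathcomp Require Import all_boot all_order all_algebra.
From mathcomp Require Import all_classical all_reals all_analysis.
From mathcomp Require Import measurable_realfun ring lra.
Set Implicit Arguments. Unset Strict Implicit. Unset Printing Implicit Defensive.
Import Order.TTheory GRing.Theory Num.Theory.
Import numFieldNormedType.Exports.
Local Open Scope classical_set_scope.
Local Open Scope ring_scope.

(** Write [G = |grad f|] and let [A_s G] be the average of [G] over cubes of side comparable to [s].
    Mollifying [f] with a quadratic B-spline at the scales [s 2^-l] and telescoping gives, for almost
    every [x] and every [|h| <= s],
      [|f(x+h) - f(x)| <= C \sum_l s 2^-l (A_(s 2^-l) G (x) + A_(s 2^-l) G (x+h))],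
    where only the weak gradient tested against explicit tensor products of splines is used.  By a
    weighted Hoelder inequality, whose weights [rho] depend only on [n] and [p0], the [n]-th power of
    the modulus of continuity at [s] is at most a geometrically weighted sum over [l] of
    [(s 2^-l)^n ||A_(s 2^-l) G||_p^n].  It remains to bound
      [\sum_k (2^k)^(n (1 - n/p)) ||A_(2^k) G||_p^n <= C (1 - n/p)^-1 ||G||_n^n].
    For this [G] is cut at the height [lambda_k] whose superlevel set has measure about [2^(k n)].  The
    part above is controlled in [L^1], the part below in [L^p]; both contributions satisfy geometric
    recurrences in [k] whose source terms telescope to [||G||_n^n], and the factor [(1 - n/p)^-1] is
    the sum of the geometric series of ratio [2^(- n (1 - n/p))] coming from the lower part. *)

(** * Inequalities for real numbers *)

Section real_inequalities.
Context {R : realType}.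
Implicit Types (a b x y r p : R).

(** The bound [p < p0] enters only through [rho]. Hoelder over the scales s 2^-l costs the weight
    rho^(-n l), while the smoothness n/p, which degenerates as p grows, gains only 2^(-l n^2/p).
    With rho^2 = 2^(-n/p0), half of the guaranteed gain pays for the weight and the other half
    leaves a convergent geometric series. The cut has to move with the scale: the L^n norm of G
    alone bounds each scale by C ||G||_n^n, which cannot be summed. On a layer of measure at most v,
    Hoelder trades L^1 mass for L^n mass, and the layers between consecutive cuts are disjoint, so
    their masses add up to at most ||G||_n^n. Every dyadic sum is estimated over finite windows with
    an arbitrary start, uniformly in the start and the length. The price is a boundary term, for
    which each summand needs its own a priori bound by ||G||_n^n. The almost everywhere estimate
    involves no pointwise differentiation: the excess of the difference over its bound is dominated
    by mollification errors that tend to 0 in L^1 on cubes. *)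

Lemma powR_inv x r : 0 <= x -> x^-1 `^ r = (x `^ r)^-1.
Proof. by move=> x0; rewrite -powR_inv1// -powRrM mulN1r powRN. Qed.

(** Young's inequality for the exponents p and p/(p - 1). With [b] kept as a free parameter it is
    the common source of the Bernoulli, convexity and Jensen inequalities below. *)
Lemma powR_young a b p : 0 <= a -> 0 < b -> 1 < p ->
  a * b `^ (p - 1) <= a `^ p / p + (1 - p^-1) * b `^ p.
Proof.
move=> a0 b0 p1; have p0 : 0 < p by lra.
have q0 : 0 < p / (p - 1) by apply: divr_gt0; lra.
have := @conjugate_powR R a (b `^ (p - 1)) p (p / (p - 1)) a0 (powR_ge0 _ _) p0 q0.
have pE : p^-1 + (p / (p - 1))^-1 = 1 by rewrite invf_div; field; rewrite gt_eqF//; lra.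
move=> /(_ pE); rewrite -powRrM.
have -> : (p - 1) * (p / (p - 1)) = p by field; rewrite gt_eqF//; lra.
have -> : (p / (p - 1))^-1 = 1 - p^-1 by move: pE; set z := (p / _)^-1; lra.
by rewrite [_ * b `^ p]mulrC.
Qed.

(** Concavity of the power at 1. For a = 1/q and r = 1 - n/p it bounds the gap 1 - q^(-r) from below
    by a multiple of 1 - n/p. *)
Lemma powR_le_affine a r : 0 < a <= 1 -> 0 < r < 1 -> a `^ r <= 1 - r * (1 - a).
Proof.
move=> /andP[a0 a1] /andP[r0 r1].
have rV1 : 1 < r^-1 by rewrite invf_gt1.
have := powR_young (powR_ge0 a r) ltr01 rV1.
rewrite !powR1 /= !mulr1 !invrK -powRrM mulfV ?gt_eqF// powRr1 ?(ltW a0)//; lra.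
Qed.

Lemma powR_subadd a b r : 0 <= a -> 0 <= b -> 0 < r <= 1 ->
  (a + b) `^ r <= a `^ r + b `^ r.
Proof.
move=> a0 b0 /andP[r0 r1].
have [->|/eqP aneq0] := eqVneq a 0; first by rewrite add0r powR0 ?gt_eqF// add0r.
have ap : 0 < a by rewrite lt_neqAle a0 eq_sym; move/eqP : aneq0 => ->.
have ab0 : 0 < a + b by lra.
(* A fraction at most 1 lies below its own [r]-th power, and the fractions of [a] and [b] add up to
   1. *)
have key c : 0 <= c -> c <= a + b -> c / (a + b) * (a + b) `^ r <= c `^ r.
  move=> c0 cab; have [->|cn0] := eqVneq c 0; first by rewrite !mul0r powR_ge0.
  have cp : 0 < c by rewrite lt_neqAle eq_sym cn0.
  have cd : 0 < c / (a + b) <= 1 by rewrite divr_gt0//= ler_pdivrMr// mul1r.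
  have -> : c `^ r = (c / (a + b)) `^ r * (a + b) `^ r.
    by rewrite -powRM ?divr_ge0 ?ltW// divfK// gt_eqF.
  by rewrite ler_wpM2r ?powR_ge0// ger1_powR.
have := lerD (key a a0 ltac:(lra)) (key b b0 ltac:(lra)).
by rewrite -mulrDl -mulrDl mulfV ?gt_eqF// mul1r.
Qed.

(** Convexity of the power at (1 - r) (a / (1 - r)) + r (b / r). The weight [r] is left free so that
    iteration yields Hoelder's inequality with geometric weights. *)
Lemma powR_convD a b p r : 0 <= a -> 0 <= b -> 1 < p -> 0 < r < 1 ->
  (a + b) `^ p <= (1 - r) `^ (1 - p) * a `^ p + r `^ (1 - p) * b `^ p.
Proof.
move=> a0 b0 p1 /andP[r0 r1]; have p0 : 0 < p by lra.
have [ab|abn0] := eqVneq (a + b) 0.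
  by rewrite ab powR0 ?gt_eqF// addr_ge0// mulr_ge0 ?powR_ge0.
have ab0 : 0 < a + b by rewrite lt_neqAle eq_sym abn0; lra.
(* Young for c / w against a + b, multiplied by w. For the weights 1 - r and r the last terms add up
   to (1 - p^-1) (a + b)^p, which is absorbed on the left. *)
have key (c w : R) : 0 <= c -> 0 < w ->
    c * (a + b) `^ (p - 1) <= w `^ (1 - p) * c `^ p / p + w * (1 - p^-1) * (a + b) `^ p.
  move=> c0 w0; have := powR_young (divr_ge0 c0 (ltW w0)) ab0 p1.
  move=> /(ler_wpM2l (ltW w0)); rewrite mulrA [w * (c / w)]mulrC divfK ?gt_eqF//.
  rewrite mulrDr !mulrA powRM ?invr_ge0 ?(ltW w0)// powR_inv ?(ltW w0)//.
  have -> : w `^ (1 - p) = w / w `^ p.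
    by rewrite powRB ?(gt_eqF w0) ?implybT// powRr1 ?ltW.
  by have -> : w * (c `^ p / w `^ p) / p = w / w `^ p * c `^ p / p by ring.
have := lerD (key a (1 - r) a0 ltac:(lra)) (key b r b0 r0).
rewrite -mulrDl mulr_powRB1 ?(ltW ab0)//.
set X := (a + b) `^ p; set Y := _ `^ _ * _; set Z := _ `^ _ * _ => H.
have pV : 0 < p^-1 by rewrite invr_gt0.
have H2 : X / p <= (Y + Z) / p by lra.
by rewrite ler_pM2r// in H2.
Qed.

Lemma powR_addD a b p : 0 <= a -> 0 <= b -> 1 < p ->
  (a + b) `^ p <= 2 `^ (p - 1) * (a `^ p + b `^ p).
Proof.
move=> a0 b0 p1; have := @powR_convD a b p 2^-1 a0 b0 p1 ltac:(lra).
have -> : 1 - 2^-1 = 2^-1 :> R by lra.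
by rewrite -mulrDr powR_inv// -powRN opprB.
Qed.

Lemma poweR_addD (x y : \bar R) (p : R) : (1 < p)%R -> (0 <= x -> 0 <= y ->
  (x + y) `^ p <= (2 `^ (p - 1))%:E * (x `^ p + y `^ p))%E.
Proof.
move=> p1; have p0 : (p != 0)%R by rewrite gt_eqF//; lra.
have c0 : (0 < (2 `^ (p - 1))%:E :> \bar R)%E by rewrite lte_fin powR_gt0.
have py (z : \bar R) : (z `^ p != -oo)%E by rewrite -ltNye (lt_le_trans _ (poweR_ge0 _ _)).
case: x => [x| |] //; case: y => [y| |] //.
- rewrite lee_fin => x0; rewrite lee_fin => y0; rewrite -EFinD !poweR_EFin -EFinD -EFinM lee_fin; exact: powR_addD.
- by move=> _ _; rewrite poweRyr// addey ?py// gt0_muley ?leey.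
- by move=> _ _; rewrite poweRyr// addye ?py// gt0_muley ?leey.
- by move=> _ _; rewrite poweRyr// addye ?py// gt0_muley ?leey.
Qed.

Lemma exprD_le a b n : (1 < n)%N -> 0 <= a -> 0 <= b ->
  (a + b) ^+ n <= 2 ^+ n.-1 * (a ^+ n + b ^+ n).
Proof.
move=> n1 a0 b0; have := @powR_addD a b n%:R a0 b0 ltac:(by rewrite ltr1n).
have -> : n%:R - 1 = n.-1%:R :> R by rewrite -subn1 natrB// ltnW.
by rewrite !powR_mulrn ?addr_ge0.
Qed.

(** The rescaling from v to q v pays for the convexity loss: 2^(n-1) equals q/2, and q <= q^(n-1)
    because n >= 2. The old part [a] is therefore contracted by 1/2. *)
Lemma scaled_exprD_le a b v w q n : (1 < n)%N -> q = 2 ^+ n -> 0 <= a -> 0 <= b -> 0 < v ->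
  b ^+ n <= (q * v) ^+ n.-1 * w ->
  (q * v) ^- n.-1 * (a + b) ^+ n <= v ^- n.-1 * a ^+ n / 2 + 2 ^+ n.-1 * w.
Proof.
move=> n1 qE a0 b0 v0 h.
have q2 : 2 <= q by rewrite qE -{1}[2]expr1 ler_weXn2l ?ler1n// ltnW.
have q0 : 0 < q by lra.
have qvn : 0 < (q * v) ^+ n.-1 by rewrite exprn_gt0// mulr_gt0.
rewrite ler_pdivrMl//; apply: (le_trans (exprD_le n1 a0 b0)).
rewrite mulrDr [leRHS]mulrDr; apply: lerD; last by rewrite mulrCA ler_wpM2l ?exprn_ge0.
rewrite exprMn [leRHS](_ : _ = q ^+ n.-1 / 2 * a ^+ n).
  rewrite ler_wpM2r ?exprn_ge0// ler_pdivlMr// -exprSr prednK 1?ltnW//.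
  rewrite -qE -{1}[q]expr1 ler_weXn2l//; first by lra.
  by rewrite -subn1 subn_gt0.
by field; rewrite gt_eqF// exprn_gt0.
Qed.

Lemma scaled_telescope_le (c a b v q x y : R) : 0 <= c -> q != 0 -> y + (a - b) * v <= x ->
  c * a * v <= q^-1 * (c * b * (q * v)) + (c * x - c * y).
Proof.
move=> c0 q0 h.
have -> : q^-1 * (c * b * (q * v)) + (c * x - c * y) = c * (b * v + x - y) by field.
by rewrite -mulrA ler_wpM2l//; lra.
Qed.

(** The sources telescope, and half of the sum is absorbed, so only end values remain. *)
Lemma sum_le_forward_recurrence (t w : nat -> R) N :
  (forall i, 0 <= t i) -> (forall i, t i.+1 <= t i / 2 + (w i.+1 - w i)) ->
  \sum_(i < N) t i <= 2 * t 0 + 2 * (w N - w 0).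
Proof.
move=> t0 h.
have h1 : \sum_(i < N) t i.+1 <= (\sum_(i < N) t i) / 2 + (w N - w 0).
  apply: (le_trans (ler_sum _ (fun (i : 'I_N) _ => h i))).
  rewrite big_split/= -mulr_suml lerD2l -(big_mkord xpredT (fun i => w i.+1 - w i)).
  by rewrite telescope_sumr.
have h2 : \sum_(i < N.+1) t i = t 0 + \sum_(i < N) t i.+1 by rewrite big_ord_recl.
have h3 : \sum_(i < N.+1) t i = \sum_(i < N) t i + t N by rewrite big_ord_recr.
have := t0 N; lra.
Qed.

(** Here each term is controlled by the next one, so the last term survives as a boundary value that
    needs an a priori bound. The gap 1 - k is kept explicit because it degenerates as p tends to
    n. *)
Lemma sum_le_backward_recurrence (t e : nat -> R) (k : R) N :
  (forall i, 0 <= t i) -> 0 <= k <= 1 -> (forall i, t i <= k * t i.+1 + e i) ->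
  (1 - k) * \sum_(i < N) t i <= t N + \sum_(i < N) e i.
Proof.
move=> t0 /andP[k0 k1] h.
have h1 : \sum_(i < N) t i <= k * (\sum_(i < N) t i.+1) + \sum_(i < N) e i.
  apply: (le_trans (ler_sum _ (fun (i : 'I_N) _ => h i))).
  by rewrite big_split/= -mulr_sumr.
have h2 : \sum_(i < N.+1) t i = t 0 + \sum_(i < N) t i.+1 by rewrite big_ord_recl.
have h3 : \sum_(i < N.+1) t i = \sum_(i < N) t i + t N by rewrite big_ord_recr.
have h4 : k * (\sum_(i < N) t i.+1) <= k * (\sum_(i < N) t i + t N).
  by rewrite ler_wpM2l//; have := t0 0; lra.
have h5 : k * t N <= t N by rewrite ler_piMl.
lra.
Qed.

(** The sequences are sampled from functions of a positive real, and the bound involves neither the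
    start [v] nor the length [N]: it holds on every window of a progression infinite in both
    directions. *)
Lemma geometric_sum_forward (t w : R -> R) (q c J v : R) N : 0 < q -> 0 < v -> 0 <= c ->
  (forall u, 0 < u -> 0 <= t u <= J) -> (forall u, 0 < u -> 0 <= w u <= J) ->
  (forall u, 0 < u -> t (q * u) <= t u / 2 + c * (w (q * u) - w u)) ->
  \sum_(i < N) t (q ^+ i * v) <= (2 + 2 * c) * J.
Proof.
move=> q0 v0 c0 tJ wJ h.
have vi i : 0 < q ^+ i * v by rewrite mulr_gt0// exprn_gt0.
have t0 i : 0 <= t (q ^+ i * v) by case/andP: (tJ _ (vi i)).
have {}h i : t (q ^+ i.+1 * v) <=
    t (q ^+ i * v) / 2 + (c * w (q ^+ i.+1 * v) - c * w (q ^+ i * v)).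
  by rewrite -mulrBr exprS -mulrA; exact: h.
have := sum_le_forward_recurrence N t0 h.
have [_ ta] := andP (tJ _ (vi 0)); have [wa _] := andP (wJ _ (vi 0)).
have [_ wb] := andP (wJ _ (vi N)).
have := ler_wpM2l c0 wb; have := mulr_ge0 c0 wa.
have -> : (2 + 2 * c) * J = 2 * J + 2 * (c * J) by ring.
by move: ta; move: (t _) (c * w _) (c * w _) (c * J) (\sum_(_ < _) _) => x y z cJ s; lra.
Qed.

Lemma geometric_sum_backward (t e : R -> R) (q k J K v : R) N : 0 < q -> 0 < v ->
  0 <= k <= 1 ->
  (forall u, 0 < u -> 0 <= t u <= J) ->
  (forall u, 0 < u -> t u <= k * t (q * u) + e u) ->
  \sum_(i < N) e (q ^+ i * v) <= K ->
  (1 - k) * \sum_(i < N) t (q ^+ i * v) <= J + K.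
Proof.
move=> q0 v0 k01 tJ h hK.
have vi i : 0 < q ^+ i * v by rewrite mulr_gt0// exprn_gt0.
have t0 i : 0 <= t (q ^+ i * v) by case/andP: (tJ _ (vi i)).
have {}h i : t (q ^+ i * v) <= k * t (q ^+ i.+1 * v) + e (q ^+ i * v).
  by rewrite exprS -mulrA; exact: h.
apply: (le_trans (sum_le_backward_recurrence N t0 k01 h)).
by apply: lerD => //; case/andP: (tJ _ (vi N)).
Qed.

Lemma geometric_telescope_le (w : R -> R) (q J v : R) N : 0 < q -> 0 < v ->
  (forall u, 0 < u -> 0 <= w u <= J) ->
  \sum_(i < N) (w (q ^+ i * v) - w (q * (q ^+ i * v))) <= J.
Proof.
move=> q0 v0 wJ; have vi i : 0 < q ^+ i * v by rewrite mulr_gt0// exprn_gt0.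
under eq_bigr do rewrite mulrA -exprS -[_ - _]opprK opprB.
rewrite sumrN -(big_mkord xpredT (fun i => w (q ^+ i.+1 * v) - w (q ^+ i * v))).
rewrite telescope_sumr// opprB.
have := wJ _ (vi 0); have := wJ _ (vi N); lra.
Qed.

(** Since 1 - q^-1 >= 1/2, the gap 1 - k is at least th/2. The constant 10 is twice 1 + 4, after q J
    has been enlarged to q^2 J. *)
Lemma geometric_ratio_bound (x k q J th : R) : 4 <= q -> 0 < th -> 0 <= x -> 0 <= J ->
  k <= 1 - th * (1 - q^-1) -> (1 - k) * x <= q * J + q * (4 * q * J) ->
  x <= 10 * q ^+ 2 / th * J.
Proof.
move=> q4 t0 x0 J0 hk hx; have qp : 0 < q by lra.
have qq : q^-1 <= 2^-1 by rewrite lef_pV2 ?posrE//; lra.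
have hk2 : th * 2^-1 <= 1 - k.
  have : th * (2^-1) <= th * (1 - q^-1) by rewrite ler_wpM2l ?(ltW t0)//; lra.
  lra.
have h1 : th * 2^-1 * x <= (1 - k) * x by rewrite ler_wpM2r.
have h3 : q * J <= q * (q * J) by rewrite ler_wpM2l ?(ltW qp)// ler_peMl//; lra.
have -> : 10 * q ^+ 2 / th * J = th^-1 * (10 * (q * (q * J))) by rewrite expr2; ring.
have h4 : 0 <= q * (q * J) by rewrite !mulr_ge0 ?(ltW qp).
rewrite ler_pdivlMl//; move: hx h1 h3 h4.
have -> : q * (4 * q * J) = 4 * (q * (q * J)) by ring.
move: (q * (q * J)) (q * J) ((1 - k) * x) => a b c; lra.
Qed.

End real_inequalities.

(** * Level sets *)

Section integral_tools.
Context d (T : measurableType d) (R : realType) (mu : {measure set T -> \bar R}).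
Local Open Scope ereal_scope.

(** The integral of a nonnegative function is a supremum over the simple functions below it, hence
    monotone for arbitrary functions. In this way [diffLp] can be integrated in the shift and
    [modulus] in the scale with no measurability proof. *)
Lemma le_ge0_integral (D : set T) (f g : T -> \bar R) :
  (forall x, D x -> 0 <= f x) -> (forall x, D x -> f x <= g x) ->
  \int[mu]_(x in D) f x <= \int[mu]_(x in D) g x.
Proof.
move=> f0 fg; rewrite integral_mkcond [leRHS]integral_mkcond.
rewrite !ge0_integralTE; last 2 first.
- by move=> x; rewrite patchE; case: ifPn => // /set_mem Dx; apply: le_trans (fg x Dx); exact: f0.
- by move=> x; rewrite patchE; case: ifPn => // /set_mem Dx; exact: f0.
apply: le_ereal_sup => _ [h /= hf <-]; exists h => //= x.
apply: le_trans (hf x) _; rewrite !patchE; case: ifPn => // /set_mem Dx; exact: fg.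
Qed.

(** Young's inequality against a constant [a], integrated over [D], then optimised in [a]. *)
Lemma integral_Jensen (D : set T) (u : T -> R) (p v : R) :
  measurable D -> (1 < p)%R -> (0 < v)%R -> mu D <= v%:E ->
  measurable_fun D u -> (forall x, D x -> 0 <= u x)%R ->
  (\int[mu]_(x in D) (u x)%:E) `^ p
    <= (v `^ (p - 1))%:E * \int[mu]_(x in D) (u x `^ p)%:E.
Proof.
move=> mD p1 v0 Dv mu_ u0; have p0 : (0 < p)%R by lra.
have mup : measurable_fun D (fun x => (u x `^ p)%:E).
  by apply/measurable_EFinP; apply: (measurableT_comp (measurable_powR p)).
have mue : measurable_fun D (fun x => (u x)%:E) by apply/measurable_EFinP.
have u0e x : D x -> 0 <= (u x)%:E by move=> /u0; rewrite lee_fin.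
have J0 : 0 <= \int[mu]_(x in D) (u x)%:E by exact: integral_ge0.
have I0 : 0 <= \int[mu]_(x in D) (u x `^ p)%:E.
  by apply: integral_ge0 => x _; rewrite lee_fin powR_ge0.
have key a : (0 < a)%R -> \int[mu]_(x in D) (u x)%:E * (a `^ (p - 1))%:E <=
    \int[mu]_(x in D) (u x `^ p)%:E * (p^-1)%:E + ((1 - p^-1) * a `^ p * v)%:E.
  move=> a0; rewrite -ge0_integralZr//; last by rewrite lee_fin powR_ge0.
  rewrite -ge0_integralZr//; last 2 first.
  - by move=> x _; rewrite lee_fin powR_ge0.
  - by rewrite lee_fin invr_ge0 ltW.
  have pV1 : (0 <= 1 - p^-1)%R by rewrite subr_ge0 invf_le1// ltW.
  apply: (@le_trans _ _ (\int[mu]_(x in D) ((u x `^ p)%:E * (p^-1)%:E +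
      ((1 - p^-1) * a `^ p)%:E))).
    apply: le_ge0_integral => x Dx.
      by rewrite mule_ge0 ?u0e// lee_fin powR_ge0.
    by rewrite -!EFinM -EFinD lee_fin powR_young// u0.
  rewrite ge0_integralD//; last 3 first.
  - by move=> x _; rewrite -EFinM lee_fin mulr_ge0 ?powR_ge0// invr_ge0 ltW.
  - by apply: emeasurable_funM => //; exact: measurable_cst.
  - by move=> x _; rewrite lee_fin mulr_ge0 ?powR_ge0.
  apply: leeD2l; rewrite integral_cst// [leRHS]EFinM lee_wpmul2l// lee_fin mulr_ge0 ?powR_ge0//.
(* If the integral of u^p is infinite the claim is trivial; if it is finite, [key] at a = 1 forces
   the integral of u to be finite. *)
move: I0 J0 key.
case: (\int[mu]_(x in D) (u x `^ p)%:E) => [I I0| _ _ _|//]; last first.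
  by rewrite gt0_muley ?leey// lte_fin powR_gt0.
case: (\int[mu]_(x in D) (u x)%:E) => [J J0|_ /(_ 1%R ltr01)|//]; last first.
  by rewrite powR1 mule1 -EFinM -EFinD leye_eq.
move=> key; rewrite poweR_EFin -EFinM lee_fin.
rewrite !lee_fin in I0 J0.
have [->|Jn0] := eqVneq J 0%R; first by rewrite powR0 ?gt_eqF// mulr_ge0 ?powR_ge0.
have Jp : (0 < J)%R by rewrite lt_neqAle eq_sym Jn0.
(* The optimal constant is the mean of u over a set of measure v. *)
have := key (J / v)%R (divr_gt0 Jp v0).
rewrite -!EFinM -EFinD lee_fin => {key}.
have -> : ((J / v) `^ (p - 1) = J `^ p / J / (v `^ p / v))%R.
  rewrite powRM ?invr_ge0 ?ltW// powRB ?Jn0 ?implybT// powRr1//.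
  by rewrite powR_inv ?ltW// powRB ?(gt_eqF v0) ?implybT// powRr1 ?ltW.
have -> : ((J / v) `^ p = J `^ p / v `^ p)%R.
  by rewrite powRM ?invr_ge0 ?ltW// powR_inv ?ltW.
rewrite powRB ?(gt_eqF v0) ?implybT// powRr1 ?(ltW v0)//.
have vp : (0 < v `^ p)%R by rewrite powR_gt0.
move: vp; set V := (v `^ p)%R; set X := (J `^ p)%R => vp H.
have E1 : (J * (X / J / (V / v)) = X * (v / V))%R by field; rewrite Jn0 !gt_eqF.
have E2 : ((1 - p^-1) * (X / V) * v = (1 - p^-1) * (X * (v / V)))%R by ring.
rewrite E1 E2 in H.
have pV : (0 < p^-1)%R by rewrite invr_gt0.
have H2 : ((X * (v / V)) / p <= I / p)%R by lra.
rewrite ler_pM2r// in H2.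
have -> : (X = (V / v) * (X * (v / V)))%R by field; rewrite !gt_eqF.
by rewrite ler_wpM2l// divr_ge0// ltW.
Qed.

End integral_tools.

(** * Cutting an L^n function at its decreasing rearrangement *)

Section level_sets.
Context d (T : measurableType d) (R : realType) (mu : {measure set T -> \bar R}).
Variables (n : nat) (G : T -> R) (I : R).
Hypotheses (n2 : (2 <= n)%N) (mG : measurable_fun setT G) (G0 : forall x, 0 <= G x).
Hypothesis IG : (\int[mu]_x (G x ^+ n)%:E = I%:E)%E.

Let E (l : R) : set T := [set x | l < G x].

Let mE (l : R) : measurable (E l).
Proof.
rewrite (_ : E l = setT `&` G @^-1` `]l, +oo[%classic); first exact: mG.
by apply/seteqP; split => x; rewrite /E /= in_itv/= andbT => // -[].
Qed.

Let le_mu A B : measurable A -> measurable B -> A `<=` B -> (mu A <= mu B)%E.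
Proof. by move=> mA mB; apply: le_measure; exact: mem_set. Qed.

Let mGn (D : set T) : measurable_fun D (fun x => (G x ^+ n)%:E).
Proof.
by apply/measurable_EFinP; apply: measurable_funX; exact: measurable_funTS.
Qed.

Let Gn0 x : (0 <= (G x ^+ n)%:E)%E. Proof. by rewrite lee_fin exprn_ge0. Qed.

Let I0 : 0 <= I.
Proof. by rewrite -lee_fin -IG; apply: integral_ge0. Qed.

Let chebyshev (l : R) : 0 <= l -> ((l ^+ n)%:E * mu (E l) <= I%:E)%E.
Proof.
move=> l0; rewrite -IG -integral_cst//.
apply: (@le_trans _ _ (\int[mu]_(x in E l) (G x ^+ n)%:E)%E).
  apply: le_ge0_integral => x Ex; rewrite lee_fin ?exprn_ge0//.
  by rewrite lerXn2r// ?nnegrE// ltW.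
exact: ge0_subset_integral.
Qed.

(** This is the decreasing rearrangement of [G] at [v], the generalized inverse of its distribution
    function. *)
Definition level (v : R) : R := inf [set l : R | 0 <= l /\ (mu [set x | (l < G x)%R] <= v%:E)%E].

Let has_inf_level (v : R) : 0 < v -> has_inf [set l : R | 0 <= l /\ (mu (E l) <= v%:E)%E].
Proof.
move=> v0; split; last by exists 0 => l [].
have Iv : 0 <= I / v by rewrite divr_ge0// ltW.
(* Chebyshev works at this height: being at least 1 it is below its n-th power, and its product with
   v is v + I. *)
exists (1 + I / v); split; first by lra.
have := @chebyshev (1 + I / v) ltac:(lra).
set m := mu _ => H.
have l1 : 1 + I / v <= (1 + I / v) ^+ n by rewrite ler_eXnr ?(leq_trans _ n2)//; lra.
have lp : 0 < (1 + I / v) ^+ n by lra.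
have : (((1 + I / v)^+n)%:E * m <= ((1 + I / v)^+n)%:E * v%:E)%E.
  apply: (le_trans H); rewrite -EFinM lee_fin.
  apply: (@le_trans _ _ ((1 + I / v) * v)); last by rewrite ler_wpM2r// ltW.
  by rewrite mulrDl divfK ?gt_eqF//; lra.
by rewrite lee_pmul2l.
Qed.

Lemma level_ge0 (v : R) : 0 < v -> 0 <= level v.
Proof. by move=> /has_inf_level[h _]; apply: lb_le_inf => // l []. Qed.

(** The distribution function is right continuous, by continuity of the measure along increasing
    superlevel sets, so the infimum defining [level] is attained. *)
Lemma measure_gt_level (v : R) : 0 < v -> (mu [set x | (level v < G x)%R] <= v%:E)%E.
Proof.
move=> v0.
have -> : [set x | level v < G x] = \bigcup_k E (level v + k.+1%:R^-1).
  apply/seteqP; split => [x /= h|x [k _]]; last first.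
    by rewrite /E/=; apply: lt_trans; rewrite ltrDl invr_gt0.
  have := h; rewrite -subr_gt0 => h1.
  have [k _ kh] := near_infty_natSinv_lt (PosNum h1).
  by exists k => //; rewrite /E/= -ltrBrDl; exact: (kh k (leqnn k)).
have nd : nondecreasing_seq (fun k => E (level v + k.+1%:R^-1)).
  move=> i j ij; apply/subsetPset => x; rewrite /E/=; apply: le_lt_trans.
  by rewrite lerD2l lef_pV2 ?posrE// ler_nat.
have cv := @nondecreasing_cvg_mu _ _ _ mu _ (fun k => mE (level v + k.+1%:R^-1))
  (bigcup_measurable (fun k _ => mE (level v + k.+1%:R^-1))) nd.
rewrite -(cvg_lim _ cv)//; apply: lime_le; first by apply/cvg_ex; eexists; exact: cv.
apply: nearW => k /=.
have [|l [l0 hl] lk] := @inf_adherent _ _ (k.+1%:R^-1) _ (has_inf_level v0).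
  by rewrite invr_gt0.
apply: le_trans hl; apply: le_mu; [exact: mE|exact: mE|].
by move=> x; rewrite /E/=; apply: lt_trans.
Qed.

Lemma measure_gt_lt_level (v l : R) : 0 <= l -> l < level v -> (v%:E < mu [set x | (l < G x)%R])%E.
Proof.
move=> l0 lv; rewrite ltNge; apply/negP => h.
suff : level v <= l by rewrite leNgt lv.
by apply: ge_inf; [exists 0 => ? []|split].
Qed.

Lemma level_anti (v w : R) : 0 < v -> v <= w -> level w <= level v.
Proof.
move=> v0 vw; apply: lb_le_inf; first by case: (has_inf_level v0).
move=> l [l0 h]; apply: ge_inf; first by exists 0 => ? [].
by split=> //; apply: le_trans h _; rewrite lee_fin.
Qed.

Let lam := level.
Variable q : R.
Hypothesis qE : q = 2 ^+ n.
Let q4 : 4 <= q.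
Proof.
rewrite qE; have -> : (4 : R) = 2 ^+ 2 by ring.
by rewrite ler_weXn2l//; lra.
Qed.
Let q_gt0 : 0 < q. Proof. by have := q4; lra. Qed.
Let q_ge1 : 1 <= q. Proof. by have := q4; lra. Qed.
Let qv_gt0 (v : R) : 0 < v -> 0 < q * v. Proof. exact: mulr_gt0 q_gt0. Qed.

(** Half of a positive level lies strictly below the infimum, so its superlevel set has measure
    greater than v and Chebyshev applies there. The halving costs 2^n. *)
Lemma level_weak_type (v : R) : 0 < v -> lam v ^+ n * v <= 2 ^+ n * I.
Proof.
move=> v0; have l0 := level_ge0 v0.
have [lE|ln0] := eqVneq (lam v) 0.
  by rewrite lE expr0n gtn_eqF ?(leq_trans _ n2)// mul0r mulr_ge0// exprn_ge0.
have lp : 0 < lam v by rewrite lt_neqAle eq_sym ln0.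
have h := @chebyshev (lam v / 2) ltac:(lra).
have h2 := @measure_gt_lt_level v (lam v / 2) ltac:(lra) ltac:(rewrite -/lam; lra).
rewrite -ler_pdivrMl ?exprn_gt0// mulrCA mulrA -exprVn -exprMn.
rewrite -lee_fin EFinM; apply: le_trans h; rewrite lee_wpmul2l// ?(ltW h2)//.
by rewrite lee_fin exprn_ge0//; lra.
Qed.

Let fint (D : set T) (u : T -> R) : R := fine (\int[mu]_(x in D) (u x)%:E)%E.

Let fintK D u (r : R) : (forall x, D x -> 0 <= u x) -> (\int[mu]_(x in D) (u x)%:E <= r%:E)%E ->
  (\int[mu]_(x in D) (u x)%:E)%E = (fint D u)%:E.
Proof.
move=> u0 h; rewrite fineK// ge0_fin_numE; first by rewrite (le_lt_trans h) ?ltry.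
by apply: integral_ge0 => x Dx; rewrite lee_fin u0.
Qed.

Let fint_ge0 D u : (forall x, D x -> 0 <= u x) -> 0 <= fint D u.
Proof. by move=> u0; apply: fine_ge0; apply: integral_ge0 => x /u0; rewrite lee_fin. Qed.

Let W (l : R) := fint (E l) (fun x => G x ^+ n).

Let WE (l : R) : (\int[mu]_(x in E l) (G x ^+ n)%:E)%E = (W l)%:E.
Proof.
apply: (@fintK _ _ I) => [x _|]; first exact: exprn_ge0.
by rewrite -IG; apply: ge0_subset_integral.
Qed.

Let WI (l : R) : W l <= I.
Proof. by rewrite -lee_fin -WE -IG; apply: ge0_subset_integral. Qed.

Let W0 (l : R) : 0 <= W l.
Proof. by apply: fint_ge0 => x _; exact: exprn_ge0. Qed.

Let Jensen_n D (v : R) : measurable D -> 0 < v -> (mu D <= v%:E)%E -> (\int[mu]_(x in D) (G x ^+ n)%:E <= I%:E)%E ->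
  (\int[mu]_(x in D) (G x)%:E = (fint D G)%:E)%E /\
  fint D G ^+ n <= v ^+ n.-1 * fint D (fun x => G x ^+ n).
Proof.
move=> mD v0 Dv DI.
have n1 : 1 < n%:R :> R by rewrite ltr1n.
have := integral_Jensen mD n1 v0 Dv (measurable_funTS mG) (fun x _ => G0 x).
under [X in (_ <= _ * X)%E]eq_integral do rewrite powR_mulrn//.
rewrite (fintK (fun x _ => exprn_ge0 n (G0 x)) DI).
have -> : v `^ (n%:R - 1) = v ^+ n.-1.
  by rewrite -powR_mulrn ?ltW// -subn1 natrB// ltnW.
have J0 : (0 <= \int[mu]_(x in D) (G x)%:E)%E by apply: integral_ge0 => x _; rewrite lee_fin.
rewrite -EFinM => h.
have fin : (\int[mu]_(x in D) (G x)%:E)%E \is a fin_num.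
  rewrite ge0_fin_numE//; apply: (@lty_poweRy _ _ n%:R); first by rewrite gt_eqF// (lt_trans _ n1).
  exact: le_lt_trans h (ltry _).
split; first by rewrite fineK.
by move: h; rewrite -(fineK fin) poweR_EFin lee_fin powR_mulrn// fint_ge0.
Qed.

(** With v = s^n this is the weighted contribution of the high part at scale s, in which the
    exponent p has cancelled. *)
Let t (v : R) := v ^- n.-1 * fint (E (lam v)) G ^+ n.

Let T_fin (v : R) : 0 < v -> (\int[mu]_(x in E (lam v)) (G x)%:E = (fint (E (lam v)) G)%:E)%E
  /\ fint (E (lam v)) G ^+ n <= v ^+ n.-1 * W (lam v).
Proof. by move=> v0; apply: Jensen_n => //; [exact: measure_gt_level|rewrite WE lee_fin]. Qed.

Lemma integral_gt_level_fin (v : R) : 0 < v ->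
  (\int[mu]_(x in [set x | (level v < G x)%R]) (G x)%:E)%E \is a fin_num.
Proof. by move=> v0; rewrite (T_fin v0).1. Qed.

(** Passing from v to q v adds the layer [L] between two levels. It has measure at most q v, so
    Hoelder bounds its L^1 mass by its L^n mass, which is exactly an increment of [W]. *)
Let t_step (v : R) : 0 < v -> t (q * v) <= t v / 2 + 2 ^+ n.-1 * (W (lam (q * v)) - W (lam v)).
Proof.
have hq := q4.
move=> v0; have qv0 := qv_gt0 v0.
have vqv : v <= q * v by rewrite ler_peMl ?ltW//; lra.
have EE : E (lam v) `<=` E (lam (q * v)).
  by move=> x; rewrite /E/=; apply: le_lt_trans; exact: level_anti.
set L := E (lam (q * v)) `\` E (lam v).
have mL : measurable L by exact: measurableD.
have UE : E (lam (q * v)) = E (lam v) `|` L by rewrite setDUK.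
have LI : [disjoint E (lam v) & L] by apply/disj_setPS => x [? []].
have LI' : (\int[mu]_(x in L) (G x ^+ n)%:E <= I%:E)%E.
  by rewrite -IG; apply: ge0_subset_integral.
have WL : fint L (fun x => G x ^+ n) = W (lam (q * v)) - W (lam v).
  have := ge0_integral_setU mu (mE (lam v)) mL (@mGn _) (fun x _ => Gn0 x) LI.
  rewrite -UE WE WE (fintK (fun x _ => exprn_ge0 n (G0 x)) LI') -EFinD => -[->].
  by rewrite addrC addKr.
have muL : (mu L <= (q * v)%:E)%E.
  apply: le_trans (measure_gt_level qv0); apply: le_mu => //; first exact: mE.
  by move=> x [].
have [LG LJ] := Jensen_n mL qv0 muL LI'.
have TE : fint (E (lam (q * v))) G = fint (E (lam v)) G + fint L G.
  have mGE : measurable_fun (E (lam v) `|` L) (fun x => (G x)%:E).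
    by apply/measurable_EFinP; exact: measurable_funTS.
  have G0E x : (E (lam v) `|` L) x -> (0 <= (G x)%:E)%E by rewrite lee_fin.
  have := ge0_integral_setU mu (mE (lam v)) mL mGE G0E LI.
  by rewrite -UE (T_fin qv0).1 (T_fin v0).1 LG -EFinD => -[].
rewrite /t TE -WL; apply: scaled_exprD_le => //; exact: fint_ge0.
Qed.

Lemma sum_integral_gt_level (v : R) N : 0 < v ->
  \sum_(i < N) (q ^+ i * v) ^- n.-1 *
    fine (\int[mu]_(x in [set x | (level (q ^+ i * v) < G x)%R]) (G x)%:E)%E ^+ n
  <= (2 + 2 * 2 ^+ n.-1) * I.
Proof.
move=> v0.
apply: (@geometric_sum_forward R t (fun u => W (lam u)) q _ I) => //.
- move=> u u0; rewrite mulr_ge0 ?invr_ge0 ?exprn_ge0 ?(ltW u0) ?fint_ge0//=.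
  rewrite /t ler_pdivrMl ?exprn_gt0//.
  have [_ /le_trans] := T_fin u0; apply.
  by rewrite ler_wpM2l// exprn_ge0// ltW.
- by move=> u _; rewrite W0 WI.
Qed.

Let V (l : R) := fint setT (fun x => Num.min (G x) l ^+ n).

Let minG0 (l : R) x : 0 <= l -> 0 <= Num.min (G x) l ^+ n.
Proof. by move=> l0; rewrite exprn_ge0// le_min G0. Qed.

Let mminG (l : R) : measurable_fun setT (fun x => (Num.min (G x) l ^+ n)%:E).
Proof.
apply/measurable_EFinP; apply: measurable_funX.
by apply: measurable_minr => //; exact: measurable_cst.
Qed.

Let V_le (l : R) : 0 <= l -> (\int[mu]_x (Num.min (G x) l ^+ n)%:E <= I%:E)%E.
Proof.
move=> l0; rewrite -IG; apply: le_ge0_integral => x _; rewrite lee_fin; first exact: minG0.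
by rewrite lerXn2r ?nnegrE ?le_min ?G0// ge_min lexx.
Qed.

Let VE (l : R) : 0 <= l -> (\int[mu]_x (Num.min (G x) l ^+ n)%:E = (V l)%:E)%E.
Proof. by move=> l0; apply: (@fintK _ _ I) => [x _|]; [exact: minG0|exact: V_le]. Qed.

Let y (v : R) := lam v ^+ n * v.

(** For b <= a the truncated integral [V] grows from b to a by at least (a^n - b^n) times the
    measure of {G > a}. Taking a and b to be half-levels makes this measure at least v, so the
    increment of [V] controls what [y v] exceeds of [q^-1 * y (q * v)]. *)
Let y_step (v : R) : 0 < v ->
  y v <= q^-1 * y (q * v) + (2 ^+ n * V (lam v / 2) - 2 ^+ n * V (lam (q * v) / 2)).
Proof.
have hq := q4.
move=> v0; have qv0 := qv_gt0 v0.
have vqv : v <= q * v by rewrite ler_peMl ?ltW//; lra.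
have ll := level_anti v0 vqv; have l0 := level_ge0 v0; have l0' := level_ge0 qv0.
rewrite -/lam in ll l0 l0'.
set a := lam v / 2; set b := lam (q * v) / 2.
have a0 : 0 <= a by rewrite /a; lra.
have b0 : 0 <= b by rewrite /b; lra.
have ba : b <= a by rewrite /a /b; lra.
have abn : b ^+ n <= a ^+ n by rewrite lerXn2r.
have key : V b + (a ^+ n - b ^+ n) * v <= V a.
  have [aE|an0] := eqVneq a 0.
    have bE : b = 0 by apply/eqP; rewrite eq_le b0 -aE ba.
    by rewrite aE bE subrr mul0r addr0.
  have ap : 0 < a by rewrite lt_neqAle eq_sym an0.
  have va : (v%:E <= mu (E a))%E.
    by apply/ltW/measure_gt_lt_level => //; rewrite /a -/lam; rewrite /a in ap; lra.
  suff : (\int[mu]_x (Num.min (G x) b ^+ n)%:E + (a ^+ n - b ^+ n)%:E * v%:E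
      <= \int[mu]_x (Num.min (G x) a ^+ n)%:E)%E.
    by rewrite (VE a0) (VE b0) -EFinM -EFinD lee_fin.
  apply: (@le_trans _ _ (\int[mu]_x ((Num.min (G x) b ^+ n)%:E +
      (a ^+ n - b ^+ n)%:E * (\1_(E a) x)%:E))%E).
    rewrite ge0_integralD//; last 3 first.
    - by move=> x _; rewrite lee_fin minG0.
    - by move=> x _; rewrite mule_ge0// lee_fin ?subr_ge0.
    - by apply: measurable_funeM; apply/measurable_EFinP; exact: measurable_indic.
    apply: leeD2l; rewrite ge0_integralZl_EFin ?subr_ge0//; last first.
      by apply/measurable_EFinP; exact: measurable_indic.
    by rewrite integral_indic// setIT lee_wpmul2l// lee_fin subr_ge0.
  apply: le_ge0_integral => x _.
    by rewrite adde_ge0 ?mule_ge0// lee_fin ?minG0// subr_ge0.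
  rewrite -EFinM -EFinD lee_fin indicE; case: (boolP (x \in E a)).
    rewrite inE /E/= => ax; rewrite mulr1 !min_r ?(ltW ax) ?(le_trans ba (ltW ax))//.
    by rewrite addrC subrK.
  move=> _; rewrite mulr0 addr0 lerXn2r ?nnegrE ?le_min ?G0//.
  by rewrite ge_min lexx /= ge_min ba orbT.
rewrite /y.
have -> : lam v ^+ n = 2 ^+ n * a ^+ n by rewrite -exprMn /a [2 * _]mulrC divfK.
have -> : lam (q * v) ^+ n = 2 ^+ n * b ^+ n by rewrite -exprMn /b [2 * _]mulrC divfK.
by apply: scaled_telescope_le => //; rewrite gt_eqF// q_gt0.
Qed.

(** A discrete layer-cake formula for the rearrangement. The boundary term and the telescoped
    sources are each at most 2^n I, and dividing by 1 - q^-1 >= 1/2 doubles their sum. *)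
Lemma sum_level_le (v : R) N : 0 < v ->
  \sum_(i < N) y (q ^+ i * v) <= 4 * 2 ^+ n * I.
Proof.
move=> v0; have hq := q4.
have q1 : 0 <= q^-1 <= 1 by rewrite invr_ge0 (ltW q_gt0)/= invf_le1//; lra.
have c0 : 0 <= 2 ^+ n :> R by rewrite exprn_ge0.
have hl u : 0 < u -> 0 <= lam u / 2 by move=> u0; rewrite divr_ge0// level_ge0.
pose w u := 2 ^+ n * V (lam u / 2).
have w01 u : 0 < u -> 0 <= w u <= 2 ^+ n * I.
  move=> u0; rewrite /w mulr_ge0//=; last by apply: fint_ge0 => x _; exact/minG0/hl.
  by rewrite ler_wpM2l// -lee_fin -VE ?V_le ?hl.
have y01 u : 0 < u -> 0 <= y u <= 2 ^+ n * I.
  move=> u0; rewrite /y mulr_ge0 ?exprn_ge0 ?(ltW u0) ?level_ge0//=.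
  exact: level_weak_type.
have := @geometric_sum_backward R y (fun u => w u - w (q * u)) q q^-1 _ _ v N q_gt0 v0 q1
  y01 y_step (geometric_telescope_le N q_gt0 v0 w01).
have qq : q^-1 <= 2^-1 by rewrite lef_pV2 ?posrE//; lra.
have Y0 : 0 <= \sum_(i < N) y (q ^+ i * v).
  by apply: sumr_ge0 => i _; case/andP: (y01 (q ^+ i * v) (mulr_gt0 (exprn_gt0 _ q_gt0) v0)).
have : (\sum_(i < N) y (q ^+ i * v)) / 2 <= (1 - q^-1) * \sum_(i < N) y (q ^+ i * v).
  by rewrite [leLHS]mulrC ler_wpM2r//; lra.
have cI : 0 <= 2 ^+ n * I by rewrite mulr_ge0.
rewrite -[4 * 2 ^+ n * I]mulrA; move: cI Y0.
move: (\sum_(i < N) _) => b; move: ((1 - q^-1) * b) (2 ^+ n * I) => a c.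
by move=> *; lra.
Qed.

Variable p : R.
Hypothesis np : n%:R < p.
Let p0 : 0 < p. Proof. by apply: le_lt_trans np; exact: ler0n. Qed.
Let th : R := 1 - n%:R / p.
Let th01 : 0 < th < 1.
Proof.
have : n%:R / p < 1 by rewrite ltr_pdivrMr// mul1r.
have : 0 < n%:R / p by rewrite divr_gt0// ltr0n (leq_trans _ n2).
by rewrite /th; lra.
Qed.
Let np01 : 0 < n%:R / p <= 1. Proof. by move: th01; rewrite /th; lra. Qed.

Let F (l : R) : set T := [set x | G x <= l].
Let mF (l : R) : measurable (F l).
Proof.
rewrite (_ : F l = ~` E l); first exact: measurableC.
by apply/seteqP; split => x; rewrite /F /E/= leNgt => /negP.
Qed.
Let S (l : R) := fint (F l) (fun x => G x `^ p).
Let mGp D : measurable_fun D (fun x => (G x `^ p)%:E).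
Proof.
apply/measurable_EFinP; apply: (measurableT_comp (measurable_powR p)).
exact: measurable_funTS.
Qed.
Let Gp0 x : (0 <= (G x `^ p)%:E)%E. Proof. by rewrite lee_fin powR_ge0. Qed.

Lemma integral_powR_le_level (l : R) : 0 <= l ->
  (\int[mu]_(x in F l) (G x `^ p)%:E <= (l `^ (p - n%:R) * I)%:E)%E.
Proof.
move=> l0; rewrite EFinM -IG -ge0_integralZl_EFin ?powR_ge0//.
apply: (@le_trans _ _ (\int[mu]_(x in F l) ((l `^ (p - n%:R))%:E * (G x ^+ n)%:E))%E).
  apply: le_ge0_integral => x; rewrite /F/= => Gl; first exact: Gp0.
  rewrite -EFinM lee_fin -[leLHS](_ : G x `^ (p - n%:R) * G x ^+ n = _).
    by rewrite ler_wpM2r ?exprn_ge0// ge0_ler_powR ?nnegrE// subr_ge0 ltW.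
  rewrite -powR_mulrn// -powRD ?subrK//; apply/implyP; rewrite gt_eqF//.
apply: ge0_subset_integral => //.
- exact: measurable_funeM.
- by move=> x _; rewrite mule_ge0// lee_fin powR_ge0.
Qed.

Let SE (l : R) : 0 <= l -> (\int[mu]_(x in F l) (G x `^ p)%:E = (S l)%:E)%E.
Proof.
by move=> l0; apply: (fintK _ (integral_powR_le_level l0)) => x _; exact: powR_ge0.
Qed.
Let S0 (l : R) : 0 <= S l. Proof. by apply: fint_ge0 => x _; exact: powR_ge0. Qed.

(** The difference comes from the layer between the two levels, where G is at most [lam v] and whose
    measure is at most q v. *)
Let S_step (v : R) : 0 < v -> S (lam v) <= S (lam (q * v)) + lam v `^ p * (q * v).
Proof.
have hq := q4.
move=> v0; have qv0 := qv_gt0 v0.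
have vqv : v <= q * v by rewrite ler_peMl ?ltW//; lra.
have ll := level_anti v0 vqv; have l0 := level_ge0 v0; have l0' := level_ge0 qv0.
have UE : F (lam v) = F (lam (q * v)) `|` (F (lam v) `\` F (lam (q * v))).
  by rewrite setDUK// => x; rewrite /F/= => /le_trans; apply.
have mD : measurable (F (lam v) `\` F (lam (q * v))) by exact: measurableD.
have dD : [disjoint F (lam (q * v)) & F (lam v) `\` F (lam (q * v))].
  by apply/disj_setPS => x [? []].
suff : (\int[mu]_(x in F (lam v)) (G x `^ p)%:E <=
    \int[mu]_(x in F (lam (q * v))) (G x `^ p)%:E + (lam v `^ p * (q * v))%:E)%E.
  by rewrite (SE l0) (SE l0') -EFinD lee_fin.
have := ge0_integral_setU mu (mF (lam (q * v))) mD (@mGp _) (fun x _ => Gp0 x) dD.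
rewrite -UE => ->.
apply: leeD2l.
apply: (@le_trans _ _ (\int[mu]_(x in F (lam v) `\` F (lam (q * v))) (lam v `^ p)%:E)%E).
  apply: le_ge0_integral => x [Fx _]; first exact: Gp0.
  by rewrite lee_fin ge0_ler_powR ?nnegrE// ?(ltW p0)//.
rewrite (integral_cst mu mD) EFinM lee_wpmul2l ?lee_fin ?powR_ge0//.
apply: le_trans (measure_gt_level qv0); apply: le_mu; [exact: measurableD|exact: mE|].
by move=> x [_]; rewrite /F/= => /negP; rewrite -ltNge.
Qed.

Let sg (v : R) := v `^ th * S (lam v) `^ (n%:R / p).

(** The power n/p <= 1 is subadditive, so [S_step] survives it. The exponents th and n/p add up to
    1, so the source is lam(v)^n v up to the factor q^(n/p) <= q. *)
Let sg_step (v : R) : 0 < v -> sg v <= (q^-1) `^ th * sg (q * v) + q * y v.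
Proof.
have hq := q4.
move=> v0; have qv0 := qv_gt0 v0.
have qp := q_gt0.
have l0 := level_ge0 v0; rewrite -/lam in l0.
have /andP[r0 r1] := np01.
have h : S (lam v) `^ (n%:R / p) <= S (lam (q * v)) `^ (n%:R / p) +
    lam v ^+ n * (q `^ (n%:R / p) * v `^ (n%:R / p)).
  apply: (@le_trans _ _ ((S (lam (q * v)) + lam v `^ p * (q * v)) `^ (n%:R / p))).
    rewrite ge0_ler_powR ?nnegrE ?(ltW r0) ?S_step//.
    by rewrite addr_ge0// mulr_ge0 ?powR_ge0 ?(ltW qv0).
  apply: (le_trans (powR_subadd (S0 _) _ np01)); first by rewrite mulr_ge0 ?powR_ge0 ?(ltW qv0).
  rewrite lerD2l [leLHS]powRM ?powR_ge0 ?(ltW qv0)// [(q * v) `^ _]powRM ?(ltW v0) ?(ltW qp)//.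
  by rewrite -powRrM [p * _]mulrC divfK ?gt_eqF// powR_mulrn.
rewrite /sg; apply: (le_trans (ler_wpM2l (powR_ge0 v th) h)).
rewrite mulrDr; apply: lerD.
  rewrite mulrA -powRM ?invr_ge0 ?(ltW qp) ?(ltW qv0)//.
  by rewrite mulrA mulVf ?gt_eqF// mul1r.
have vE : v `^ th * v `^ (n%:R / p) = v.
  by rewrite -powRD ?(gt_eqF v0) ?implybT// /th subrK powRr1// ltW.
have -> : v `^ th * (lam v ^+ n * (q `^ (n%:R / p) * v `^ (n%:R / p))) =
   q `^ (n%:R / p) * (lam v ^+ n * (v `^ th * v `^ (n%:R / p))) by ring.
rewrite vE ler_wpM2r ?mulr_ge0 ?exprn_ge0 ?(ltW v0)//.
by rewrite ler1_powR// q_ge1.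
Qed.

(** Interpolation: the weak-type bound enters with exponent th and the L^n integral with exponent
    n/p. This is the boundary value required by the backward recurrence. *)
Let sg_le (v : R) : 0 < v -> sg v <= 2 ^+ n * I.
Proof.
have hq := q4.
move=> v0; have l0 := level_ge0 v0; rewrite -/lam in l0.
have /andP[r0 r1] := np01; have /andP[t0 t1] := th01.
have h : S (lam v) <= lam v `^ (p - n%:R) * I.
  by rewrite -lee_fin -SE//; exact: integral_powR_le_level.
have h2 : S (lam v) `^ (n%:R / p) <= lam v `^ (n%:R * th) * I `^ (n%:R / p).
  have -> : lam v `^ (n%:R * th) * I `^ (n%:R / p) = (lam v `^ (p - n%:R) * I) `^ (n%:R / p).
    rewrite powRM ?powR_ge0// -powRrM; congr (_ `^ _ * _).
    by rewrite /th; field; rewrite gt_eqF.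
  by apply: ge0_ler_powR; rewrite ?nnegrE ?(ltW r0) ?S0 ?mulr_ge0 ?powR_ge0 ?I0.
rewrite /sg; apply: (le_trans (ler_wpM2l (powR_ge0 v th) h2)).
rewrite mulrA powRrM powR_mulrn// -powRM ?exprn_ge0 ?(ltW v0)//.
have hw := level_weak_type v0; rewrite mulrC in hw.
have J0 : 0 <= 2 ^+ n * I by rewrite mulr_ge0// exprn_ge0.
have IJ : I <= 2 ^+ n * I by rewrite ler_peMl// -qE q_ge1.
apply: (@le_trans _ _ ((2 ^+ n * I) `^ th * (2 ^+ n * I) `^ (n%:R / p))).
  rewrite ler_pM ?powR_ge0//.
    by rewrite ge0_ler_powR ?nnegrE ?mulr_ge0 ?exprn_ge0 ?(ltW v0) ?(ltW t0).
  by rewrite ge0_ler_powR ?nnegrE ?(ltW r0).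
by rewrite -powRD /th subrK ?powRr1// oner_eq0.
Qed.

Lemma sum_integral_le_level (v : R) N : 0 < v ->
  \sum_(i < N) (q ^+ i * v) `^ (1 - n%:R / p) *
    fine (\int[mu]_(x in [set x | (G x <= level (q ^+ i * v))%R]) (G x `^ p)%:E)%E `^ (n%:R / p)
  <= 10 * q ^+ 2 / (1 - n%:R / p) * I.
Proof.
have hq := q4.
move=> v0; have /andP[t0 t1] := th01; have qp := q_gt0.
have qV : 0 < q^-1 <= 1 by rewrite invr_gt0 qp invf_le1//; lra.
(* The ratio of the recurrence tends to 1 as p tends to n; this lower bound on its distance from 1
   is the origin of (1 - n/p)^-1. *)
have hk := powR_le_affine qV th01.
have q1 : 0 <= (q^-1) `^ th <= 1.
  by rewrite powR_ge0/= (le_trans hk)// gerBl mulr_ge0 ?(ltW t0)//; lra.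
have sg01 u : 0 < u -> 0 <= sg u <= 2 ^+ n * I.
  by move=> u0; rewrite mulr_ge0 ?powR_ge0//= sg_le.
have hY : \sum_(i < N) q * y (q ^+ i * v) <= q * (4 * 2 ^+ n * I).
  by rewrite -mulr_sumr ler_wpM2l ?(ltW qp)// sum_level_le.
have := @geometric_sum_backward R sg (fun u => q * y u) q _ _ _ v N qp v0 q1 sg01 sg_step hY.
have X0 : 0 <= \sum_(i < N) sg (q ^+ i * v).
  by apply: sumr_ge0 => i _; case/andP: (sg01 (q ^+ i * v) (mulr_gt0 (exprn_gt0 _ qp) v0)).
rewrite -qE => hX; exact: (geometric_ratio_bound hq t0 X0 I0 hk hX).
Qed.

End level_sets.

(** * Lebesgue measure on tuples *)

Section tuple_sigma_algebra.
Context {R : realType} {n : nat}.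
Notation Rn := (n.-tuple R).

Definition box (a b : 'I_n -> R) : set Rn := [set x | forall i, a i <= tnth x i < b i].

Lemma measurable_forall_tnth d (T : measurableType d) (P : 'I_n -> T -> Prop) :
  (forall i, measurable [set x | P i x]) -> measurable [set x | forall i, P i x].
Proof.
move=> mP; rewrite (_ : [set x | _] = \bigcap_(i in setT) [set x | P i x]).
  by apply: fin_bigcap_measurable => //; exact: finite_finset.
by apply/seteqP; split => x /= h i; [move=> _|]; exact: h.
Qed.

Lemma measurable_box a b : measurable (box a b).
Proof.
apply: measurable_forall_tnth => i.
rewrite (_ : [set x | _] = setT `&` (fun x : Rn => tnth x i) @^-1` `[a i, b i[%classic).
  by apply: measurable_tnth.
by apply/seteqP; split => x /=; rewrite in_itv/=; [|case].
Qed.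

Let boxes : set (set Rn) := [set A | exists a b, A = box a b].

Let bound_gt (x : Rn) i : `|tnth x i| < (Num.bound (\sum_j `|tnth x j|))%:R.
Proof.
apply: le_lt_trans (archi_boundP _); last by apply: sumr_ge0.
by rewrite (bigD1 i)//= lerDl sumr_ge0.
Qed.

Lemma bigcup_cube : \bigcup_k box (fun=> - k%:R) (fun=> k%:R) = [set: Rn].
Proof.
apply/seteqP; split=> // x _; exists (Num.bound (\sum_j `|tnth x j|)) => // i.
by have := bound_gt x i; rewrite ltr_norml => /andP[/ltW -> ->].
Qed.

(** The hypothesis [is_lebesgue_n] prescribes the measure on boxes, a family closed under
    intersection; this identity makes uniqueness of measures applicable to them. *)
Lemma measurable_boxesE : @measurable _ Rn = <<s boxes >>.
Proof.
apply/seteqP; split; last first.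
  apply: smallest_sub; first exact: sigma_algebra_measurable.
  by move=> _ [a [b ->]]; exact: measurable_box.
apply: smallest_sub; first exact: smallest_sigma_algebra.
move=> A; rewrite -bigcup_seq => -[i /= _ [B mB <-]].
have : measurable_fun (setT : set (g_sigma_algebraType boxes)) (fun x : Rn => tnth x i).
  apply: (measurability (@RGenCInfty.G R)); first exact: RGenCInfty.measurableE.
  move=> _ [_ [r ->] <-].
  (* A half-space is exhausted by boxes that keep one face on its boundary. *)
  rewrite (_ : _ `&` _ = \bigcup_k box (fun j => if j == i then r else - k%:R) (fun=> k%:R)).
    apply: bigcup_measurable => k _; apply: sub_sigma_algebra.
    by exists (fun j => if j == i then r else - k%:R), (fun=> k%:R).
  apply/seteqP; split => [x [_ /=]|x [k _ h]].
    rewrite in_itv/= andbT => rx; exists (Num.bound (\sum_j `|tnth x j|)) => // j.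
    have := bound_gt x j; rewrite ltr_norml => /andP[/ltW lj ->]; rewrite andbT.
    by case: eqP => [->|].
  by split => //=; rewrite in_itv/= andbT; have := h i; rewrite eqxx => /andP[].
by apply.
Qed.

Lemma boxes_setI : setI_closed boxes.
Proof.
move=> _ _ [a [b ->]] [c [e ->]].
exists (fun i => Num.max (a i) (c i)), (fun i => Num.min (b i) (e i)).
apply/seteqP; split => [x [h1 h2] i|x h].
  by have := h1 i; have := h2 i; rewrite ge_max lt_min => /andP[-> ->] /andP[-> ->].
by split=> i; have := h i; rewrite ge_max lt_min => /andP[/andP[? ?] /andP[? ?]]; apply/andP.
Qed.

Definition tmove (x : Rn) (s : R) (w : Rn) : Rn := [tuple tnth x i + s * tnth w i | i < n].

Lemma tnth_tmove x s w i : tnth (tmove x s w) i = tnth x i + s * tnth w i.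
Proof. by rewrite tnth_mktuple. Qed.

Lemma rowt_tmove x s w : rowt (tmove x s w) = rowt x + s *: rowt w.
Proof. by apply/rowP => i; rewrite !mxE tnth_tmove. Qed.

Lemma measurable_tmove2 s : measurable_fun setT (fun z : Rn * Rn => tmove z.1 s z.2).
Proof.
apply/measurable_fun_tnthP => i.
rewrite (_ : _ \o _ = (fun z : Rn * Rn => tnth z.1 i + s * tnth z.2 i)); last first.
  by apply/funext => z /=; rewrite tnth_tmove.
apply: measurable_funD.
  exact: (measurableT_comp (measurable_tnth i) measurable_fst).
apply: measurable_funM => //.
exact: (measurableT_comp (measurable_tnth i) measurable_snd).
Qed.

Lemma measurable_tmove x s : measurable_fun setT (tmove x s).
Proof.
exact: (measurableT_comp (measurable_tmove2 s) (pair1_measurable x)).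
Qed.

Lemma measurable_tmovel s w : measurable_fun setT (fun x => tmove x s w).
Proof.
exact: (measurableT_comp (measurable_tmove2 s) (pair2_measurable w)).
Qed.

End tuple_sigma_algebra.

(** * Translations, dilations, Tonelli and cubes for Lebesgue measure *)

Section lebesgue_tuple.
Context {R : realType} {n : nat}.
Notation Rn := (n.-tuple R).
Variable mu : {measure set Rn -> \bar R}.
Hypothesis muL : is_lebesgue_n mu.
Local Open Scope ereal_scope.

Lemma sigma_finite_lebesgue_n : sigma_finite setT mu.
Proof.
exists (fun k => box (fun=> - k%:R)%R (fun=> k%:R)%R); first by rewrite bigcup_cube.
move=> k; split; first exact: measurable_box.
rewrite muL ?ltry// => i; have := ler0n R k; lra.
Qed.

Let nu : {sigma_finite_measure set Rn -> \bar R} :=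
  HB.pack_for (SigmaFiniteMeasure.type Rn R) (Measure.sort mu)
    (isSFinite.Build _ _ _ _ (sfinite_measure_sigma_finite sigma_finite_lebesgue_n))
    (isSigmaFinite.Build _ _ _ _ sigma_finite_lebesgue_n).

Lemma tonelli_lebesgue_n (F : Rn * Rn -> \bar R) : measurable_fun setT F ->
  (forall z, 0 <= F z) -> \int[mu]_x \int[mu]_y F (x, y) = \int[mu]_y \int[mu]_x F (x, y).
Proof. by move=> mF F0; exact: (@fubini_tonelli _ _ _ _ R nu nu). Qed.

Lemma measurable_int_lebesgue_n d (T : measurableType d) (F : T * Rn -> \bar R) :
  measurable_fun setT F -> (forall z, 0 <= F z) ->
  measurable_fun setT (fun x => \int[mu]_y F (x, y)).
Proof. by move=> mF F0; exact: (@measurable_fun_fubini_tonelli_F _ _ _ _ R nu). Qed.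

(** Both sides are measures in [A], finite on the exhausting cubes, and they agree on boxes. *)
Lemma mu_tmove x (s : R) A : (0 < s)%R -> measurable A ->
  mu (tmove x s @^-1` A) = (s ^- n)%:E * mu A.
Proof.
move=> s0 mA.
have sn0 : (0 <= s ^- n)%R by rewrite invr_ge0 exprn_ge0// ltW.
pose m : {measure set Rn -> \bar R} :=
  pushforward mu (tmove x s).
pose m1 := m (measurable_tmove x s).
pose m2 : {measure set Rn -> \bar R} := mscale (NngNum sn0) mu.
suff : m1 A = m2 A by [].
apply: (@measure_unique _ _ _ _ (fun k => box (fun=> - k%:R)%R (fun=> k%:R)%R)
  measurable_boxesE boxes_setI) => //.
- by move=> k; exists (fun=> - k%:R)%R, (fun=> k%:R)%R.
- exact: bigcup_cube.
- move=> _ [a [b ->]].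
  change (mu (tmove x s @^-1` box a b) = (s ^- n)%:E * mu (box a b)).
  have -> : tmove x s @^-1` box a b =
      box (fun i => (a i - tnth x i) / s)%R (fun i => (b i - tnth x i) / s)%R.
    apply/seteqP; split => w /= h i; move: (h i); rewrite tnth_tmove;
      by rewrite ler_pdivrMr// ltr_pdivlMr// lerBlDl ltrBrDl [(tnth w i * s)%R]mulrC.
  (* The volume formula is given for ordered endpoints only; the remaining boxes are empty, and so
     are their preimages. *)
  have [ab|/existsNP[i /negP]] := pselect (forall i, a i <= b i)%R; last first.
    rewrite -ltNge => ba.
    have empty a' b' : (b' i < a' i)%R -> box a' b' = set0 :> set Rn.
      move=> h; apply/seteqP; split => // y /(_ i) /andP[h1 h2].
      by have := lt_trans (le_lt_trans h1 h2) h; rewrite ltxx.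
    rewrite !empty// ?measure0 ?mule0//.
    by rewrite ltr_pM2r ?invr_gt0// ltrD2r.
  rewrite !muL// => [|i]; last by rewrite ler_pM2r ?invr_gt0// lerD2r.
  rewrite -EFinM; congr EFin.
  rewrite (eq_bigr (fun i => s^-1 * (b i - a i))%R); last first.
    by move=> i _; field; rewrite gt_eqF.
  by rewrite big_split/= prodr_const card_ord exprVn.
- move=> k.
  change (mu (tmove x s @^-1` box (fun=> - k%:R)%R (fun=> k%:R)%R) < +oo).
  have -> : tmove x s @^-1` box (fun=> - k%:R)%R (fun=> k%:R)%R =
      box (fun i => (- k%:R - tnth x i) / s)%R (fun i => (k%:R - tnth x i) / s)%R.
    apply/seteqP; split => w /= h i; move: (h i); rewrite tnth_tmove;
      by rewrite ler_pdivrMr// ltr_pdivlMr// lerBlDl ltrBrDl [(tnth w i * s)%R]mulrC.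
  rewrite muL ?ltry// => i; rewrite ler_pM2r ?invr_gt0// lerD2r.
  by have := ler0n R k; lra.
Qed.

Lemma int_tmove x (s : R) (F : Rn -> \bar R) : (0 < s)%R -> measurable_fun setT F ->
  (forall y, 0 <= F y) -> \int[mu]_w F (tmove x s w) = (s ^- n)%:E * \int[mu]_y F y.
Proof.
move=> s0 mF F0; have sn0 : (0 <= s ^- n)%R by rewrite invr_ge0 exprn_ge0// ltW.
pose m : {measure set Rn -> \bar R} :=
  pushforward mu (tmove x s).
transitivity (\int[m (measurable_tmove x s)]_y F y).
  by rewrite (ge0_integral_pushforward (measurable_tmove x s)).
rewrite -(@ge0_integral_mscale _ _ _ _ setT measurableT (NngNum sn0) F)//.
by apply: eq_measure_integral => A mA _; exact: mu_tmove.
Qed.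

Lemma int_shift (s : R) w (F : Rn -> \bar R) : measurable_fun setT F ->
  (forall y, 0 <= F y) -> \int[mu]_x F (tmove x s w) = \int[mu]_y F y.
Proof.
move=> mF F0.
under eq_integral => x _.
  (* The inner point is s w, so the translation of x becomes a dilation by 1 about s w. *)
  rewrite (_ : tmove x s w = tmove (tmove w (s - 1) w) 1 x); last first.
    by apply: eq_from_tnth => i; rewrite !tnth_tmove; ring.
  over.
by rewrite int_tmove// expr1n invr1 mul1e.
Qed.

(** The half-side 4 s leaves room for a spline kernel supported in x + [0, 3 s]^n and for one whose
    corner has moved by at most s in each coordinate. *)
Definition cube (s : R) (x : Rn) : set Rn :=
  [set y | forall i, (`|tnth y i - tnth x i| <= 4 * s)%R].

Lemma measurable_cube2 (s : R) : measurable [set z : Rn * Rn | cube s z.1 z.2].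
Proof.
apply: measurable_forall_tnth => i.
have mf : measurable_fun setT (fun z : Rn * Rn => `|tnth z.2 i - tnth z.1 i|%R).
  apply: measurableT_comp => //; apply: measurable_funB.
    exact: (measurableT_comp (measurable_tnth i) measurable_snd).
  exact: (measurableT_comp (measurable_tnth i) measurable_fst).
rewrite (_ : [set x | _] = setT `&` (fun z : Rn * Rn => `|tnth z.2 i - tnth z.1 i|%R)
   @^-1` `]-oo, (4 * s)%R]%classic); first exact: mf.
by apply/seteqP; split => x /=; rewrite in_itv/=; [|case].
Qed.

Lemma measurable_cube s x : measurable (cube s x).
Proof.
rewrite (_ : cube s x = setT `&` (pair x) @^-1` [set z | cube s z.1 z.2]).
  by apply: (pair1_measurable x) => //; exact: measurable_cube2.
by rewrite setTI.
Qed.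

Lemma cube_sym s x y : cube s x y = cube s y x.
Proof. by apply/propext; split=> h i; rewrite distrC. Qed.

(** The measure is known on half-open boxes, so the closed cube of side 8 s is enclosed in one of
    side 9 s. *)
Lemma mu_cube (s : R) x : (0 < s)%R -> mu (cube s x) <= ((9 * s) ^+ n)%:E.
Proof.
move=> s0; rewrite [leRHS](_ : _ = mu (box (fun i => tnth x i - 4 * s)%R (fun i => tnth x i + 5 * s)%R)).
  apply: le_measure; rewrite ?inE; [exact: measurable_cube|exact: measurable_box|].
  move=> y h i; have := h i; rewrite ler_norml; lra.
rewrite muL => [|i]; last by lra.
congr EFin; rewrite (eq_bigr (fun=> 9 * s)%R) ?prodr_const ?card_ord// => i _; ring.
Qed.

Lemma integral_cubeE s x (u : Rn -> \bar R) :
  \int[mu]_(y in cube s x) u y =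
  \int[mu]_y (u y * (\1_[set z : Rn * Rn | cube s z.1 z.2] (x, y))%:E).
Proof.
rewrite integral_mkcond; apply: eq_integral => y _; rewrite patchE indicE.
have -> : ((x, y) \in [set z : Rn * Rn | cube s z.1 z.2]) = (y \in cube s x).
  by apply/idP/idP; rewrite !inE.
by case: ifP => _; rewrite ?mule1 ?mule0.
Qed.

Let mcubeF s (u : Rn -> \bar R) : measurable_fun setT u ->
  measurable_fun setT (fun z : Rn * Rn =>
    u z.2 * (\1_[set z : Rn * Rn | cube s z.1 z.2] z)%:E).
Proof.
move=> mu_; apply: emeasurable_funM.
  exact: (measurableT_comp mu_ measurable_snd).
by apply/measurable_EFinP; apply: measurable_indic; exact: measurable_cube2.
Qed.

Lemma measurable_integral_cube s (u : Rn -> \bar R) : measurable_fun setT u ->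
  (forall y, 0 <= u y) -> measurable_fun setT (fun x => \int[mu]_(y in cube s x) u y).
Proof.
move=> mu_ u0; under eq_fun do rewrite integral_cubeE.
apply: (measurable_int_lebesgue_n (mcubeF s mu_)) => z.
by rewrite mule_ge0// lee_fin.
Qed.

(** Membership in a cube is symmetric in the point and the centre, so exchanging the integrals
    leaves the measure of a cube around y. *)
Lemma tonelli_cube (s : R) (u : Rn -> \bar R) : (0 < s)%R -> measurable_fun setT u ->
  (forall y, 0 <= u y) ->
  \int[mu]_x \int[mu]_(y in cube s x) u y <= ((9 * s) ^+ n)%:E * \int[mu]_y u y.
Proof.
move=> s0 mu_ u0; under eq_integral do rewrite integral_cubeE.
rewrite (tonelli_lebesgue_n (mcubeF s mu_)); last by move=> z; rewrite mule_ge0// lee_fin.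
have c0 : (0 <= (9 * s) ^+ n)%R by rewrite exprn_ge0// mulr_ge0// ltW.
rewrite -ge0_integralZl_EFin//; apply: le_ge0_integral => y _.
  by apply: integral_ge0 => x _; rewrite mule_ge0// lee_fin.
rewrite /= ge0_integralZl//; last first.
  apply: (measurableT_comp (f := fun z => (\1_[set z : Rn * Rn | cube s z.1 z.2] z)%:E)
    _ (pair2_measurable y)).
  by apply/measurable_EFinP; apply: measurable_indic; exact: measurable_cube2.
rewrite muleC lee_wpmul2r//.
rewrite (_ : \int[mu]_x _ = mu (cube s y)); first exact: mu_cube.
rewrite -[RHS]mul1e -(integral_cst _ (measurable_cube s y)) integral_cubeE.
apply: eq_integral => x _; rewrite mul1e !indicE; congr (_%:R%:E)%R.
by congr nat_of_bool; apply/idP/idP; rewrite !inE /= cube_sym.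
Qed.

End lebesgue_tuple.

(** * Averages over cubes *)

Section averages.
Context {R : realType} {n : nat}.
Notation Rn := (n.-tuple R).
Variable mu : {measure set Rn -> \bar R}.
Hypothesis muL : is_lebesgue_n mu.
Local Open Scope ereal_scope.

(* Normalized by [s ^+ n], not by the volume [(8 * s) ^+ n] of the cube. *)
Definition avg (s : R) (u : Rn -> R) (x : Rn) : \bar R :=
  (s ^- n)%:E * \int[mu]_(y in cube s x) (u y)%:E.

Lemma avg_ge0 (s : R) (u : Rn -> R) x : (0 < s)%R -> (forall y, 0 <= u y)%R -> 0 <= avg s u x.
Proof.
move=> s0 u0; apply: mule_ge0; first by rewrite lee_fin invr_ge0 exprn_ge0// ltW.
by apply: integral_ge0 => y _; rewrite lee_fin.
Qed.

Lemma measurable_avg (s : R) (u : Rn -> R) : (forall y, 0 <= u y)%R -> measurable_fun setT u ->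
  measurable_fun setT (avg s u).
Proof.
move=> u0 mu_; apply: measurable_funeM; apply: (measurable_integral_cube muL) => //.
by apply/measurable_EFinP.
Qed.

Lemma avgD (s : R) (u v : Rn -> R) x : (0 < s)%R -> (forall y, 0 <= u y)%R -> (forall y, 0 <= v y)%R ->
  measurable_fun setT u -> measurable_fun setT v ->
  avg s (u \+ v)%R x = avg s u x + avg s v x.
Proof.
move=> s0 u0 v0 mu_ mv; rewrite /avg -ge0_muleDr; last 2 first.
- by apply: integral_ge0 => y _; rewrite lee_fin.
- by apply: integral_ge0 => y _; rewrite lee_fin.
congr (_ * _); rewrite -ge0_integralD//; first exact: measurable_cube.
- by move=> y _; rewrite lee_fin.
- by apply/measurable_EFinP; exact: measurable_funTS.
- by move=> y _; rewrite lee_fin.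
- by apply/measurable_EFinP; exact: measurable_funTS.
Qed.

Lemma integral_avg (s : R) (u : Rn -> R) : (0 < s)%R -> (forall y, 0 <= u y)%R -> measurable_fun setT u ->
  \int[mu]_x avg s u x <= (9 ^+ n)%:E * \int[mu]_y (u y)%:E.
Proof.
move=> s0 u0 mu_.
have mue : measurable_fun setT (fun y => (u y)%:E) by apply/measurable_EFinP.
have ue0 y : 0 <= (u y)%:E by rewrite lee_fin.
have sn0 : (0 <= s ^- n)%R by rewrite invr_ge0 exprn_ge0// ltW.
rewrite ge0_integralZl_EFin//; last 2 first.
- by move=> x _; apply: integral_ge0.
- exact: (measurable_integral_cube muL).
apply: (le_trans (lee_wpmul2l _ (tonelli_cube muL s0 mue ue0))); first by rewrite lee_fin.
rewrite muleA -EFinM exprMn mulrCA mulVf ?mulr1//.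
by rewrite expf_neq0// gt_eqF.
Qed.

Lemma integral_avg_powR (s p : R) (u : Rn -> R) : (0 < s)%R -> (1 < p)%R -> (forall y, 0 <= u y)%R ->
  measurable_fun setT u ->
  \int[mu]_x (avg s u x) `^ p <= ((9 ^+ n) `^ p)%:E * \int[mu]_y (u y `^ p)%:E.
Proof.
move=> s0 p1 u0 mu_.
have mup : measurable_fun setT (fun y => (u y `^ p)%:E).
  by apply/measurable_EFinP; apply: (measurableT_comp (measurable_powR p)).
have up0 y : 0 <= (u y `^ p)%:E by rewrite lee_fin powR_ge0.
have sn0 : (0 <= s ^- n)%R by rewrite invr_ge0 exprn_ge0// ltW.
have V0 : (0 < (9 * s) ^+ n)%R by rewrite exprn_gt0// mulr_gt0.
pose c : R := ((s ^- n) `^ p * ((9 * s) ^+ n) `^ (p - 1))%R.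
have c0 : (0 <= c)%R by rewrite mulr_ge0 ?powR_ge0.
apply: (@le_trans _ _ (\int[mu]_x (c%:E * \int[mu]_(y in cube s x) (u y `^ p)%:E))).
  apply: le_ge0_integral => x _; first exact: poweR_ge0.
  rewrite /avg poweRM; last 2 first.
  - by rewrite lee_fin.
  - by apply: integral_ge0 => y _; rewrite lee_fin.
  rewrite poweR_EFin EFinM -muleA; apply: lee_wpmul2l; first by rewrite lee_fin powR_ge0.
  apply: integral_Jensen => //; [exact: measurable_cube|exact: mu_cube|exact: measurable_funTS].
rewrite ge0_integralZl_EFin//; last 2 first.
- by move=> x _; apply: integral_ge0.
- exact: (measurable_integral_cube muL).
apply: (le_trans (lee_wpmul2l _ (tonelli_cube muL s0 mup up0))); first by rewrite lee_fin.
rewrite muleA -EFinM /c -mulrA [(_ `^ (p - 1) * _)%R]mulrC mulr_powRB1 ?(ltW V0)//; last by lra.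
rewrite -powRM ?(ltW V0)// exprMn mulrCA mulVf ?mulr1//.
by rewrite expf_neq0// gt_eqF.
Qed.

End averages.

(** * L^p norms of the averages of an L^n function *)

Section averages_of_Ln.
Context {R : realType} {n : nat}.
Notation Rn := (n.-tuple R).
Variable mu : {measure set Rn -> \bar R}.
Hypothesis muL : is_lebesgue_n mu.
Variables (G : Rn -> R) (I p : R).
Hypotheses (n2 : (2 <= n)%N) (mG : measurable_fun setT G) (G0 : forall x, 0 <= G x).
Hypothesis IG : (\int[mu]_x (G x ^+ n)%:E = I%:E)%E.
Hypothesis np : n%:R < p.
Local Open Scope ereal_scope.

Let lev (s : R) : R := level mu G (s ^+ n).
(** The cut is the rearrangement at s^n, so dyadic scales become a geometric progression of ratio
    2^n in the level-set estimates. *)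
Definition low_part (s : R) : R :=
  fine (\int[mu]_(x in [set x | (G x <= level mu G (s ^+ n))%R]) (G x `^ p)%:E).
Definition high_part (s : R) : R :=
  fine (\int[mu]_(x in [set x | (level mu G (s ^+ n) < G x)%R]) (G x)%:E).

Let p1 : (1 < p)%R.
Proof. by apply: lt_trans np; rewrite ltr1n. Qed.

Lemma high_part_ge0 s : (0 <= high_part s)%R.
Proof. by apply: fine_ge0; apply: integral_ge0 => x _; rewrite lee_fin. Qed.

Lemma low_part_ge0 s : (0 <= low_part s)%R.
Proof. by apply: fine_ge0; apply: integral_ge0 => x _; rewrite lee_fin powR_ge0. Qed.

Let mlow s : measurable [set x | (G x <= lev s)%R].
Proof.
rewrite (_ : [set x | _] = setT `&` G @^-1` `]-oo, lev s]%classic); first exact: mG.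
by apply/seteqP; split => x; rewrite /= in_itv/=; [|case].
Qed.

Let mhigh s : measurable [set x | (lev s < G x)%R].
Proof.
rewrite (_ : [set x | _] = setT `&` G @^-1` `]lev s, +oo[%classic); first exact: mG.
by apply/seteqP; split => x; rewrite /= in_itv/= andbT; [|case].
Qed.

(** Jensen handles the low part in L^p. The average of the high part is at most [tau] everywhere, so
    its p-th power is at most tau^(p-1) times itself, and its integral is again controlled by the
    L^1 norm. *)
Lemma integral_avg_le (s : R) : (0 < s)%R ->
  \int[mu]_x (avg mu s G x) `^ p <=
  (2 `^ p * (9 ^+ n) `^ p * (low_part s + (s ^- n) `^ (p - 1) * high_part s `^ p))%:E.
Proof.
move=> s0; have v0 : (0 < s ^+ n)%R by rewrite exprn_gt0.
have p0 : (0 < p)%R by have := p1; lra.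
pose u : Rn -> R := fun x => (G x * \1_[set x | (G x <= lev s)%R] x)%R.
pose v : Rn -> R := fun x => (G x * \1_[set x | (lev s < G x)%R] x)%R.
have u0 x : (0 <= u x)%R by rewrite mulr_ge0.
have v0' x : (0 <= v x)%R by rewrite mulr_ge0.
have mu_ : measurable_fun setT u by apply: measurable_funM => //; exact: measurable_indic.
have mv : measurable_fun setT v by apply: measurable_funM => //; exact: measurable_indic.
have GE : G = (u \+ v)%R.
  apply/funext => x; rewrite /u /v /= -mulrDr -[LHS]mulr1; congr (_ * _)%R.
  rewrite !indicE; have [h|h] := leP (G x) (lev s).
    by rewrite mem_set//= memNset ?addr0//= => k; have := lt_le_trans k h; rewrite ltxx.
  by rewrite memNset ?mem_set ?add0r//= => k; have := lt_le_trans h k; rewrite ltxx.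
have lowE : \int[mu]_x (u x `^ p)%:E = (low_part s)%:E.
  rewrite fineK; last first.
    rewrite ge0_fin_numE; last by apply: integral_ge0 => x _; rewrite lee_fin powR_ge0.
    have := integral_powR_le_level mG G0 IG np (level_ge0 n2 mG G0 IG v0).
    by move/le_lt_trans; apply; rewrite ltry.
  rewrite [RHS]integral_mkcond; apply: eq_integral => x _; rewrite patchE /u indicE.
  by case: ifP => h; rewrite ?h ?mulr1// mulr0 powR0// gt_eqF.
have highE : \int[mu]_x (v x)%:E = (high_part s)%:E.
  rewrite fineK; last first.
    exact: (integral_gt_level_fin n2 mG G0 IG v0).
  rewrite [RHS]integral_mkcond; apply: eq_integral => x _; rewrite patchE /v indicE.
  by case: ifP => h; rewrite ?h ?mulr1 ?mulr0.
have sn0 : (0 <= s ^- n)%R by rewrite invr_ge0 exprn_ge0// ltW.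
have mavgu := measurable_avg muL s u0 mu_; have mavgv := measurable_avg muL s v0' mv.
have mpow (w : Rn -> \bar R) : measurable_fun setT w -> measurable_fun setT (fun x => w x `^ p).
  move=> mw; exact: (measurableT_comp (measurable_poweR p) mw).
have c0 : 0 <= (2 `^ (p - 1))%:E :> \bar R by rewrite lee_fin powR_ge0.
apply: (@le_trans _ _ ((2 `^ (p - 1))%:E *
    (\int[mu]_x (avg mu s u x) `^ p + \int[mu]_x (avg mu s v x) `^ p))).
  rewrite -ge0_integralD//; last 4 first.
  - by move=> x _; exact: poweR_ge0.
  - exact: mpow.
  - by move=> x _; exact: poweR_ge0.
  - exact: mpow.
  rewrite -ge0_integralZl_EFin ?powR_ge0//; last 2 first.
  - by move=> x _; rewrite adde_ge0 ?poweR_ge0.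
  - by apply: emeasurable_funD; exact: mpow.
  apply: le_ge0_integral => x _; first exact: poweR_ge0.
  by rewrite {1}GE avgD// poweR_addD// avg_ge0.
have hu : \int[mu]_x (avg mu s u x) `^ p <= ((9 ^+ n) `^ p * low_part s)%:E.
  by rewrite EFinM -lowE; exact: integral_avg_powR.
pose tau : R := (s ^- n * high_part s)%R.
have tau0 : (0 <= tau)%R by rewrite mulr_ge0// high_part_ge0.
have avgtau x : avg mu s v x <= tau%:E.
  rewrite /tau EFinM -highE; apply: lee_wpmul2l; first by rewrite lee_fin.
  apply: ge0_subset_integral => //; first exact: measurable_cube.
  - by apply/measurable_EFinP.
  - by move=> y _; rewrite lee_fin.
have hv : \int[mu]_x (avg mu s v x) `^ p <=
    (9 ^+ n * ((s ^- n) `^ (p - 1) * high_part s `^ p))%:E.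
  apply: (@le_trans _ _ (\int[mu]_x ((tau `^ (p - 1))%:E * avg mu s v x))).
    apply: le_ge0_integral => x _; first exact: poweR_ge0.
    have a0 : 0 <= avg mu s v x by exact: avg_ge0.
    have afin : avg mu s v x \is a fin_num.
      by rewrite ge0_fin_numE// (le_lt_trans (avgtau x))// ltry.
    move: a0 (avgtau x); rewrite -(fineK afin) => a0 at_.
    rewrite lee_fin in a0; rewrite lee_fin in at_.
    rewrite poweR_EFin -EFinM lee_fin -mulr_powRB1// mulrC ler_wpM2r//.
    by rewrite ge0_ler_powR ?nnegrE//; have := p1; lra.
  rewrite ge0_integralZl_EFin ?powR_ge0//; last by move=> x _; exact: avg_ge0.
  apply: (@le_trans _ _ ((tau `^ (p - 1))%:E * ((9 ^+ n)%:E * (high_part s)%:E))).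
    by apply: lee_wpmul2l; rewrite ?lee_fin ?powR_ge0// -highE; exact: integral_avg.
  rewrite -!EFinM lee_fin /tau powRM ?high_part_ge0//.
  rewrite -(mulr_powRB1 (high_part_ge0 s) p0) le_eqVlt; apply/orP; left; apply/eqP; ring.
apply: (le_trans (lee_wpmul2l c0 (leeD hu hv))).
rewrite -EFinD -EFinM lee_fin -!mulrA.
have H0 : (0 <= (s ^- n) `^ (p - 1) * high_part s `^ p)%R by rewrite mulr_ge0 ?powR_ge0.
have L0 := low_part_ge0 s.
have nine : (9 ^+ n <= (9 ^+ n) `^ p :> R)%R.
  by apply: le1r_powR; [rewrite exprn_ege1//; lra|have := p1; lra].
apply: ler_pM; rewrite ?powR_ge0//.
- by rewrite addr_ge0// mulr_ge0 ?powR_ge0 ?exprn_ge0.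
- by rewrite ler_powR//; lra.
- by rewrite mulrDr lerD2l ler_wpM2r.
Qed.

(** This is what the preceding estimate becomes under the power n/p; that power removes p from the
    constants 2^p and 9^(n p). *)
Definition avg_bound (s : R) : R :=
  (2 ^+ n * (9 ^+ n) ^+ n *
   (low_part s `^ (n%:R / p) + (s ^- n) `^ ((p - 1) * (n%:R / p)) * high_part s ^+ n))%R.

Lemma avg_bound_ge0 s : (0 <= avg_bound s)%R.
Proof.
by rewrite !mulr_ge0 ?exprn_ge0// addr_ge0 ?powR_ge0// mulr_ge0 ?powR_ge0 ?exprn_ge0 ?high_part_ge0.
Qed.

Lemma integral_avg_bound (s : R) : (0 < s)%R ->
  (\int[mu]_x (avg mu s G x) `^ p) `^ (n%:R / p) <= (avg_bound s)%:E.
Proof.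
move=> s0; have p0 : (0 < p)%R by have := p1; lra.
have r01 : (0 < n%:R / p <= 1)%R.
  by rewrite divr_gt0 ?ltr0n ?(leq_trans _ n2)//= ler_pdivrMr// mul1r ltW.
have /andP[r0 r1] := r01.
have X0 : 0 <= \int[mu]_x (avg mu s G x) `^ p by apply: integral_ge0 => x _; exact: poweR_ge0.
have H0 : (0 <= (s ^- n) `^ (p - 1) * high_part s `^ p)%R by rewrite mulr_ge0 ?powR_ge0.
have L0 := low_part_ge0 s.
have Y0 : (0 <= 2 `^ p * (9 ^+ n) `^ p * (low_part s + (s ^- n) `^ (p - 1) * high_part s `^ p))%R.
  by rewrite !mulr_ge0 ?powR_ge0// addr_ge0.
apply: (@le_trans _ _ ((2 `^ p * (9 ^+ n) `^ p *
    (low_part s + (s ^- n) `^ (p - 1) * high_part s `^ p))%:E `^ (n%:R / p))).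
  by apply: gt0_ler_poweR; rewrite ?(ltW r0) ?in_itv/= ?leey ?andbT ?lee_fin// integral_avg_le.
rewrite poweR_EFin lee_fin powRM ?mulr_ge0 ?powR_ge0 ?addr_ge0//.
rewrite powRM ?powR_ge0// -!powRrM [(p * _)%R]mulrC divfK ?gt_eqF// !powR_mulrn ?exprn_ge0//.
rewrite /avg_bound ler_wpM2l ?mulr_ge0 ?exprn_ge0//.
apply: (le_trans (powR_subadd L0 H0 r01)); rewrite lerD2l powRM ?powR_ge0// -!powRrM.
by rewrite [(p * _)%R]mulrC divfK ?gt_eqF// powR_mulrn// high_part_ge0.
Qed.

(** For v = s^n the weight is v^(1 - n/p), and in the high part all exponents of v combine to 1 - n.
    The two level-set sums then apply with q = 2^n; since (1 - n/p)^-1 >= 1, the high part can carry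
    this factor too. *)
Lemma sum_avg_bound (s : R) N : (0 < s)%R ->
  (\sum_(i < N) (2 ^+ i * s) `^ (n%:R * (1 - n%:R / p)) * avg_bound (2 ^+ i * s)
   <= 2 ^+ n * (9 ^+ n) ^+ n * (2 + 2 * 2 ^+ n.-1 + 10 * (2 ^+ n) ^+ 2) / (1 - n%:R / p) * I)%R.
Proof.
move=> s0; have v0 : (0 < s ^+ n)%R by rewrite exprn_gt0.
have p0 : (0 < p)%R by have := p1; lra.
have th0 : (0 < 1 - n%:R / p)%R by rewrite subr_gt0 ltr_pdivrMr// mul1r.
have th1 : (1 - n%:R / p <= 1)%R by rewrite gerBl divr_ge0// ltW.
have h1 := sum_integral_gt_level n2 mG G0 IG erefl N v0.
have h2 := sum_integral_le_level n2 mG G0 IG erefl np N v0.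
have I0 : (0 <= I)%R.
  by rewrite -lee_fin -IG; apply: integral_ge0 => x _; rewrite lee_fin exprn_ge0.
have vE i : ((2 ^+ n) ^+ i * s ^+ n = (2 ^+ i * s) ^+ n :> R)%R by rewrite exprAC -exprMn.
have E i : ((2 ^+ i * s) `^ (n%:R * (1 - n%:R / p)) * avg_bound (2 ^+ i * s) =
   2 ^+ n * (9 ^+ n) ^+ n *
   (((2 ^+ n) ^+ i * s ^+ n) `^ (1 - n%:R / p) * low_part (2 ^+ i * s) `^ (n%:R / p) +
    ((2 ^+ n) ^+ i * s ^+ n) ^- n.-1 * high_part (2 ^+ i * s) ^+ n))%R.
  have t0 : (0 < 2 ^+ i * s)%R by rewrite mulr_gt0// exprn_gt0.
  rewrite vE /avg_bound; move: (2 ^+ i * s)%R t0 => t t0.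
  rewrite mulrCA; congr (_ * _)%R; rewrite mulrDr [(t `^ (n%:R * _))%R]powRrM powR_mulrn ?(ltW t0)//.
  congr (_ + _)%R; rewrite mulrA; congr (_ * _)%R.
  have tn0 : (0 < t ^+ n)%R by rewrite exprn_gt0.
  rewrite powR_inv ?(ltW tn0)// -powRN -powRD ?(gt_eqF tn0) ?implybT//.
  rewrite -powR_invn ?(ltW tn0)//; congr (_ `^ _)%R.
  rewrite -subn1 natrB; last by rewrite ltnW.
  by field; rewrite gt_eqF.
under eq_bigr do rewrite E; rewrite -mulr_sumr big_split/=.
rewrite -!mulrA ler_wpM2l ?exprn_ge0// ler_wpM2l ?exprn_ge0//.
have h1' : (\sum_(i < N) ((2 ^+ n) ^+ i * s ^+ n) ^- n.-1 * high_part (2 ^+ i * s) ^+ n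
    <= (2 + 2 * 2 ^+ n.-1) * I)%R.
  by apply: le_trans h1; apply: ler_sum => i _; rewrite /high_part -vE.
have h2' : (\sum_(i < N) ((2 ^+ n) ^+ i * s ^+ n) `^ (1 - n%:R / p) *
    low_part (2 ^+ i * s) `^ (n%:R / p) <= 10 * (2 ^+ n) ^+ 2 / (1 - n%:R / p) * I)%R.
  by apply: le_trans h2; apply: ler_sum => i _; rewrite /low_part -vE.
apply: (le_trans (lerD h2' h1')).
have thV : (1 <= (1 - n%:R / p)^-1)%R by rewrite invf_ge1.
move: thV; move: (_^-1)%R => z z1.
rewrite mulrA -mulrDl ler_wpM2r// [leRHS]mulrDl addrC lerD2r.
by rewrite ler_peMr// addr_ge0// mulr_ge0// exprn_ge0.
Qed.

End averages_of_Ln.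

(** * Spline kernels *)

Section truncated_powers.
Context {R : realType}.

Definition tpow (m : nat) (x : R) : R := Num.max 0 x ^+ m.

Lemma tpow_le0 m x : (0 < m)%N -> x <= 0 -> tpow m x = 0.
Proof. by move=> m0 x0; rewrite /tpow max_l// expr0n gtn_eqF. Qed.

Lemma tpow_ge0E m x : 0 <= x -> tpow m x = x ^+ m.
Proof. by move=> x0; rewrite /tpow max_r. Qed.

Lemma tpow_ge0 m x : 0 <= tpow m x.
Proof. by rewrite exprn_ge0// le_max lexx. Qed.

Lemma continuous_tpow m : continuous (tpow m).
Proof.
have cm : continuous (fun x : R => Num.max 0 x).
  move=> x; apply: (@continuous_max _ _ (cst 0) id); [exact: cvg_cst|exact: cvg_id].
move=> x; exact: (continuous_comp (cm x) (@exprn_continuous _ m _)).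
Qed.

(** Only the knot 0 is delicate: with exponent at least 2 the difference quotient there is at most
    |h| for |h| <= 1. *)
Lemma is_derive_tpow m (x : R) : is_derive x 1 (tpow m.+2) (m.+2%:R * tpow m.+1 x).
Proof.
have [x0|x0|->] := ltgtP x 0.
- rewrite tpow_le0 ?(ltW x0)// mulr0.
  apply: (@near_eq_is_derive R R R (cst 0)).
  near=> y; rewrite /= tpow_le0//; apply: ltW; near: y; exact: lt_nbhsl.
- rewrite tpow_ge0E ?(ltW x0)//.
  apply: (@near_eq_is_derive R R R (id ^+ m.+2)).
    near=> y; rewrite tpow_ge0E ?exprfctE//; apply: ltW; near: y; exact: lt_nbhsr.
  apply: is_derive_eq; rewrite /= /GRing.scale/= mulr1//.
- rewrite tpow_le0// mulr0.
  have H : (fun h : R => h^-1 *: ((tpow m.+2 \o shift 0) (h *: 1) - tpow m.+2 0)) @ 0^' --> (0 : R).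
    apply/cvgr0Pnorm_le => e e0; near=> h.
    rewrite /= addr0 /GRing.scale/= mulr1 [tpow _ 0]tpow_le0// subr0.
    have [h0|h0] := leP h 0; first by rewrite tpow_le0// mulr0 normr0 ltW.
    rewrite tpow_ge0E ?(ltW h0)// exprS mulKf ?gt_eqF// ger0_norm ?exprn_ge0 ?(ltW h0)//.
    have h1 : h <= 1.
      by rewrite -[h]ger0_norm ?(ltW h0)//; near: h; apply: dnbhs0_le.
    apply: (@le_trans _ _ h); first by rewrite exprS ler_piMr ?(ltW h0)// exprn_ile1 ?(ltW h0).
    by rewrite -[h]ger0_norm ?(ltW h0)//; near: h; apply: dnbhs0_le.
  by apply: DeriveDef; [apply/cvg_ex; exists 0|exact: (cvg_lim _ H)].
Unshelve. all: by end_near. Qed.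

(* Up to normalization, [spline 2] is the quadratic B-spline with knots 0, 1, 2, 3,
   and [spline 3] is a primitive of it. *)
Definition spline (m : nat) (x : R) : R :=
  tpow m x - 3 * tpow m (x - 1) + 3 * tpow m (x - 2) - tpow m (x - 3).

Lemma continuous_spline m : continuous (spline m).
Proof.
have ct (a : R) : continuous (fun x : R => tpow m (x - a)).
  move=> x; apply: (@continuous_comp _ _ _ (fun x : R => x - a) (tpow m)); last exact: continuous_tpow.
  by apply: cvgB; [exact: cvg_id|exact: cvg_cst].
move=> x; apply: cvgB; last exact: ct.
apply: cvgD; last by apply: cvgM; [exact: cvg_cst|exact: ct].
apply: cvgB; first exact: continuous_tpow.
by apply: cvgM; [exact: cvg_cst|exact: ct].
Qed.

Lemma is_derive_spline_affine m (s a x : R) :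
  is_derive x 1 (fun y => spline m.+2 (s * (y - a))) (s * (m.+2%:R * spline m.+1 (s * (x - a)))).
Proof.
have ct (b : R) : is_derive x 1 (fun y => tpow m.+2 (s * (y - a) - b))
    (m.+2%:R * tpow m.+1 (s * (x - a) - b) * s).
  have aff : is_derive x 1 (fun y : R => s * (y - a) - b) s.
    have -> : (fun y : R => s * (y - a) - b) = s \*: (id - cst a) - cst b by [].
    by apply: is_derive_eq; rewrite /= subr0 subr0 /GRing.scale/= mulr1.
  by have := @is_derive1_comp R (tpow m.+2) _ x _ _ (is_derive_tpow m (s * (x - a) - b)) aff.
have -> : (fun y => spline m.+2 (s * (y - a))) =
  (fun y => tpow m.+2 (s * (y - a))) - 3 \*: (fun y => tpow m.+2 (s * (y - a) - 1))
  + 3 \*: (fun y => tpow m.+2 (s * (y - a) - 2)) - (fun y => tpow m.+2 (s * (y - a) - 3)).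
  by [].
have ct0 : is_derive x 1 (fun y => tpow m.+2 (s * (y - a))) (m.+2%:R * tpow m.+1 (s * (x - a)) * s).
  by have := ct 0; under eq_fun do rewrite subr0; rewrite subr0.
apply: is_derive_eq; rewrite /spline /GRing.scale/=; ring.
Qed.

Lemma spline_le0 m x : (0 < m)%N -> x <= 0 -> spline m x = 0.
Proof. by move=> m0 x0; rewrite /spline !tpow_le0//; lra. Qed.

(** To the right of all knots the spline is a full third difference, which annihilates squares and
    sends cubes to 3! = 6. *)
Lemma spline2_ge3 x : 3 <= x -> spline 2 x = 0.
Proof. by move=> x3; rewrite /spline !tpow_ge0E; try lra; ring. Qed.

Lemma spline3_ge3 x : 3 <= x -> spline 3 x = 6.
Proof. by move=> x3; rewrite /spline !tpow_ge0E; try lra; ring. Qed.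

Lemma spline2_bound x : 0 <= spline 2 x <= 2.
Proof.
have [x0|x0] := leP x 0; first by rewrite spline_le0//; lra.
have [x3|x3] := leP 3 x; first by rewrite spline2_ge3//; lra.
rewrite /spline tpow_ge0E ?(ltW x0)// [tpow 2 (x - 3)]tpow_le0 ?subr_le0 ?(ltW x3)//.
have [x1|x1] := leP x 1.
  rewrite !tpow_le0//; try lra; nra.
rewrite [tpow 2 (x - 1)]tpow_ge0E; last by lra.
have [x2|x2] := leP x 2.
  rewrite tpow_le0//; try lra; nra.
rewrite tpow_ge0E; last by lra.
nra.
Qed.

Lemma spline2_ge1 x : 1 <= x <= 2 -> 1 <= spline 2 x.
Proof.
move=> /andP[x1 x2]; rewrite /spline [tpow 2 (x - 3)]tpow_le0 ?[tpow 2 (x - 2)]tpow_le0//; try lra.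
by rewrite !tpow_ge0E; try lra; nra.
Qed.

(** A crude bound: the coefficients 1, 3, 3, 1 add up to 8, and on [0, 3] each truncated cube is at
    most 27. *)
Lemma spline3_bound x : `|spline 3 x| <= 216.
Proof.
have [x0|x0] := leP x 0; first by rewrite spline_le0// normr0.
have [x3|x3] := leP 3 x; first by rewrite spline3_ge3// ger0_norm//; lra.
have b a : 0 <= a -> 0 <= tpow 3 (x - a) <= 27.
  move=> a0; rewrite tpow_ge0/=.
  have [h|h] := leP (x - a) 0; first by rewrite tpow_le0.
  rewrite tpow_ge0E ?(ltW h)//.
  have -> : (27 : R) = 3 ^+ 3 by ring.
  by rewrite lerXn2r ?nnegrE ?(ltW h)//; lra.
rewrite /spline -[in tpow 3 x](subr0 x).
have := b 0 ltac:(lra); have := b 1 ltac:(lra); have := b 2 ltac:(lra); have := b 3 ltac:(lra).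
by rewrite ler_norml; lra.
Qed.

End truncated_powers.

(** * Tensor products as test functions *)

Section tensor_products.
Context {R : realType} {n : nat}.

Definition tensor (u : 'I_n -> R -> R) (x : 'rV[R]_n) : R := \prod_i u i (x 0 i).

Lemma continuous_prod_seq (T : topologicalType) (I : Type) (r : seq I) (P : pred I)
  (F : I -> T -> R) : (forall i, continuous (F i)) ->
  continuous (fun x => \prod_(i <- r | P i) F i x).
Proof.
move=> cF; elim: r => [|i r IH].
  by under eq_fun do rewrite big_nil; move=> x; exact: cvg_cst.
under eq_fun do rewrite big_cons.
by case: (P i) => // x; apply: cvgM; [exact: cF|exact: IH].
Qed.

Lemma continuous_tensor_coord (u : R -> R) i : continuous u ->
  continuous (fun x : 'rV[R]_n => u (x 0 i)).
Proof. by move=> cu x; apply: continuous_comp; [exact: coord_continuous|exact: cu]. Qed.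

Lemma is_derive_tensor (u : 'I_n -> R -> R) (x : 'rV[R]_n) i (du : R) :
  is_derive (x 0 i) 1 (u i) du ->
  is_derive x (delta_mx 0 i) (tensor u) (du * \prod_(j | j != i) u j (x 0 j)).
Proof.
move=> [dui duE]; set K := \prod_(j | _) _.
have E : (fun h : R => h^-1 *: ((tensor u \o shift x) (h *: delta_mx 0 i) - tensor u x)) =
    (fun h : R => h^-1 *: ((u i \o shift (x 0 i)) (h *: 1) - u i (x 0 i)) * K).
  apply/funext => h; rewrite /= /tensor (bigD1 i)//= [in X in _ - X](bigD1 i)//=.
  rewrite !mxE !eqxx /=.
  rewrite (eq_bigr (fun j => u j (x 0 j))); last first.
    by move=> j ji; rewrite !mxE eqxx (negbTE ji) mulr0 add0r.
  by rewrite -/K /GRing.scale/= !mulr1; ring.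
have H : (fun h : R => h^-1 *: ((tensor u \o shift x) (h *: delta_mx 0 i) - tensor u x)) @ 0^'
    --> (du * K : R).
  by rewrite E; apply: cvgM; [rewrite -duE; exact: dui|exact: cvg_cst].
by apply: DeriveDef; [apply/cvg_ex; exists (du * K)|exact: (cvg_lim _ H)].
Qed.

Lemma enorm_le_sup (x : 'rV[R]_n) (M : R) : (forall i, `|x 0 i| <= M) ->
  enorm x <= Num.sqrt (n%:R * M ^+ 2).
Proof.
move=> h; apply: ler_wsqrtr; rewrite [leRHS](_ : _ = \sum_(i < n) M ^+ 2).
  by apply: ler_sum => i _; rewrite -[x 0 i ^+ 2]real_normK ?num_real// lerXn2r ?nnegrE// (le_trans _ (h i)).
by rewrite sumr_const card_ord mulr_natl.
Qed.

Lemma coord_le_enorm (x : 'rV[R]_n) i : `|x 0 i| <= enorm x.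
Proof.
rewrite -sqrtr_sqr; apply: ler_wsqrtr.
by rewrite (bigD1 i)//= lerDl; apply: sumr_ge0 => j _; exact: sqr_ge0.
Qed.

Lemma test_fun_tensor (u du : 'I_n -> R -> R) (M : R) :
  (forall i (x : R), is_derive x 1 (u i) (du i x)) -> (forall i, continuous (du i)) ->
  (forall i x, M < `|x| -> u i x = 0) -> test_fun (tensor u).
Proof.
move=> dE cdu supp.
have cu i : continuous (u i).
  by move=> x; apply: differentiable_continuous; apply/derivable1_diffP; case: (dE i x).
split; [|split; [|split]].
- by apply: continuous_prod_seq => i; exact: continuous_tensor_coord.
- by move=> i x; case: (is_derive_tensor (dE i (x 0 i))).
- move=> i; rewrite [X in continuous X](_ : _ = (fun x : 'rV[R]_n =>
     du i (x 0 i) * \prod_(j | j != i) u j (x 0 j))); last first.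
    by apply/funext => x; case: (is_derive_tensor (dE i (x 0 i))).
  move=> x; apply: cvgM; last first.
  - by apply: continuous_prod_seq => j; exact: continuous_tensor_coord.
  - exact: (@continuous_tensor_coord _ i (cdu i) x).
  - exact: nbhs_filter.
- exists (Num.sqrt (n%:R * M ^+ 2)) => x.
  have [h|/existsNP[i /negP]] := pselect (forall i, `|x 0 i| <= M).
    by rewrite ltNge enorm_le_sup.
  by rewrite -ltNge => h _; rewrite /tensor (bigD1 i)//= supp// mul0r.
Qed.

(** The factors are exchanged one at a time in the order of the indices; [H k] is the product after
    k exchanges. *)
Lemma prod_telescope (A B : 'I_n -> R) :
  \prod_i A i - \prod_i B i =
  \sum_i (A i - B i) * \prod_(j | j != i) (if (j < i)%N then B j else A j).
Proof.
pose H (k : nat) := \prod_(j < n) (if (j < k)%N then B j else A j).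
have H0 : H 0 = \prod_i A i by [].
have Hn : H n = \prod_i B i by apply: eq_bigr => i _; rewrite ltn_ord.
rewrite -H0 -Hn -[LHS]opprB -(telescope_sumr _ (leq0n n)) big_mkord -sumrN.
apply: eq_bigr => i _; rewrite opprB /H (bigD1 i)//= ltnn [in X in _ - X](bigD1 i)//= ltnSn.
rewrite mulrBl; congr (_ - _ * _); apply: eq_bigr => j ji.
by rewrite ltnS leq_eqVlt; move: ji; rewrite -val_eqE /= => /negbTE ->.
Qed.

Lemma measurable_tensor (u : 'I_n -> R -> R) : (forall i, measurable_fun setT (u i)) ->
  measurable_fun setT (tensor u \o @rowt R n).
Proof.
move=> mu_; rewrite (_ : _ \o _ = fun x : n.-tuple R => \prod_(i <- index_enum 'I_n) u i (tnth x i)).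
  apply: measurable_prod => i _.
  exact: (measurableT_comp (mu_ i) (measurable_tnth i)).
by apply/funext => x /=; apply: eq_bigr => i _; rewrite mxE.
Qed.

End tensor_products.

(** * The spline kernel and its weak-gradient estimate *)

Section kernel.
Context {R : realType} {n : nat}.
Notation Rn := (n.-tuple R).
Implicit Types (s : R) (a : Rn).

(** The divisor 2 normalizes: [step] is a primitive that rises from 0 to 1, so every bump has
    integral 1 whatever its scale and position. *)
Definition bump (s b y : R) : R := s^-1 * (spline 2 (s^-1 * (y - b)) / 2).
Definition step (s b y : R) : R := spline 3 (s^-1 * (y - b)) / 6.

Lemma is_derive_step s (b y : R) : is_derive y 1 (step s b) (bump s b y).
Proof.
rewrite (_ : step s b = 6^-1 \*: (fun y => spline 3 (s^-1 * (y - b)))); last first.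
  by apply/funext => z; rewrite /step /= mulrC.
have := is_derive_spline_affine 1 s^-1 b y => h.
by apply: is_derive_eq; rewrite /bump /GRing.scale/=; move: (s^-1) => t; field.
Qed.

Let dbump (s b y : R) : R := s^-1 * (s^-1 * spline 1 (s^-1 * (y - b))).

Let is_derive_bump s (b y : R) : is_derive y 1 (bump s b) (dbump s b y).
Proof.
rewrite (_ : bump s b = (s^-1 / 2) \*: (fun y => spline 2 (s^-1 * (y - b)))); last first.
  by apply/funext => z; rewrite /bump /= /GRing.scale/=; ring.
have := is_derive_spline_affine 0 s^-1 b y => h.
by apply: is_derive_eq; rewrite /dbump /GRing.scale/=; move: (s^-1) => t; field.
Qed.

Let continuous_spline_affine m s (b : R) : continuous (fun y : R => spline m (s^-1 * (y - b))).
Proof.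
move=> y; apply: (@continuous_comp _ _ _ (fun y : R => s^-1 * (y - b)) (spline m)).
  by apply: cvgM; [exact: cvg_cst|apply: cvgB; [exact: cvg_id|exact: cvg_cst]].
exact: continuous_spline.
Qed.

Lemma continuous_bump s (b : R) : continuous (bump s b).
Proof.
move=> y; apply: cvgM; first exact: cvg_cst.
by apply: cvgM; [exact: continuous_spline_affine|exact: cvg_cst].
Qed.

Let continuous_dbump s (b : R) : continuous (dbump s b).
Proof.
move=> y; apply: cvgM; first exact: cvg_cst.
by apply: cvgM; [exact: cvg_cst|exact: continuous_spline_affine].
Qed.

Let continuous_step s (b : R) : continuous (step s b).
Proof. by move=> y; apply: cvgM; [exact: continuous_spline_affine|exact: cvg_cst]. Qed.

Lemma bump_bound s (b y : R) : 0 < s -> 0 <= bump s b y <= s^-1.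
Proof.
move=> s0; have /andP[h1 h2] := spline2_bound (s^-1 * (y - b)).
rewrite /bump mulr_ge0 ?invr_ge0 ?(ltW s0) ?divr_ge0//=.
by rewrite ler_piMr ?invr_ge0 ?(ltW s0)// ler_pdivrMr// mul1r.
Qed.

Lemma bump_out s (b y : R) : 0 < s -> ~~ (b < y < b + 3 * s) -> bump s b y = 0.
Proof.
move=> s0; rewrite negb_and -!leNgt => /orP[h|h]; rewrite /bump.
  by rewrite spline_le0 ?mul0r ?mulr0// mulr_ge0_le0 ?invr_ge0 ?(ltW s0)// subr_le0.
by rewrite spline2_ge3 ?mul0r ?mulr0// ler_pdivlMl//; lra.
Qed.

Let step_bound s (b y : R) : `|step s b y| <= 36.
Proof.
have := spline3_bound (s^-1 * (y - b)); rewrite /step normrM (@ger0_norm _ 6^-1)//; lra.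
Qed.

Let step_left s (b y : R) : 0 < s -> y <= b -> step s b y = 0.
Proof.
move=> s0 h; rewrite /step spline_le0 ?mul0r//.
by rewrite mulr_ge0_le0 ?invr_ge0 ?(ltW s0)// subr_le0.
Qed.

Let step_right s (b y : R) : 0 < s -> b + 3 * s <= y -> step s b y = 1.
Proof.
move=> s0 h; rewrite /step spline3_ge3 ?divff//.
by rewrite ler_pdivlMl//; lra.
Qed.

(** The point [a] is the lower corner of the support, not its centre, so mollification moves points
    in nonnegative directions only. *)
Definition ker s a (y : 'rV[R]_n) : R := tensor (fun i => bump s (tnth a i)) y.

Lemma ker_ge0 s a y : 0 < s -> 0 <= ker s a y.
Proof. by move=> s0; apply: prodr_ge0 => i _; case/andP: (bump_bound (tnth a i) (y 0 i) s0). Qed.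

Lemma measurable_ker s a : measurable_fun setT (ker s a \o @rowt R n).
Proof.
by apply: measurable_tensor => i; apply: continuous_measurable_fun; exact: continuous_bump.
Qed.

Lemma measurable_ball_enorm (r : R) : measurable [set x : Rn | enorm (rowt x) < r].
Proof.
have men : measurable_fun setT (fun x : Rn => enorm (rowt x)).
  rewrite (_ : (fun x : Rn => enorm (rowt x)) =
    (fun x : Rn => (\sum_(i <- index_enum 'I_n) tnth x i ^+ 2) `^ 2^-1)).
    apply: (measurableT_comp (measurable_powR _)); apply: measurable_sum => i.
    by apply: measurable_funX; exact: measurable_tnth.
  apply/funext => x; rewrite powR12_sqrt; last by apply: sumr_ge0 => i _; exact: sqr_ge0.
  by congr Num.sqrt; apply: eq_bigr => i _; rewrite mxE.
rewrite (_ : [set x | _] = setT `&` (fun x : Rn => enorm (rowt x)) @^-1` `]-oo, r[%classic).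
  exact: men.
by apply/seteqP; split => x /=; rewrite in_itv/=; [|case].
Qed.

Variable mu : {measure set Rn -> \bar R}.
Variables (f : 'rV[R]_n -> R) (g : 'I_n -> 'rV[R]_n -> R).
Hypothesis fW : in_Wdot1n mu f g.

Let F (x : Rn) : R := f (rowt x).
Definition grad_norm (x : Rn) : R := enorm (\row_i g i (rowt x)).

Let mF : measurable_fun setT F. Proof. by case: fW. Qed.

Lemma grad_norm_ge0 x : 0 <= grad_norm x. Proof. exact: sqrtr_ge0. Qed.

Lemma measurable_grad_norm : measurable_fun setT grad_norm.
Proof.
have [_ [_ [_ [mg _]]]] := fW.
rewrite (_ : grad_norm = (fun x => (\sum_(i <- index_enum 'I_n) g i (rowt x) ^+ 2) `^ 2^-1)).
  apply: (measurableT_comp (measurable_powR _)); apply: measurable_sum => i.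
  by apply: measurable_funX; exact: mg.
apply/funext => x; rewrite powR12_sqrt; last by apply: sumr_ge0 => i _; exact: sqr_ge0.
by congr Num.sqrt; apply: eq_bigr => i _; rewrite mxE.
Qed.

Let tensor_supp (w : 'I_n -> R -> R) a s : 
  (forall j y, 4 * s < `|y - tnth a j| -> w j y = 0) ->
  forall x, ~ cube s a x -> tensor w (rowt x) = 0.
Proof.
move=> h x /existsNP[i /negP]; rewrite -ltNge => hi.
by rewrite /tensor (bigD1 i)//= mxE h// mul0r.
Qed.

Let tensor_bound (w : 'I_n -> R -> R) (C : 'I_n -> R) x :
  (forall j y, `|w j y| <= C j) -> `|tensor w x| <= \prod_j C j.
Proof. by move=> h; rewrite normr_prod; apply: ler_prod => j _; rewrite normr_ge0 h. Qed.

Lemma integrable_cube a s : mu.-integrable (cube s a) (EFin \o F).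
Proof.
have [_ [lf _]] := fW.
pose M := \sum_j `|tnth a j| + `|4 * s|.
(* The added 1 gives the strict inequality that defines the ball, and a positive radius. *)
pose r := Num.sqrt (n%:R * M ^+ 2) + 1.
have r0 : 0 < r by have := sqrtr_ge0 (n%:R * M ^+ 2); rewrite /r; lra.
have mball := measurable_ball_enorm r.
have sub : cube s a `<=` [set x : Rn | enorm (rowt x) < r].
  move=> x h; rewrite /= /r.
  have : enorm (rowt x) <= Num.sqrt (n%:R * M ^+ 2).
    apply: enorm_le_sup => i; rewrite mxE.
    have -> : tnth x i = tnth a i + (tnth x i - tnth a i) by ring.
    apply: (le_trans (ler_normD _ _)); apply: lerD.
      by rewrite (bigD1 i)//= lerDl sumr_ge0.
    by apply: (le_trans (h i)); exact: ler_norm.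
  lra.
apply: (@integrableS _ _ _ _ _ _ _ mball) => //; first exact: measurable_cube.
apply/integrableP; split; first by apply/measurable_EFinP; exact: measurable_funTS.
exact: lf.
Qed.

Let integrable_tensor (w : 'I_n -> R -> R) a s (C : 'I_n -> R) :
  (forall j, measurable_fun setT (w j)) ->
  (forall j y, `|w j y| <= C j) ->
  (forall j y, 4 * s < `|y - tnth a j| -> w j y = 0) ->
  mu.-integrable setT (fun x => (F x * tensor w (rowt x))%:E).
Proof.
move=> mw wC supp.
have mFw : measurable_fun setT (fun x => F x * tensor w (rowt x)).
  by apply: measurable_funM => //; exact: (measurable_tensor mw).
apply/integrableP; split; first exact/measurable_EFinP.
have /integrableP[_ hF] := integrable_cube a s.
have C0 : 0 <= \prod_j C j.
  by apply: prodr_ge0 => j _; apply: le_trans (wC j 0).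
apply: (@le_lt_trans _ _ ((\prod_j C j)%:E * \int[mu]_(x in cube s a) `|(EFin \o F) x|)%E).
  rewrite -ge0_integralZl_EFin//; last 2 first.
  - exact: measurable_cube.
  - by apply: measurableT_comp => //; apply/measurable_EFinP; exact: measurable_funTS.
  rewrite [leRHS]integral_mkcond; apply: le_ge0_integral => x _; first exact: abse_ge0.
  rewrite patchE; case: ifPn => [|/negP xQ].
    by move=> _; rewrite /= lee_fin normrM mulrC ler_wpM2r// tensor_bound.
  rewrite (tensor_supp supp) ?mulr0 ?abse0; first exact: lexx.
  by move=> h; apply: xQ; rewrite inE.
move: hF; set J := (\int[mu]_(x in _) _)%E => hF.
have J0 : (0 <= J)%E by apply: integral_ge0 => x _; exact: abse_ge0.
by rewrite -(@fineK _ J) ?ge0_fin_numE// -EFinM ltry.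
Qed.

Lemma integrable_ker s a : 0 < s -> mu.-integrable setT (fun x => (F x * ker s a (rowt x))%:E).
Proof.
move=> s0; apply: (@integrable_tensor _ a s (fun=> s^-1)).
- by move=> j; apply: continuous_measurable_fun; exact: continuous_bump.
- by move=> j y; have /andP[h1 h2] := bump_bound (tnth a j) y s0; rewrite ger0_norm.
- move=> j y; rewrite ltr_normr => /orP h; apply: bump_out => //.
  by apply/negP => /andP[h1 h2]; case: h; lra.
Qed.

(* The difference of the two tensor products telescopes into products with one factor replaced by
   a difference of two bumps, which is the derivative of a compactly supported function because both
   bumps have the same integral; the weak gradient then applies to each term. *)
Lemma ker_difference s s' a a' : 0 < s -> s / 2 <= s' <= s ->
  (forall i, `|tnth a' i - tnth a i| <= s) ->
  (`| \int[mu]_x (F x * ker s a (rowt x))%:E - \int[mu]_x (F x * ker s' a' (rowt x))%:E |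
   <= (n%:R * (72 ^+ n * s))%:E * avg mu s grad_norm a)%E.
Proof.
move=> s0 /andP[ss' s's] aa'.
have s'0 : 0 < s' by lra.
have [_ [_ [_ [mg [_ wd]]]]] := fW.
(* The i-th factor of [W i] is a primitive of a difference of bumps, so the i-th partial derivative
   of its tensor product is that of [D i], the i-th term of the telescoping sum. *)
pose W (i j : 'I_n) : R -> R := if (j < i)%N then bump s' (tnth a' j)
  else if j == i then (fun y => step s (tnth a j) y - step s' (tnth a' j) y)
  else bump s (tnth a j).
pose dW (i j : 'I_n) : R -> R := if (j < i)%N then dbump s' (tnth a' j)
  else if j == i then (fun y => bump s (tnth a j) y - bump s' (tnth a' j) y)
  else dbump s (tnth a j).
pose D (i j : 'I_n) : R -> R := if j == i then (fun y => bump s (tnth a j) y - bump s' (tnth a' j) y)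
  else W i j.
have dWE i j (y : R) : is_derive y 1 (W i j) (dW i j y).
  rewrite /W /dW; case: ifP => _; first exact: is_derive_bump.
  case: ifP => _; last exact: is_derive_bump.
  exact: (is_deriveB (is_derive_step _ _ _) (is_derive_step _ _ _)).
have cdW i j : continuous (dW i j).
  rewrite /dW; case: ifP => _; first exact: continuous_dbump.
  case: ifP => _; last exact: continuous_dbump.
  by move=> y; apply: cvgB; exact: continuous_bump.
have mW i j : measurable_fun setT (W i j).
  apply: continuous_measurable_fun; rewrite /W; case: ifP => _; first exact: continuous_bump.
  case: ifP => _; last exact: continuous_bump.
  by move=> y; apply: cvgB; exact: continuous_step.
have mD i j : measurable_fun setT (D i j).
  rewrite /D; case: ifP => _ //; apply: continuous_measurable_fun.
  by move=> y; apply: cvgB; exact: continuous_bump.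
have far j y : 4 * s < `|y - tnth a j| -> [/\ bump s (tnth a j) y = 0, bump s' (tnth a' j) y = 0 &
    step s (tnth a j) y - step s' (tnth a' j) y = 0].
  have := aa' j; rewrite ler_norml => /andP[h1 h2].
  rewrite ltr_normr => /orP[h|h]; split.
  - by apply: bump_out => //; apply/negP => /andP[]; lra.
  - by apply: bump_out => //; apply/negP => /andP[]; lra.
  - by rewrite !step_right ?subrr//; lra.
  - by apply: bump_out => //; apply/negP => /andP[]; lra.
  - by apply: bump_out => //; apply/negP => /andP[]; lra.
  - by rewrite !step_left ?subrr//; lra.
have suppW i j y : 4 * s < `|y - tnth a j| -> W i j y = 0.
  by move=> /far[h1 h2 h3]; rewrite /W; case: ifP => _ //; case: ifP.
have suppD i j y : 4 * s < `|y - tnth a j| -> D i j y = 0.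
  move=> h; rewrite /D; case: ifP => _; last exact: suppW.
  by have [-> -> _] := far _ _ h; rewrite subrr.
have tW i : test_fun (tensor (W i)).
  apply: (@test_fun_tensor _ _ _ (dW i) (\sum_j `|tnth a j| + 4 * s)) => // j y h.
  apply: suppW; have : `|tnth a j| <= \sum_j `|tnth a j| by rewrite (bigD1 j)//= lerDl sumr_ge0.
  have := ler_normD (y - tnth a j) (tnth a j); rewrite subrK; lra.
have dEi i x : derive (tensor (W i)) x (delta_mx 0 i) = tensor (D i) x.
  case: (is_derive_tensor (dWE i i (x 0 i))) => _ ->.
  rewrite /tensor [RHS](bigD1 i)//= /D /dW ltnn eqxx; congr (_ * _).
  by apply: eq_bigr => j /negbTE ->.
have kerE x : ker s a x - ker s' a' x = \sum_i tensor (D i) x.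
  rewrite /ker /tensor prod_telescope; apply: eq_bigr => i _.
  rewrite [RHS](bigD1 i)//= /D eqxx; congr (_ * _).
  by apply: eq_bigr => j /negbTE ji; rewrite ji /W ji; case: ifP.
have sV : s'^-1 <= 2 * s^-1.
  by rewrite -[X in _ <= X * _]invrK -invfM lef_pV2 ?posrE ?mulr_gt0 ?invr_gt0// mulrC.
have sVp : 0 < s^-1 by rewrite invr_gt0.
(* The constant 72 comes from the difference of two steps, each at most 36; the bumps, bounded by
   s^-1 and 2 s^-1, are given the same constant so that all factors multiply to 72^n. *)
have bb j y : `|bump s (tnth a j) y| <= 72 * s^-1 /\ `|bump s' (tnth a' j) y| <= 72 * s^-1.
  have /andP[h1 h2] := bump_bound (tnth a j) y s0.
  have /andP[h3 h4] := bump_bound (tnth a' j) y s'0.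
  by rewrite !ger0_norm//; split; lra.
have bW i j y : `|W i j y| <= 72 * (if j == i then 1 else s^-1).
  rewrite /W; case: ifP => [ji|_].
    rewrite (_ : (j == i) = false); first by have [_] := bb j y.
    by apply/negP => /eqP ijE; rewrite ijE ltnn in ji.
  case: ifP => _; last by have [] := bb j y.
  have := ler_normB (step s (tnth a j) y) (step s' (tnth a' j) y).
  have := step_bound s (tnth a j) y; have := step_bound s' (tnth a' j) y; lra.
have bD i j y : `|D i j y| <= if j == i then 2 * (72 * s^-1) else 72 * s^-1.
  rewrite /D; case: ifP => [_|ji]; last by have := bW i j y; rewrite ji.
  have [h1 h2] := bb j y; have := ler_normB (bump s (tnth a j) y) (bump s' (tnth a' j) y); lra.
have intD i : mu.-integrable setT (fun x => (F x * tensor (D i) (rowt x))%:E).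
  exact: (integrable_tensor (mD i) (bD i) (suppD i)).
have -> : (\int[mu]_x (F x * ker s a (rowt x))%:E - \int[mu]_x (F x * ker s' a' (rowt x))%:E =
    \sum_i - \int[mu]_x (g i (rowt x) * tensor (W i) (rowt x))%:E)%E.
  rewrite -integralB_EFin//; [|exact: integrable_ker|exact: integrable_ker].
  under eq_integral do rewrite -EFinB -mulrBr kerE mulr_sumr -sumEFin.
  rewrite integral_sum//; apply: eq_bigr => i _.
  by rewrite -(wd _ (tW i)); apply: eq_integral => x _; rewrite dEi.
(* There are n - 1 factors of size s^-1 and one of size 1: compared with the normalization s^-n of
   [avg], a power of s is gained. *)
have Psi_bound i x : `|tensor (W i) (rowt x)| <= 72 ^+ n * s * s ^- n.
  apply: (le_trans (tensor_bound (rowt x) (bW i))).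
  rewrite big_split/= prodr_const card_ord -mulrA ler_wpM2l ?exprn_ge0//.
  rewrite (bigD1 i)//= eqxx mul1r (eq_bigr (fun=> s^-1)); last by move=> j /negbTE ->.
  rewrite prodr_const cardC1 card_ord le_eqVlt; apply/orP; left; apply/eqP.
  have n0 : (0 < n)%N by apply: leq_ltn_trans (ltn_ord i).
  by rewrite -[in RHS](prednK n0) exprS invfM mulrA mulfV ?gt_eqF// mul1r exprVn.
have G0 := grad_norm_ge0.
apply: (@le_trans _ _ (\sum_(i < n) `|\int[mu]_x (g i (rowt x) * tensor (W i) (rowt x))%:E|)%E).
  apply: (le_trans (lee_abs_sum _ _ _)); apply: lee_sum => i _; by rewrite abseN.
apply: (@le_trans _ _ (\sum_(i < n) ((72 ^+ n * s)%:E * avg mu s grad_norm a))%E); last first.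
  rewrite (EFinM n%:R) -muleA; set X := (_ * _)%E.
  rewrite (eq_bigr (fun=> 1%:E * X)%E); last by move=> i _; rewrite mul1e.
  by rewrite -ge0_sume_distrl// sumEFin sumr_const card_ord lexx.
apply: lee_sum => i _.
have mgW : measurable_fun setT (fun x : Rn => g i (rowt x) * tensor (W i) (rowt x)).
  by apply: measurable_funM; [exact: mg|exact: (measurable_tensor (mW i))].
apply: (le_trans (le_abse_integral _ _ _)) => //; first exact/measurable_EFinP.
rewrite /avg muleA -EFinM -ge0_integralZl_EFin//; last 4 first.
- exact: measurable_cube.
- by move=> x _; rewrite lee_fin.
- by apply/measurable_EFinP; apply: measurable_funTS; exact: measurable_grad_norm.
- by rewrite !mulr_ge0 ?exprn_ge0 ?invr_ge0 ?exprn_ge0 ?(ltW s0).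
rewrite [leRHS]integral_mkcond; apply: le_ge0_integral => x _; first exact: abse_ge0.
rewrite patchE; case: ifPn => [_|/negP xQ].
  rewrite /= lee_fin normrM mulrC; apply: ler_pM => //.
  by have := coord_le_enorm (\row_i g i (rowt x)) i; rewrite mxE.
rewrite (tensor_supp (suppW i)) ?mulr0 ?abse0; first exact: lexx.
by move=> h; apply: xQ; rewrite inE.
Qed.

End kernel.

(** * Mollification *)

Section translation_continuity.
Context {R : realType} {n : nat}.
Notation Rn := (n.-tuple R).
Variable mu : {measure set Rn -> \bar R}.
Hypothesis muL : is_lebesgue_n mu.
Variables (e : nat -> R) (e0 : R) (w a : Rn) (r : R).
Hypotheses (r0 : 0 < r) (eE : forall k, 0 <= e k <= e0) (ecvg : e @ \oo --> (0 : R)).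
(* Nonnegative directions suffice for kernels supported in [0, 3]^n, and indicators of
   half-open boxes are continuous along them everywhere, not just almost everywhere. *)
Hypothesis w0 : forall i, 0 <= tnth w i.

Implicit Types u v : Rn -> R.

Let Q := cube r a.
Let r' := r + e0 * \sum_i `|tnth w i|.
Let Q' := cube r' a.

Let rr' : r <= r'.
Proof.
rewrite lerDl mulr_ge0 ?sumr_ge0//; have := eE 0; lra.
Qed.
Let r'0 : 0 < r'. Proof. exact: lt_le_trans rr'. Qed.

Let QQ' : Q `<=` Q'.
Proof. by move=> x h i; apply: le_trans (h i) _; rewrite ler_pM2l. Qed.

Lemma tmove_cube k x : Q x -> Q' (tmove x (e k) w).
Proof.
move=> h i; rewrite tnth_tmove.
have -> : tnth x i + e k * tnth w i - tnth a i = (tnth x i - tnth a i) + e k * tnth w i by ring.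
apply: (le_trans (ler_normD _ _)).
have /andP[ek0 ek] := eE k.
have h1 : `|e k * tnth w i| <= e0 * \sum_i `|tnth w i|.
  rewrite normrM (ger0_norm ek0) ler_pM//.
  by rewrite (bigD1 i)//= lerDl sumr_ge0.
have h0 : 0 <= `|e k * tnth w i| by [].
have := h i; rewrite /r'; lra.
Qed.

Definition shift_err (k : nat) (u : Rn -> R) : \bar R :=
  (\int[mu]_(x in cube r a) (`|u (tmove x (e k) w) - u x|)%:E)%E.

Let mshift k u : measurable_fun setT u ->
  measurable_fun setT (fun x => u (tmove x (e k) w)).
Proof. by move=> mu_; exact: (measurableT_comp mu_ (measurable_tmovel _ _)). Qed.

Let mdiff k u : measurable_fun setT u ->
  measurable_fun setT (fun x => (`|u (tmove x (e k) w) - u x|)%:E).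
Proof.
move=> mu_; apply/measurable_EFinP; apply: measurableT_comp => //.
by apply: measurable_funB => //; exact: mshift.
Qed.

Let good u := forall d : R, 0 < d -> \forall k \near \oo, (shift_err k u <= d%:E)%E.

Lemma int_cube_shift k (u : Rn -> R) : measurable_fun setT u -> (forall x, 0 <= u x) ->
  (\int[mu]_(x in cube r a) (u (tmove x (e k) w))%:E <= \int[mu]_(x in cube r' a) (u x)%:E)%E.
Proof.
move=> mu_ u0; rewrite [leRHS]integral_mkcond.
rewrite -(int_shift muL (e k) w); last 2 first.
- by apply/(measurable_restrictT _ _).1 => //; [exact: measurable_cube|apply/measurable_EFinP; exact: measurable_funTS].
- by move=> y; rewrite patchE; case: ifP => // _; rewrite lee_fin.
rewrite integral_mkcond; apply: le_ge0_integral => x _.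
  by rewrite patchE; case: ifP => // _; rewrite lee_fin.
rewrite !patchE; case: ifPn => [|_]; last by case: ifP => // _; rewrite lee_fin.
by rewrite inE => /(tmove_cube k) h; rewrite mem_set.
Qed.

Let shift_err_sub k u v (v' : Rn -> R) : measurable_fun setT u -> measurable_fun setT v -> measurable_fun setT v' ->
  (forall x y, `|u x - u y| <= `|v x - v y| + `|v' x - v' y|) ->
  (shift_err k u <= shift_err k v + shift_err k v')%E.
Proof.
move=> mu_ mv mv' h; rewrite /shift_err -ge0_integralD//.
- by apply: le_ge0_integral => x _; rewrite -?EFinD lee_fin.
- exact: measurable_cube.
- by apply: measurable_funTS; exact: mdiff.
- by apply: measurable_funTS; exact: mdiff.
Qed.

Let good_sub u v (v' : Rn -> R) : measurable_fun setT u -> measurable_fun setT v -> measurable_fun setT v' ->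
  (forall x y, `|u x - u y| <= `|v x - v y| + `|v' x - v' y|) -> good v -> good v' -> good u.
Proof.
move=> mu_ mv mv' h gv gv' d d0; have d2 : 0 < d / 2 by rewrite divr_gt0.
near=> k; apply: (le_trans (shift_err_sub k mu_ mv mv' h)).
have -> : (d%:E = (d / 2)%:E + (d / 2)%:E)%E by rewrite -EFinD; congr EFin; lra.
apply: leeD; near: k; [exact: gv|exact: gv'].
Unshelve. all: by end_near. Qed.

(** A three-epsilon argument: translation moves the shifted approximation error into the larger cube
    Q', where it is bounded independently of k. *)
Let good_approx u : measurable_fun setT u ->
  (forall d : R, 0 < d -> exists v : Rn -> R, [/\ measurable_fun setT v, good v &
    (\int[mu]_(x in Q') (`|u x - v x|)%:E <= d%:E)%E]) -> good u.
Proof.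
move=> mu_ h d d0; have d3 : 0 < d / 3 by rewrite divr_gt0.
have [v [mv gv hv]] := h _ d3.
have muv : measurable_fun setT (fun x => `|u x - v x|).
  by apply: measurableT_comp => //; exact: measurable_funB.
near=> k.
apply: (@le_trans _ _ (shift_err k v + (\int[mu]_(x in Q) (`|u (tmove x (e k) w) - v (tmove x (e k) w)|)%:E
   + \int[mu]_(x in Q) (`|u x - v x|)%:E))%E).
  have mQ : measurable Q by exact: measurable_cube.
  have m1 : measurable_fun Q (fun x => (`|u (tmove x (e k) w) - v (tmove x (e k) w)|)%:E).
    by apply: measurable_funTS; apply/measurable_EFinP; exact: (mshift k muv).
  have m2 : measurable_fun Q (fun x => (`|u x - v x|)%:E).
    by apply: measurable_funTS; exact/measurable_EFinP.
  rewrite -ge0_integralD// /shift_err -ge0_integralD//; last 3 first.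
  - by apply: measurable_funTS; exact: mdiff.
  - by move=> x _; rewrite -EFinD lee_fin addr_ge0.
  - exact: emeasurable_funD.
  apply: le_ge0_integral => x _; rewrite -?EFinD lee_fin//.
  set a1 := u _; set b1 := v _; set a2 := u _; set b2 := v _.
  have -> : a1 - a2 = (b1 - b2) + ((a1 - b1) + (b2 - a2)) by ring.
  apply: (le_trans (ler_normD _ _)); rewrite lerD2l.
  by apply: (le_trans (ler_normD _ _)); rewrite (distrC b2).
have -> : (d%:E = (d / 3)%:E + ((d / 3)%:E + (d / 3)%:E))%E.
  by rewrite -!EFinD; congr EFin; lra.
apply: leeD; first by near: k; exact: gv.
apply: leeD.
  by apply: le_trans hv; exact: (int_cube_shift k muv).
apply: le_trans hv; apply: ge0_subset_integral; rewrite ?QQ'//.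
- exact: measurable_cube.
- exact: measurable_cube.
- by apply: measurable_funTS; exact/measurable_EFinP.
Unshelve. all: by end_near. Qed.

(** This family is shown to be a sigma-algebra containing the coordinate half-spaces, hence to
    contain all measurable sets. Simple functions follow by linearity, integrable ones by
    approximation. *)
Let G0 : set (set Rn) := [set A | measurable A /\ good (\1_A : Rn -> R)].

Let mind (A : set Rn) : measurable A -> measurable_fun setT (\1_A : Rn -> R).
Proof. by move=> mA; exact: measurable_indic. Qed.

Let good_setU A B : G0 A -> G0 B -> G0 (A `|` B).
Proof.
move=> [mA gA] [mB gB]; have mAB := measurableU _ _ mA mB; split => //.
apply: (good_sub (mind mAB) (mind mA) (mind mB) _ gA gB) => x y.
rewrite !indicE !in_setU; case: (x \in A); case: (x \in B); case: (y \in A); case: (y \in B) => /=;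
  rewrite ?subrr ?subr0 ?sub0r ?normrN ?normr0 ?normr1; lra.
Qed.

Let good_set0 : G0 set0.
Proof.
split=> // d d0; near=> k; rewrite /shift_err.
by rewrite integral0_eq ?lee_fin ?(ltW d0)// => x _; rewrite !indic0 subrr normr0.
Unshelve. all: by end_near. Qed.

(** Finite unions approximate the union in L^1 of Q', since the errors [C N] decrease to the empty
    set inside a set of finite measure. *)
Let good_bigcup (A : nat -> set Rn) : (forall i, G0 (A i)) -> G0 (\bigcup_i A i).
Proof.
move=> gA; have mU : measurable (\bigcup_i A i) by apply: bigcupT_measurable => i; case: (gA i).
split => //; apply: good_approx; first exact: mind.
move=> d d0; pose B N := \big[setU/set0]_(i < N) A i.
have gB N : G0 (B N).
  by rewrite /B; elim: N => [|N IH]; rewrite ?big_ord0// big_ord_recr/=; exact: good_setU.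
pose C N := Q' `&` ((\bigcup_i A i) `\` B N).
have mQ' : measurable Q' by exact: measurable_cube.
have mC N : measurable (C N).
  by apply: measurableI => //; apply: measurableD => //; case: (gB N).
have C0 : mu (C 0) \is a fin_num.
  rewrite ge0_fin_numE//; apply: le_lt_trans (ltry ((9 * r') ^+ n)).
  apply: le_trans (mu_cube muL a r'0); apply: le_measure; rewrite ?inE//.
  by move=> x [].
have cv : mu (C N) @[N --> \oo] --> mu (\bigcap_N C N).
  apply: nonincreasing_cvg_mu => //; first by rewrite ltey_eq C0.
    exact: bigcap_measurable.
  move=> i j ij; apply/subsetPset => x [Qx [Ux nB]]; split => //; split => // Bi; apply: nB.
  move: Bi; rewrite /B -!bigcup_mkord => -[k /= ki Ak]; exists k => //=.
  exact: leq_trans ki ij.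
have CE : \bigcap_N C N = set0.
  rewrite -subset0 => x h; have [_ [[i _ Ai] _]] := h 0%N I.
  have [_ [_ nB]] := h i.+1 I; apply: nB.
  by rewrite /B -bigcup_mkord; exists i => /=.
rewrite CE measure0 in cv.
have /(_ d d0) [N _ hN] : forall d : R, 0 < d -> \forall N \near \oo, (mu (C N) <= d%:E)%E.
  move=> c c0; move/fine_cvgP : cv => [fin cv].
  near=> N; have fN : mu (C N) \is a fin_num by near: N.
  rewrite -(fineK fN) lee_fin; near: N; move/cvgr0Pnorm_le : cv => /(_ c c0).
  by apply: filterS => N; apply: le_trans; exact: ler_norm.
exists (\1_(B N)); split; [by apply: mind; case: (gB N)|by case: (gB N)|].
apply: le_trans (hN N (leqnn N)).
rewrite [leLHS](_ : _ = \int[mu]_(x in Q') (\1_(C N) x)%:E)%E.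
  by rewrite integral_indic// setIidl// => x [].
apply: eq_integral => x; rewrite inE => Qx; congr EFin.
have BU : B N `<=` \bigcup_i A i.
  by rewrite /B -bigcup_mkord => y [i _ Ai]; exists i.
rewrite !indicE /C in_setI (mem_set Qx) /= in_setD.
case: (boolP (x \in B N)) => [/set_mem/BU/mem_set ->|_] /=; first by rewrite subrr normr0.
by rewrite andbT subr0; case: (x \in _) => /=; rewrite ?normr1 ?normr0.
Unshelve. all: by end_near. Qed.

Let good_setC A : G0 A -> G0 (~` A).
Proof.
move=> [mA gA]; split; first exact: measurableC.
move=> d d0; have := gA d d0; apply: filterS => k; apply: le_trans.
rewrite /shift_err le_eqVlt; apply/orP; left; apply/eqP; apply: eq_integral => x _; congr EFin.
rewrite !indicE !in_setC; case: (_ \in A); case: (_ \in A) => /=;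
  by rewrite ?subrr ?subr0 ?sub0r ?normrN.
Qed.

(** A point of the half-space never leaves it, and a point outside has positive distance to it, so
    its translates are eventually outside; dominated convergence on the cube concludes. *)
Let good_halfspace i (b : R) : G0 ((fun x : Rn => tnth x i) @^-1` `[b, +oo[%classic).
Proof.
set A := _ @^-1` _.
have mA : measurable A.
  by rewrite -[A]setTI; exact: measurable_tnth.
split=> //.
have mQ : measurable Q by exact: measurable_cube.
have muQ : (mu Q < +oo)%E by apply: le_lt_trans (mu_cube muL a r0) (ltry _).
have key : (\int[mu]_(x in Q) (`|\1_A (tmove x (e k) w) - \1_A x|)%:E)%E @[k --> \oo] --> 0%E.
  have := @dominated_cvg _ _ _ mu Q mQ (fun k x => (`|\1_A (tmove x (e k) w) - \1_A x : R|)%:E)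
    (cst 0%E) (cst 1%E).
  rewrite integral0; apply.
  - by move=> k; apply: measurable_funTS; exact: (mdiff k (mind mA)).
  - move=> x _.
    have pw : \forall k \near \oo, `|\1_A (tmove x (e k) w) - \1_A x : R| = 0.
      have [xb|xb] := leP b (tnth x i).
        near=> k.
        have Ax : A x by rewrite /A/= in_itv/= andbT.
        have Ak : A (tmove x (e k) w).
          rewrite /A/= in_itv/= andbT tnth_tmove (le_trans xb)// lerDl mulr_ge0//.
          by case/andP: (eE k).
        by rewrite !indicE (mem_set Ax) (mem_set Ak) subrr normr0.
      have : e k * tnth w i @[k --> \oo] --> (0 * tnth w i : R).
        by apply: cvgM => //; exact: cvg_cst.
      rewrite mul0r => /cvgr0Pnorm_lt /(_ (b - tnth x i)); rewrite subr_gt0 => /(_ xb) ew.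
      near=> k.
      have Ax : ~ A x by rewrite /A/= in_itv/= andbT; apply/negP; rewrite -ltNge.
      have Ak : ~ A (tmove x (e k) w).
        rewrite /A/= in_itv/= andbT; apply/negP; rewrite -ltNge tnth_tmove -ltrBrDl.
        by apply: le_lt_trans (ler_norm _) _; near: k.
      by rewrite !indicE (memNset Ax) (memNset Ak) subrr normr0.
    apply: cvg_near_cst; near=> k; congr EFin; by near: k.
  - by [].
  - by apply/integrableP; split => //; under eq_integral do rewrite /= normr1; rewrite integral_cst// mul1e.
  - move=> k x _; rewrite lee_fin /= ger0_norm// !indicE.
    by case: (_ \in A); case: (_ \in A); rewrite /= ?subrr ?subr0 ?sub0r ?normrN ?normr0 ?normr1.
move=> d d0; move/fine_cvgP : key => [fin cv].
move/cvgr0Pnorm_le : cv => /(_ d d0) cv.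
near=> k; rewrite /shift_err -/Q.
have fN : (\int[mu]_(x in Q) (`|\1_A (tmove x (e k) w) - \1_A x|)%:E)%E \is a fin_num by near: k.
rewrite -(fineK fN) lee_fin; apply: le_trans (ler_norm _) _; near: k; exact: cv.
Unshelve. all: by end_near. Qed.

Let sigma_G0 : sigma_algebra setT G0.
Proof.
split; [exact: good_set0| |exact: good_bigcup].
by move=> A gA; rewrite setTD; exact: good_setC.
Qed.

Lemma good_indic A : measurable A -> good (\1_A : Rn -> R).
Proof.
suff : measurable `<=` G0 by move=> h /h[].
apply: smallest_sub; first exact: sigma_G0.
move=> B; rewrite -bigcup_seq => -[i /= _ [C mC <-]]; rewrite setTI.
suff : measurable `<=` [set C : set R | G0 ((fun x : Rn => tnth x i) @^-1` C)] by exact.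
rewrite [X in X `<=` _](_ : _ = <<s @RGenCInfty.G R >>); last exact: RGenCInfty.measurableE.
apply: smallest_sub.
- split => /=.
  + by rewrite preimage_set0.
  + by move=> D gD; rewrite setTD preimage_setC; exact: good_setC.
  + by move=> D gD; rewrite preimage_bigcup; exact: good_bigcup.
- by move=> _ [b ->]; exact: good_halfspace.
Qed.

Let good_scale (c : R) u : measurable_fun setT u -> good u -> good (fun x => c * u x).
Proof.
move=> mu_ gu d d0; have c1 : 0 < `|c| + 1 by rewrite ltr_wpDl.
have := gu (d / (`|c| + 1)) (divr_gt0 d0 c1); apply: filterS => k h.
apply: (@le_trans _ _ ((`|c| + 1)%:E * shift_err k u)%E).
  have mQ : measurable Q by exact: measurable_cube.
  have md : measurable_fun Q (fun x => (`|u (tmove x (e k) w) - u x|)%:E).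
    by apply: measurable_funTS; exact: mdiff.
  rewrite /shift_err -ge0_integralZl_EFin ?(ltW c1)//.
  apply: le_ge0_integral => x _; rewrite -?EFinM lee_fin// -mulrBr normrM.
  by rewrite ler_wpM2r// lerDl.
apply: (le_trans (lee_wpmul2l _ h)); first by rewrite lee_fin ltW.
by rewrite -EFinM lee_fin mulrC divfK// gt_eqF.
Qed.

Let good_sum (I : eqType) (s : seq I) (u : I -> Rn -> R) :
  (forall i, measurable_fun setT (u i)) -> (forall i, good (u i)) ->
  good (fun x => \sum_(i <- s) u i x).
Proof.
move=> mu_ gu; elim: s => [|i s IH].
  move=> d d0; near=> k; rewrite /shift_err integral0_eq ?lee_fin ?(ltW d0)// => x _.
  by rewrite !big_nil subrr normr0.
have ms t : measurable_fun setT (fun x => \sum_(i <- t) u i x) by exact: measurable_sum.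
apply: (good_sub (ms _) (mu_ i) (ms s) _ (gu i) IH) => x y.
rewrite !big_cons; apply: le_trans (ler_normD _ _).
by rewrite le_eqVlt; apply/orP; left; apply/eqP; congr `|_|; ring.
Unshelve. all: by end_near. Qed.

Import HBSimple.

Lemma shift_err_cvg0 (u : Rn -> R) : measurable_fun setT u ->
  mu.-integrable (cube r' a) (EFin \o u) ->
  forall d : R, 0 < d -> \forall k \near \oo, (shift_err k u <= d%:E)%E.
Proof.
move=> mu_ iu; apply: good_approx => // d d0.
have mQ' : measurable Q' by exact: measurable_cube.
have [h [_ _ /fine_cvgP[fin]]] := approximation_sfun_integrable mQ' iu.
move=> /cvgr0Pnorm_le /(_ d d0) cv.
near \oo => k.
exists (HBSimple.SimpleFun.sort (h k)); split.
- exact: measurable_funP.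
- rewrite (_ : HBSimple.SimpleFun.sort (h k) = fun x => \sum_(y <- finmap.enum_fset (fset_set (range (h k))))
     (y * \1_(h k @^-1` [set y]) x)); last first.
    by apply/funext => x; rewrite fimfunE fsbig_finite.
  apply: good_sum => y.
    by apply: measurable_funM => //; apply: mind; exact: measurable_sfunP.
  by apply: good_scale; [apply: mind|apply: good_indic]; exact: measurable_sfunP.
- have fN : (\int[mu]_(z in Q') `|(EFin \o u) z - (h k z)%:E|)%E \is a fin_num by near: k.
  rewrite [leLHS](_ : _ = \int[mu]_(z in Q') `|(EFin \o u) z - (h k z)%:E|)%E//.
  rewrite -(fineK fN) lee_fin; apply: le_trans (ler_norm _) _; near: k; exact: cv.
Unshelve. all: by end_near. Qed.

End translation_continuity.

(** * Convergence of mollifications in L^1 on cubes *)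

Section mollifier.
Context {R : realType} {n : nat}.
Notation Rn := (n.-tuple R).
Variable mu : {measure set Rn -> \bar R}.
Hypothesis muL : is_lebesgue_n mu.

Definition origin : Rn := [tuple 0 | i < n].
Definition eta (w : Rn) : R := ker 1 origin (rowt w).

Lemma eta_ge0 w : 0 <= eta w. Proof. exact: ker_ge0. Qed.

Lemma measurable_eta : measurable_fun setT eta. Proof. exact: measurable_ker. Qed.

Lemma eta_out w : ~ (forall i, 0 <= tnth w i <= 3) -> eta w = 0.
Proof.
move=> /existsNP[i /negP h]; rewrite /eta /ker /tensor (bigD1 i)//= mxE tnth_mktuple bump_out ?mul0r//.
by apply: contra h => /andP[]; lra.
Qed.

Lemma ker_tmove s a w : 0 < s -> ker s a (rowt (tmove a s w)) = s ^- n * eta w.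
Proof.
move=> s0; rewrite /eta /ker /tensor.
rewrite (eq_bigr (fun i => s^-1 * bump 1 (tnth origin i) (rowt w 0 i))).
  by rewrite big_split/= prodr_const card_ord exprVn.
move=> i _; rewrite !mxE tnth_tmove tnth_mktuple /bump subr0 invr1 !mul1r.
by congr (_ * (spline 2 _ / 2)); field; rewrite gt_eqF.
Qed.

Definition mass : R := fine (\int[mu]_w (eta w)%:E)%E.

Lemma integral_eta : (\int[mu]_w (eta w)%:E)%E = mass%:E.
Proof.
rewrite fineK// ge0_fin_numE; last by apply: integral_ge0 => w _; rewrite lee_fin eta_ge0.
apply: (@le_lt_trans _ _ (\int[mu]_(w in cube 1 origin) (cst 1%E) w)%E).
  rewrite [leRHS]integral_mkcond; apply: le_ge0_integral => w _; first by rewrite lee_fin eta_ge0.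
  rewrite patchE; case: ifPn => [_|/negP h].
    rewrite lee_fin /eta /ker /tensor; apply: prodr_ile1 => i _.
    by have := bump_bound (tnth origin i) (rowt w 0 i) ltr01; rewrite invr1.
  rewrite eta_out; first exact: lexx.
  move=> k; apply: h; rewrite inE => i; rewrite tnth_mktuple subr0.
  by have := k i => /andP[h1 h2]; rewrite ger0_norm//; lra.
rewrite integral_cst; last exact: measurable_cube.
by rewrite mul1e; apply: le_lt_trans (mu_cube muL origin ltr01) (ltry _).
Qed.

(** On [1, 2]^n, a box of measure 1, every factor of [eta] is at least 1/2. A bound depending only
    on n is what the final constant requires. *)
Lemma mass_ge : 2^-1 ^+ n <= mass.
Proof.
rewrite -lee_fin -integral_eta.
pose B : set Rn := box (fun=> 1) (fun=> 2).
have mB : measurable B by exact: measurable_box.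
have BE : mu B = 1%E.
  rewrite muL => [|i]; last by lra.
  by congr EFin; rewrite big1// => i _; lra.
apply: (@le_trans _ _ (\int[mu]_(w in B) (cst (2^-1 ^+ n)%:E) w)%E).
  by rewrite integral_cst// BE mule1.
rewrite integral_mkcond; apply: le_ge0_integral => w _.
  by rewrite patchE; case: ifP => // _; rewrite lee_fin exprn_ge0.
rewrite patchE; case: ifPn => [|_]; last by rewrite lee_fin eta_ge0.
rewrite inE lee_fin => Bw.
rewrite [leLHS](_ : _ = \prod_(i < n) 2^-1); last by rewrite prodr_const card_ord.
rewrite /eta /ker /tensor; apply: ler_prod => i _.
rewrite invr_ge0 ler0n/= mxE tnth_mktuple /bump invr1 !mul1r subr0.
have := Bw i => /andP[h1 h2]; have := @spline2_ge1 _ (tnth w i) ltac:(lra); lra.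
Qed.

Lemma mass_gt0 : 0 < mass.
Proof. by apply: lt_le_trans mass_ge; rewrite exprn_gt0. Qed.

Variable F : Rn -> R.
Hypothesis mF : measurable_fun setT F.
Hypothesis iF : forall s a, mu.-integrable (cube s a) (EFin \o F).

(** It dominates the mollification error at x, and being the integral of a nonnegative function it
    reduces by Tonelli to translation errors averaged against [eta]. *)
Definition err (s : R) (x : Rn) : \bar R :=
  (\int[mu]_w (`|F (tmove x s w) - F x| * eta w)%:E)%E.

Let mJ s : measurable_fun setT (fun z : Rn * Rn => (`|F (tmove z.1 s z.2) - F z.1| * eta z.2)%:E).
Proof.
apply/measurable_EFinP; apply: measurable_funM.
  apply: measurableT_comp => //; apply: measurable_funB.
    exact: (measurableT_comp mF (measurable_tmove2 s)).
  exact: (measurableT_comp mF measurable_fst).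
exact: (measurableT_comp measurable_eta measurable_snd).
Qed.

Lemma measurable_err s : measurable_fun setT (err s).
Proof.
apply: (measurable_int_lebesgue_n muL (mJ s)) => z.
by rewrite lee_fin mulr_ge0 ?eta_ge0.
Qed.

Lemma err_ge0 s x : (0 <= err s x)%E.
Proof. by apply: integral_ge0 => w _; rewrite lee_fin mulr_ge0 ?eta_ge0. Qed.

Lemma integral_ker s a : 0 < s -> (\int[mu]_y (ker s a (rowt y))%:E)%E = mass%:E.
Proof.
move=> s0; have sn0 : 0 < s ^+ n by rewrite exprn_gt0.
have mk : measurable_fun setT (fun y : Rn => (ker s a (rowt y))%:E).
  by apply/measurable_EFinP; exact: measurable_ker.
have := int_tmove muL a s0 mk (fun y => _); rewrite -integral_eta => /(_ _) h.
have : (\int[mu]_w (s ^- n * eta w)%:E = (s ^- n)%:E * \int[mu]_y (ker s a (rowt y))%:E)%E.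
  rewrite -h; last by move=> y; rewrite lee_fin ker_ge0.
  by apply: eq_integral => w _; rewrite ker_tmove.
under eq_integral do rewrite EFinM.
rewrite ge0_integralZl_EFin//; last 3 first.
- by move=> w _; rewrite lee_fin eta_ge0.
- by apply/measurable_EFinP; exact: measurable_eta.
- by rewrite invr_ge0 ltW.
move=> /(congr1 (fun x => (s ^+ n)%:E * x)%E).
by rewrite !muleA -!EFinM mulfV ?gt_eqF// !mul1e.
Qed.

Lemma ker_err s a : 0 < s -> mu.-integrable setT (fun x => (F x * ker s a (rowt x))%:E) ->
  (`| \int[mu]_x (F x * ker s a (rowt x))%:E - (mass * F a)%:E | <= err s a)%E.
Proof.
move=> s0 ik; have sn0 : 0 < s ^+ n by rewrite exprn_gt0.
have mk := measurable_ker (n := n) s a.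
have ik1 : mu.-integrable setT (fun x : Rn => (F a * ker s a (rowt x))%:E).
  rewrite (_ : (fun x : Rn => _) = (fun x : Rn => (F a)%:E * (ker s a (rowt x))%:E)%E) //.
  apply: integrableZl => //; apply/integrableP; split; first exact/measurable_EFinP.
  under eq_integral do rewrite gee0_abs ?lee_fin ?ker_ge0//.
  by rewrite integral_ker// ltry.
have -> : ((mass * F a)%:E = \int[mu]_x (F a * ker s a (rowt x))%:E)%E.
  under eq_integral do rewrite EFinM.
  rewrite integralZl//; last first.
    apply/integrableP; split; first exact/measurable_EFinP.
    under eq_integral do rewrite gee0_abs ?lee_fin ?ker_ge0//.
    by rewrite integral_ker// ltry.
  by rewrite integral_ker// -EFinM mulrC.
rewrite -integralB_EFin//.
have mH : measurable_fun setT (fun y : Rn => (`|F y - F a| * ker s a (rowt y))%:E).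
  apply/measurable_EFinP; apply: measurable_funM => //.
  by apply: measurableT_comp => //; exact: measurable_funB.
have H0 y : (0 <= (`|F y - F a| * ker s a (rowt y))%:E)%E.
  by rewrite lee_fin mulr_ge0// ker_ge0.
apply: (@le_trans _ _ (\int[mu]_y (`|F y - F a| * ker s a (rowt y))%:E)%E).
  apply: (le_trans (le_abse_integral _ _ _)) => //.
    apply/measurable_EFinP; apply: measurable_funB; apply: measurable_funM => //.
  apply: le_ge0_integral => y _; first exact: abse_ge0.
  by rewrite -EFinB /= lee_fin -mulrBl normrM (@ger0_norm _ (ker _ _ _))// ker_ge0.
have := int_tmove muL a s0 mH H0 => h.
have : ((s ^- n)%:E * \int[mu]_y (`|F y - F a| * ker s a (rowt y))%:E = (s ^- n)%:E * err s a)%E.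
  rewrite -h /err -ge0_integralZl_EFin//; last 3 first.
  - by move=> w _; rewrite lee_fin mulr_ge0// eta_ge0.
  - exact: (measurableT_comp (mJ s) (pair1_measurable a)).
  - by rewrite invr_ge0 ltW.
  by apply: eq_integral => w _; rewrite ker_tmove// -EFinM mulrCA.
move=> /(congr1 (fun x => (s ^+ n)%:E * x)%E).
by rewrite !muleA -!EFinM mulfV ?gt_eqF// !mul1e => ->.
Qed.

Let nn_diff s w x : (0 <= (`|F (tmove x s w) - F x|)%:E :> \bar R)%E.
Proof. by rewrite lee_fin. Qed.

Let nn_J s x w : (0 <= (`|F (tmove x s w) - F x| * eta w)%:E :> \bar R)%E.
Proof. by rewrite lee_fin mulr_ge0 ?eta_ge0. Qed.

Let mdiffw s w : measurable_fun setT (fun x => (`|F (tmove x s w) - F x|)%:E).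
Proof.
apply/measurable_EFinP; apply: measurableT_comp => //; apply: measurable_funB => //.
exact: (measurableT_comp mF (measurable_tmovel _ _)).
Qed.

Let mcube1 (r : R) (a : Rn) : measurable_fun setT (fun z : Rn * Rn => (\1_(cube r a) z.1 : R)%:E).
Proof.
apply/measurable_EFinP; apply: (measurableT_comp _ measurable_fst); apply: measurable_indic.
exact: measurable_cube.
Qed.

Let mcube2 (r : R) (a : Rn) : measurable_fun setT (fun z : Rn * Rn => (\1_(cube r a) z.2 : R)%:E).
Proof.
apply/measurable_EFinP; apply: (measurableT_comp _ measurable_snd); apply: measurable_indic.
exact: measurable_cube.
Qed.

Let cubeE (r : R) (a : Rn) (u : Rn -> \bar R) :
  (\int[mu]_(x in cube r a) u x = \int[mu]_x (u x * (\1_(cube r a) x)%:E))%E.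
Proof.
rewrite integral_mkcond; apply: eq_integral => x _; rewrite patchE indicE.
by case: ifP => _; rewrite ?mule1 ?mule0.
Qed.

Let tonelli_err (e : nat -> R) r a k : (\int[mu]_(x in cube r a) err (e k) x =
  \int[mu]_w ((eta w)%:E * shift_err mu e w a r k F))%E.
Proof.
rewrite cubeE.
transitivity (\int[mu]_x \int[mu]_w
    ((`|F (tmove x (e k) w) - F x| * eta w)%:E * (\1_(cube r a) x)%:E))%E.
  apply: eq_integral => x _; apply/esym.
  apply: (ge0_integralZr mu measurableT (measurableT_comp (mJ (e k)) (pair1_measurable x))).
    by move=> w _; exact: nn_J.
  by rewrite lee_fin.
rewrite (@tonelli_lebesgue_n _ _ _ muL (fun z : Rn * Rn =>
   (`|F (tmove z.1 (e k) z.2) - F z.1| * eta z.2)%:E * (\1_(cube r a) z.1)%:E)%E); last 2 first.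
- exact: (emeasurable_funM (mJ (e k)) (mcube1 r a)).
- by move=> z; apply: mule_ge0; [exact: nn_J|rewrite lee_fin].
apply: eq_integral => w _; rewrite /shift_err cubeE.
have mu1 : measurable_fun setT (fun x => (`|F (tmove x (e k) w) - F x|)%:E * (\1_(cube r a) x)%:E)%E.
  apply: (emeasurable_funM (mdiffw (e k) w)); apply/measurable_EFinP; apply: measurable_indic.
  exact: measurable_cube.
rewrite -(@ge0_integralZl_EFin _ _ _ mu _ measurableT _ _ mu1 _ (eta_ge0 w)); last first.
  by move=> x _; apply: mule_ge0; [exact: nn_diff|rewrite lee_fin].
by apply: eq_integral => x _; rewrite /= EFinM [X in (X * _)%E = _]muleC -muleA.
Qed.

Let measurable_eta_shift_err (e : nat -> R) r a k :
  measurable_fun setT (fun w => (eta w)%:E * shift_err mu e w a r k F)%E.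
Proof.
apply: emeasurable_funM; first by apply/measurable_EFinP; exact: measurable_eta.
rewrite (_ : (fun w => shift_err mu e w a r k F) =
  fun w => \int[mu]_x ((`|F (tmove x (e k) w) - F x|)%:E * (\1_(cube r a) x)%:E))%E; last first.
  by apply/funext => w; rewrite /shift_err cubeE.
apply: (@measurable_int_lebesgue_n _ _ _ muL _ _ (fun z : Rn * Rn =>
  (`|F (tmove z.2 (e k) z.1) - F z.2|)%:E * (\1_(cube r a) z.2)%:E)%E); last first.
  by move=> z; apply: mule_ge0; [exact: nn_diff|rewrite lee_fin].
apply: emeasurable_funM; last exact: mcube2.
apply/measurable_EFinP; apply: measurableT_comp => //; apply: measurable_funB.
  have msw : measurable_fun setT (fun z : Rn * Rn => (z.2, z.1)).
    by apply: measurable_fun_pair; [exact: measurable_snd|exact: measurable_fst].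
  exact: (measurableT_comp mF (measurableT_comp (measurable_tmove2 (e k)) msw)).
exact: (measurableT_comp mF measurable_snd).
Qed.

Let abs_int (s : R) a : R := fine (\int[mu]_(x in cube s a) (`|F x|)%:E)%E.

Let abs_intE s a : (\int[mu]_(x in cube s a) (`|F x|)%:E = (abs_int s a)%:E)%E.
Proof.
have /integrableP[_ h] := iF s a.
by rewrite fineK// ge0_fin_numE//; apply: integral_ge0 => x _; rewrite lee_fin.
Qed.

Let le_abs_int (r r2 : R) a : r <= r2 -> (\int[mu]_(x in cube r a) (`|F x|)%:E <= (abs_int r2 a)%:E)%E.
Proof.
move=> rr2; rewrite -abs_intE; apply: ge0_subset_integral.
- exact: measurable_cube.
- exact: measurable_cube.
- by apply: measurable_funTS; apply/measurable_EFinP; exact: measurableT_comp.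
- by move=> x _; rewrite lee_fin.
- by move=> x h i; apply: (le_trans (h i)); rewrite ler_pM2l.
Qed.

(** The dominating function for the limit in k. Where [eta] may be nonzero the coordinates of w lie
    in [0, 3], so their sum is at most 3 n and all translates stay in one cube. *)
Let shift_err_bound (e : nat -> R) (s r : R) a k w : 0 < s -> 0 < r -> (forall k, 0 <= e k <= s) ->
  ((eta w)%:E * shift_err mu e w a r k F <= (eta w * (2 * abs_int (r + s * (3 * n%:R)) a))%:E)%E.
Proof.
move=> s0 r0 eE.
have [wi|wi] := pselect (forall i, 0 <= tnth w i <= 3); last first.
  by rewrite eta_out// mul0e mul0r.
rewrite EFinM; apply: lee_wpmul2l; first by rewrite lee_fin eta_ge0.
have mQ : measurable (cube r a) by exact: measurable_cube.
have mabs : measurable_fun setT (fun x => `|F x|) by exact: measurableT_comp.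
have m1 : measurable_fun (cube r a) (fun x => (`|F x|)%:E).
  by apply: measurable_funTS; exact/measurable_EFinP.
have m2 : measurable_fun (cube r a) (fun x => (`|F (tmove x (e k) w)|)%:E).
  apply: measurable_funTS; apply/measurable_EFinP.
  exact: (measurableT_comp mabs (measurable_tmovel _ _)).
apply: (@le_trans _ _ (\int[mu]_(x in cube r a) (`|F (tmove x (e k) w)|)%:E +
   \int[mu]_(x in cube r a) (`|F x|)%:E)%E).
  rewrite -(ge0_integralD mu mQ _ m2 _ m1); [|by move=> x _; rewrite lee_fin..].
  by apply: le_ge0_integral => x _; rewrite -?EFinD lee_fin// ler_normB.
rewrite mulr_natl mulr2n EFinD; apply: leeD.
  apply: (le_trans (int_cube_shift muL w a r eE k mabs (fun x => normr_ge0 _))).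
  apply: le_abs_int; rewrite lerD2l ler_pM2l//.
  rewrite [leRHS](_ : _ = \sum_(i < n) 3); last by rewrite sumr_const card_ord mulr_natr.
  by apply: ler_sum => j _; have /andP[h1 h2] := wi j; rewrite ger0_norm.
by apply: le_abs_int; rewrite lerDl mulr_ge0 ?(ltW s0)// mulr_ge0.
Qed.

Let shift_err_ge0 (e : nat -> R) r a k w : (0 <= shift_err mu e w a r k F)%E.
Proof. by apply: integral_ge0 => x _; rewrite lee_fin. Qed.

Let small_cvge (u : nat -> \bar R) : (forall k, 0 <= u k)%E ->
  (forall d : R, 0 < d -> \forall k \near \oo, (u k <= d%:E)%E) -> u @ \oo --> 0%E.
Proof.
move=> u0 uc; apply/fine_cvgP; split.
  near=> k; rewrite ge0_fin_numE//; apply: (@le_lt_trans _ _ 1%:E); last exact: ltry.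
  by near: k; apply: uc.
apply/cvgr0Pnorm_le => c c0; near=> k.
have uk : (u k <= c%:E)%E by near: k; apply: uc.
have uf : u k \is a fin_num by rewrite ge0_fin_numE// (le_lt_trans uk)// ltry.
by rewrite /= ger0_norm ?fine_ge0// -lee_fin fineK.
Unshelve. all: by end_near. Qed.

Let cvge_small (u : nat -> \bar R) : u @ \oo --> 0%E ->
  forall d : R, 0 < d -> \forall k \near \oo, (u k <= d%:E)%E.
Proof.
move=> /fine_cvgP[fin /cvgr0Pnorm_le cv] d d0; have {}cv := cv d d0; near=> k.
have uf : u k \is a fin_num by near: k.
rewrite -(fineK uf) lee_fin; apply: le_trans (ler_norm _) _; near: k; exact: cv.
Unshelve. all: by end_near. Qed.

Lemma integral_err_cvg0 (s r : R) a : 0 < s -> 0 < r -> forall d : R, 0 < d ->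
  \forall k \near \oo, (\int[mu]_(x in cube r a) err (s * 2^-1 ^+ k) x <= d%:E)%E.
Proof.
move=> s0 r0; apply: cvge_small; pose e k : R := s * 2^-1 ^+ k.
have eE k : 0 <= e k <= s.
  rewrite /e mulr_ge0 ?exprn_ge0 ?(ltW s0)//= ler_piMr ?(ltW s0)// exprn_ile1//; lra.
have ecvg : e @ \oo --> (0 : R).
  rewrite -(mulr0 s); apply: cvgM; first exact: cvg_cst.
  by apply: cvg_expr; rewrite ger0_norm//; lra.
have -> : (fun k => \int[mu]_(x in cube r a) err (s * 2^-1 ^+ k) x)%E =
   (fun k => \int[mu]_w ((eta w)%:E * shift_err mu e w a r k F))%E.
  by apply/funext => k; rewrite -tonelli_err.
have bound := shift_err_bound a _ _ s0 r0 eE.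
have := @dominated_cvg _ _ _ mu setT measurableT
  (fun k w => (eta w)%:E * shift_err mu e w a r k F)%E (cst 0%E)
  (fun w => (eta w * (2 * abs_int (r + s * (3 * n%:R)) a))%:E)
  (measurable_eta_shift_err e r a).
rewrite integral0; apply => //.
- move=> w _.
  have [wi|wi] := pselect (forall i, 0 <= tnth w i <= 3); last first.
    by rewrite eta_out//; under eq_fun do rewrite mul0e; exact: cvg_cst.
  have w0 i : 0 <= tnth w i by case/andP: (wi i).
  have Tc := @shift_err_cvg0 _ _ _ muL e s w a r r0 eE ecvg w0 F mF (iF _ _).
  have := small_cvge (fun k => shift_err_ge0 e r a k w) Tc.
  by move=> /(@cvgeZl _ _ _ _ _ (eta w)%:E erefl); rewrite mule0; exact.
- rewrite (_ : (fun w => _) =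
    (fun w => (2 * abs_int (r + s * (3 * n%:R)) a)%:E * (eta w)%:E)%E); last first.
    by apply/funext => w; rewrite -EFinM mulrC.
  apply: integrableZl => //; apply/integrableP; split.
    by apply/measurable_EFinP; exact: measurable_eta.
  under eq_integral do rewrite gee0_abs ?lee_fin ?eta_ge0//.
  by rewrite integral_eta ltry.
- move=> k w _; rewrite gee0_abs; first exact: bound.
  by apply: mule_ge0; [rewrite lee_fin eta_ge0|exact: shift_err_ge0].
Qed.

End mollifier.

(** * The almost everywhere estimate *)

Section ereal_series.
Context {R : realType}.
Local Open Scope ereal_scope.

Lemma poweR_convD (x y : \bar R) (p r : R) : (1 < p)%R -> (0 < r < 1)%R -> 0 <= x -> 0 <= y ->
  (x + y) `^ p <= ((1 - r) `^ (1 - p))%:E * x `^ p + (r `^ (1 - p))%:E * y `^ p.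
Proof.
move=> p1 r01; have p0 : (p != 0)%R by rewrite gt_eqF//; lra.
have c0 : 0 < ((1 - r) `^ (1 - p))%:E :> \bar R by rewrite lte_fin powR_gt0//; lra.
have d0 : 0 < (r `^ (1 - p))%:E :> \bar R by rewrite lte_fin powR_gt0//; lra.
have py (u v : \bar R) : 0 <= u -> u * v `^ p != -oo.
  by move=> u0; rewrite -ltNye (lt_le_trans _ (mule_ge0 u0 (poweR_ge0 v p))).
case: x => [x| |] //; case: y => [y| |] //.
- rewrite lee_fin => x0; rewrite lee_fin => y0.
  by rewrite -EFinD !poweR_EFin -!EFinM -EFinD lee_fin; exact: powR_convD.
- by move=> _ _; rewrite poweRyr// gt0_muley// addey ?py ?(ltW c0)// leey.
- by move=> _ _; rewrite poweRyr// gt0_muley// addye ?py ?(ltW d0)// leey.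
- by move=> _ _; rewrite poweRyr// gt0_muley// gt0_muley// leey.
Qed.

Lemma poweR_subadd (x y : \bar R) (r : R) : (0 < r <= 1)%R -> 0 <= x -> 0 <= y ->
  (x + y) `^ r <= x `^ r + y `^ r.
Proof.
move=> r01; have r0 : (r != 0)%R by rewrite gt_eqF//; lra.
have py (v : \bar R) : v `^ r != -oo by rewrite -ltNye (lt_le_trans _ (poweR_ge0 v r)).
case: x => [x| |] //; case: y => [y| |] //.
- rewrite lee_fin => x0; rewrite lee_fin => y0.
  by rewrite -EFinD !poweR_EFin -EFinD lee_fin; exact: powR_subadd.
- by move=> _ _; rewrite poweRyr// addey ?py// leey.
- by move=> _ _; rewrite poweRyr// addye ?py// leey.
- by move=> _ _; rewrite poweRyr// addye// leey.
Qed.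

Lemma le_poweR (x y : \bar R) (p : R) : (0 <= p)%R -> 0 <= x -> x <= y -> x `^ p <= y `^ p.
Proof.
move=> p0 x0 xy; apply: gt0_ler_poweR => //; rewrite in_itv/= leey andbT//.
exact: le_trans xy.
Qed.

(** Taking p-th roots turns the hypothesis into a bound on partial sums, which passes to the
    limit. *)
Lemma nneseries_poweR_le (a : nat -> \bar R) (p : R) (M : \bar R) : (0 < p)%R ->
  (forall l, 0 <= a l) -> (forall L, (\sum_(l < L) a l) `^ p <= M) ->
  (\sum_(l <oo) a l) `^ p <= M.
Proof.
move=> p0 a0 h; have pn0 : (p != 0)%R by rewrite gt_eqF.
have M0 : 0 <= M by apply: le_trans (h 0%N); exact: poweR_ge0.
have S0 : 0 <= \sum_(l <oo) a l by apply: nneseries_ge0 => l _ _.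
suff : \sum_(l <oo) a l <= M `^ p^-1.
  move=> /(le_poweR (ltW p0) S0) /le_trans; apply.
  by rewrite -poweRrM mulVf// poweRe1.
apply: lime_le; first by apply: is_cvg_nneseries => l _ _.
apply: nearW => L; rewrite big_mkord.
have s0 : 0 <= \sum_(l < L) a l by apply: sume_ge0.
have pV : (0 <= p^-1)%R by rewrite invr_ge0 ltW.
have := le_poweR pV (poweR_ge0 _ _) (h L).
by rewrite -poweRrM mulfV// poweRe1.
Qed.

Lemma sum_le_nneseries (a : nat -> \bar R) L : (forall l, 0 <= a l) ->
  \sum_(l < L) a l <= \sum_(l <oo) a l.
Proof.
by move=> a0; rewrite -(big_mkord xpredT a); apply: nneseries_lim_ge => l _.
Qed.

(** Hoelder's inequality with geometric weights, obtained by peeling off the first term repeatedly;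
    each peeling multiplies the rest by r^(1 - p). *)
Lemma poweR_sum_le (a : nat -> \bar R) (p r : R) : (1 < p)%R -> (0 < r < 1)%R ->
  (forall l, 0 <= a l) ->
  (\sum_(l <oo) a l) `^ p <=
  ((1 - r) `^ (1 - p))%:E * \sum_(l <oo) ((r `^ (1 - p)) ^+ l)%:E * a l `^ p.
Proof.
move=> p1 r01 a0; have p0 : (0 < p)%R by lra.
set C := ((1 - r) `^ (1 - p))%R; set k := (r `^ (1 - p))%R.
have C0 : 0 <= C%:E by rewrite lee_fin powR_ge0.
have k0 : (0 <= k)%R by rewrite powR_ge0.
have t0 (b : nat -> \bar R) l : 0 <= (k ^+ l)%:E * b l `^ p.
  by rewrite mule_ge0 ?poweR_ge0// lee_fin exprn_ge0.
apply: nneseries_poweR_le => // L.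
apply: (@le_trans _ _ (C%:E * \sum_(l < L) ((k ^+ l)%:E * a l `^ p))); last first.
  by apply: lee_wpmul2l => //; exact: (sum_le_nneseries (a := fun l => (k ^+ l)%:E * a l `^ p)).
elim: L a a0 => [|L IH] a a0; first by rewrite !big_ord0 mule0 poweR0r// gt_eqF.
rewrite !big_ord_recl/= expr0 mul1e.
have s0 : 0 <= \sum_(i < L) a i.+1 by apply: sume_ge0.
apply: (le_trans (poweR_convD p1 r01 (a0 0%N) s0)).
rewrite ge0_muleDr ?poweR_ge0//; last by apply: sume_ge0 => i _; exact: (t0 a i.+1).
apply: leeD2l; have := IH (fun l => a l.+1) (fun l => a0 l.+1).
move=> /(lee_wpmul2l (_ : 0 <= k%:E)) => /(_ ltac:(by rewrite lee_fin)) /le_trans; apply.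
rewrite muleCA; apply: lee_wpmul2l => //.
rewrite ge0_sume_distrr; last by move=> i _; exact: (t0 (fun l => a l.+1) i).
by apply: lee_sum => i _; rewrite muleA -EFinM -exprS.
Qed.

Lemma poweR_sum_subadd (a : nat -> \bar R) (r : R) : (0 < r <= 1)%R -> (forall l, 0 <= a l) ->
  (\sum_(l <oo) a l) `^ r <= \sum_(l <oo) a l `^ r.
Proof.
move=> r01 a0; have r0 : (0 < r)%R by lra.
apply: nneseries_poweR_le => // L.
apply: (@le_trans _ _ (\sum_(l < L) a l `^ r)); last first.
  by apply: (sum_le_nneseries (a := fun l => a l `^ r)) => l; exact: poweR_ge0.
elim: L => [|L IH]; first by rewrite !big_ord0 poweR0r// gt_eqF.
rewrite !big_ord_recr/=; have s0 : 0 <= \sum_(i < L) a i by apply: sume_ge0.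
by apply: (le_trans (poweR_subadd r01 s0 (a0 L))); exact: leeD2r.
Qed.

Lemma dist_trans (x y z : R) (X Y : \bar R) :
  (`|x - z|)%:E <= X -> (`|z - y|)%:E <= Y -> (`|x - y|)%:E <= X + Y.
Proof.
move=> h1 h2; apply: le_trans (leeD h1 h2); rewrite -EFinD lee_fin.
by rewrite -[(x - y)%R](subrKA z) ler_normD.
Qed.

(** Bookkeeping for a path with five legs: [e1] and [e2] are mollification errors, [x] and [y] sums
    over scales at the two ends, [t] the move between them at the coarsest scale. *)
Lemma chain_bound (K : R) (e1 e2 x y t : \bar R) : (0 <= K)%R -> 0 <= e1 -> 0 <= e2 ->
  0 <= x -> 0 <= y -> t <= x ->
  e1 + K%:E * y + K%:E * t + K%:E * x + e2 <= e1 + e2 + (2 * K)%:E * (x + y).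
Proof.
move=> K0 e10 e20 x0 y0 tx.
have Ke : 0 <= K%:E by rewrite lee_fin.
have a0 : 0 <= K%:E * x by rewrite mule_ge0.
have b0 : 0 <= K%:E * y by rewrite mule_ge0.
have -> : (2 * K)%:E * (x + y) = (K%:E * x + K%:E * y) + (K%:E * x + K%:E * y).
  rewrite -ge0_muleDr// mulr_natl mulr2n EFinD ge0_muleDl//.
apply: (@le_trans _ _ (e1 + K%:E * y + K%:E * x + K%:E * x + e2)).
  by apply: leeD2r; apply: leeD2r; apply: leeD2l; apply: lee_wpmul2l.
move: (K%:E * x) (K%:E * y) a0 b0 => a b a0 b0.
rewrite [leLHS](_ : _ = e1 + e2 + (a + b + a)).
  by apply: leeD2l; apply: leeD2l; rewrite leeDl.
by rewrite addeC -!addeA addeCA; congr (_ + (_ + _)); exact: addeCA.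
Qed.

End ereal_series.

(** * Telescoping over scales and the bound on differences *)

Section pointwise_bound.
Context {R : realType} {n : nat}.
Notation Rn := (n.-tuple R).
Variable mu : {measure set Rn -> \bar R}.
Hypothesis muL : is_lebesgue_n mu.
Variables (f : 'rV[R]_n -> R) (g : 'I_n -> 'rV[R]_n -> R).
Hypothesis fW : in_Wdot1n mu f g.
Variables (s : R) (h : Rn).
Hypotheses (s0 : (0 < s)%R) (hs : forall i, `|tnth h i| <= s).
Local Open Scope ereal_scope.

Let F (x : Rn) : R := f (rowt x).
Let G := grad_norm g.
Let K0 : R := (n%:R * 72 ^+ n)%R.
Let sl (l : nat) : R := (s * 2^-1 ^+ l)%R.
Let sl0 l : (0 < sl l)%R. Proof. by rewrite mulr_gt0// exprn_gt0. Qed.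

Definition scale_sum (x : Rn) : \bar R :=
  \sum_(l <oo) ((s * 2^-1 ^+ l)%:E * avg mu (s * 2^-1 ^+ l) (grad_norm g) x).

Let term l x := (sl l)%:E * avg mu (sl l) G x.

Let term_ge0 l x : 0 <= term l x.
Proof.
apply: mule_ge0; first by rewrite lee_fin ltW.
by apply: avg_ge0 => //; exact: grad_norm_ge0.
Qed.

Lemma scale_sum_ge0 x : 0 <= scale_sum x.
Proof. by apply: nneseries_ge0 => l _ _; exact: term_ge0. Qed.

Let mterm l : measurable_fun setT (term l).
Proof.
apply: measurable_funeM; apply: (measurable_avg muL); first exact: grad_norm_ge0.
exact: (measurable_grad_norm fW).
Qed.

Lemma measurable_scale_sum : measurable_fun setT scale_sum.
Proof.
apply: (@ge0_emeasurable_sum _ _ _ setT (fun l x => term l x) xpredT).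
- by move=> l x _ _; exact: term_ge0.
- by move=> l _; exact: mterm.
Qed.

Let A l x : R := fine (\int[mu]_y (F y * ker (sl l) x (rowt y))%:E).

Let AE l x : \int[mu]_y (F y * ker (sl l) x (rowt y))%:E = (A l x)%:E.
Proof.
by rewrite fineK//; apply: integrable_fin_num => //; exact: (integrable_ker fW).
Qed.

Let K0_ge0 : (0 <= K0)%R. Proof. by rewrite mulr_ge0// exprn_ge0. Qed.

Let diff_bound l x : (n%:R * (72 ^+ n * sl l))%:E * avg mu (sl l) G x = K0%:E * term l x.
Proof. by rewrite /term [RHS]muleA -EFinM -[(K0 * _)%R]mulrA. Qed.

(** The kernel comparison with equal corners and halved scale; [A_shift] is the other extreme, equal
    scales and a corner moved by h. *)
Let A_step l x : (`|A l x - A l.+1 x|)%:E <= K0%:E * term l x.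
Proof.
have := @ker_difference _ _ mu f g fW (sl l) (sl l.+1) x x (sl0 l).
rewrite AE AE diff_bound; apply.
- rewrite /sl exprS; have := sl0 l; rewrite /sl; lra.
- by move=> i; rewrite subrr normr0 ltW.
Qed.

Let A_shift x : (`|A 0 (tmove x 1 h) - A 0 x|)%:E <= K0%:E * term 0 x.
Proof.
rewrite distrC.
have := @ker_difference _ _ mu f g fW (sl 0) (sl 0) x (tmove x 1 h) (sl0 0).
rewrite AE AE diff_bound; apply.
- by have := sl0 0; lra.
- by move=> i; rewrite tnth_tmove mul1r addrAC subrr add0r /sl expr0 mulr1.
Qed.

Let A_chain k x : (`|A 0 x - A k x|)%:E <= K0%:E * \sum_(l < k) term l x.
Proof.
elim: k => [|k IH]; first by rewrite subrr normr0 big_ord0 mule0.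
rewrite big_ord_recr/= ge0_muleDr//; last by apply: sume_ge0.
exact: dist_trans IH (A_step k x).
Qed.

Let A_chain_sum k x : (`|A 0 x - A k x|)%:E <= K0%:E * scale_sum x.
Proof.
apply: (le_trans (A_chain k x)); apply: lee_wpmul2l; first by rewrite lee_fin.
exact: (sum_le_nneseries (a := fun l => term l x)).
Qed.

Let c := mass mu.

Let A_err k x : (`|A k x - c * F x|)%:E <= err mu F (sl k) x.
Proof.
have mF : measurable_fun setT F by case: fW.
have := ker_err muL mF (sl0 k) (integrable_ker fW x (sl0 k)).
by rewrite AE.
Qed.

Let rhs x := (2 * K0)%:E * (scale_sum x + scale_sum (tmove x 1 h)).

Let pre_bound k x : (`|c * F (tmove x 1 h) - c * F x|)%:E <=
  err mu F (sl k) (tmove x 1 h) + err mu F (sl k) x + rhs x.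
Proof.
set y := tmove x 1 h.
have h1 := A_err k y; have h2 := A_chain_sum k y; have h3 := A_shift x.
have h4 := A_chain_sum k x; have h5 := A_err k x.
have t0 : term 0 x <= scale_sum x.
  have := sum_le_nneseries 1 (term_ge0^~ x); by rewrite big_ord1.
rewrite distrC in h1; rewrite distrC in h2.
have := dist_trans (dist_trans (dist_trans (dist_trans h1 h2) h3) h4) h5.
move/le_trans; apply; apply: chain_bound.
- exact: K0_ge0.
- exact: err_ge0.
- exact: err_ge0.
- exact: scale_sum_ge0.
- exact: scale_sum_ge0.
- exact: t0.
Qed.

Let mF : measurable_fun setT F. Proof. by case: fW. Qed.
Let iF s' a : mu.-integrable (cube s' a) (EFin \o F). Proof. exact: (integrable_cube fW). Qed.

Let rhs_ge0 x : 0 <= rhs x.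
Proof. by rewrite mule_ge0 ?lee_fin ?mulr_ge0// adde_ge0 ?scale_sum_ge0. Qed.

Let mrhs : measurable_fun setT rhs.
Proof.
apply: measurable_funeM; apply: emeasurable_funD; first exact: measurable_scale_sum.
exact: (measurableT_comp measurable_scale_sum (measurable_tmovel _ _)).
Qed.

(** The excess of the difference over the desired bound, equal to 0 where that bound is infinite. At
    every scale it is below two mollification errors, so its integral over each cube vanishes. *)
Let Z x := maxe 0 ((`|c * F (tmove x 1 h) - c * F x|)%:E - rhs x).

Let mZ : measurable_fun setT Z.
Proof.
apply: measurable_maxe; first exact: measurable_cst.
apply: emeasurable_funB => //; apply/measurable_EFinP; apply: measurableT_comp => //.
apply: measurable_funB; apply: measurable_funM => //.
exact: (measurableT_comp mF (measurable_tmovel _ _)).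
Qed.

Let Z_le k x : Z x <= err mu F (sl k) (tmove x 1 h) + err mu F (sl k) x.
Proof.
have E0 : 0 <= err mu F (sl k) (tmove x 1 h) + err mu F (sl k) x.
  by rewrite adde_ge0 ?err_ge0.
rewrite /Z ge_max E0/=; move: (pre_bound k x) (rhs_ge0 x).
case: (rhs x) => [r|_ _|//]; last by rewrite addeNy leNye.
by move=> h1 _; rewrite leeBlDr.
Qed.

Let hsum : R := \sum_i `|tnth h i|.

Let int_Z (r : R) : (0 < r)%R -> \int[mu]_(x in cube r origin) Z x = 0.
Proof.
move=> r0; have Z0 x : 0 <= Z x by rewrite le_max lexx.
have mQ : measurable (cube r (@origin R n)) by exact: measurable_cube.
apply/eqP; rewrite eq_le integral_ge0// andbT.
apply/lee_addgt0Pr => d d0; rewrite add0e.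
have d2 : (0 < d / 2)%R by rewrite divr_gt0.
pose r' : R := (r + 1 * hsum)%R.
have r'0 : (0 < r')%R by rewrite /r' mul1r ltr_wpDr// sumr_ge0.
near \oo => k.
have m1 : measurable_fun (cube r origin) (err mu F (sl k)).
  by apply: measurable_funTS; exact: (measurable_err muL mF).
have m2 : measurable_fun (cube r origin) (fun x => err mu F (sl k) (tmove x 1 h)).
  apply: measurable_funTS.
  exact: (measurableT_comp (measurable_err muL mF (sl k)) (measurable_tmovel _ _)).
apply: (@le_trans _ _ (\int[mu]_(x in cube r origin) (err mu F (sl k) (tmove x 1 h)) +
   \int[mu]_(x in cube r origin) err mu F (sl k) x)).
  rewrite -(ge0_integralD mu mQ _ m2 _ m1); [|by move=> x _; exact: err_ge0..].
  by apply: le_ge0_integral => x _; [exact: Z0|exact: Z_le].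
have -> : d%:E = (d / 2)%:E + (d / 2)%:E by rewrite -EFinD; congr EFin; lra.
apply: leeD; last by near: k; exact: (integral_err_cvg0 muL mF iF _ s0 r0 d2).
apply: (@le_trans _ _ (\int[mu]_(x in cube r' origin) err mu F (sl k) x)); last first.
  by near: k; exact: (integral_err_cvg0 muL mF iF _ s0 r'0 d2).
have mQ' : measurable (cube r' (@origin R n)) by exact: measurable_cube.
rewrite [leRHS]integral_mkcond -(int_shift muL 1 h); last 2 first.
- have := (measurable_restrictT (err mu F (sl k)) mQ').1; apply.
  by apply: measurable_funTS; exact: (measurable_err muL mF).
- by move=> y; rewrite patchE; case: ifP => // _; exact: err_ge0.
rewrite integral_mkcond; apply: le_ge0_integral => x _.
  by rewrite patchE; case: ifP => // _; exact: err_ge0.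
rewrite !patchE; case: ifPn => [|_]; last by case: ifP => // _; exact: err_ge0.
have e1 (j : nat) : (0 <= (1 : R) <= 1)%R by rewrite ler01 lexx.
by rewrite inE => /(tmove_cube (e := fun=> 1%R) h e1 0%N) Qx; rewrite mem_set.
Unshelve. all: by end_near. Qed.

Lemma ae_difference_bound : {ae mu, forall x,
  (c * `|F (tmove x 1 h) - F x|)%:E <= (2 * K0)%:E * (scale_sum x + scale_sum (tmove x 1 h))}.
Proof.
have c0 := mass_gt0 muL.
have : {ae mu, forall x, forall k : nat, cube k.+1%:R origin x -> Z x = 0}.
  apply: ae_foralln => k.
  have mQ : measurable (cube k.+1%:R (@origin R n)) by exact: measurable_cube.
  have Z0 x : 0 <= Z x by rewrite le_max lexx.
  have := (ae_eq_integral_abs mu mQ (measurable_funTS mZ)).1.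
  by apply; under eq_integral do rewrite gee0_abs//; exact: int_Z.
apply: filterS => x hx.
have [k Qx] : exists k : nat, cube k.+1%:R origin x.
  exists (Num.bound (\sum_i `|tnth x i|)) => i; rewrite tnth_mktuple subr0.
  have : (`|tnth x i| <= \sum_i `|tnth x i|)%R by rewrite (bigD1 i)//= lerDl sumr_ge0.
  have b0 : (0 <= \sum_i `|tnth x i|)%R by apply: sumr_ge0.
  have := archi_boundP b0; rewrite -natr1.
  move: (\sum_i _)%R => y; have := ler0n R (Num.bound y); lra.
have := hx k Qx; rewrite /Z => /eqP; rewrite eq_le ge_max => /andP[/andP[_ +] _].
rewrite -mulrBr normrM (gtr0_norm c0) -/(rhs x).
move: (rhs_ge0 x); case: (rhs x) => [r|_|//]; last by rewrite leey.
by move=> _; rewrite leeBlDr// add0e.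
Qed.

End pointwise_bound.

(** * The modulus of continuity and the Besov norm *)

Section shift_norm.
Context {R : realType} {n : nat}.
Notation Rn := (n.-tuple R).
Variable mu : {measure set Rn -> \bar R}.
Hypothesis muL : is_lebesgue_n mu.
Local Open Scope ereal_scope.

Lemma ae_shift_powR_le (p K : R) (S : Rn -> \bar R) (u : Rn -> R) (h : Rn) :
  (1 < p)%R -> (0 <= K)%R -> (forall x, 0 <= S x) -> measurable_fun setT S ->
  measurable_fun setT u ->
  {ae mu, forall x, (`|u x|)%:E <= K%:E * (S x + S (tmove x 1 h))} ->
  \int[mu]_x (`|u x| `^ p)%:E <= ((2 * K) `^ p)%:E * \int[mu]_x (S x) `^ p.
Proof.
move=> p1 K0 S0 mS mu_ ae1; have p0 : (0 < p)%R by lra.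
have mSp : measurable_fun setT (fun x => S x `^ p).
  exact: (measurableT_comp (measurable_poweR p) mS).
have mShp : measurable_fun setT (fun x => S (tmove x 1 h) `^ p).
  exact: (measurableT_comp mSp (measurable_tmovel _ _)).
have k0 : (0 <= K `^ p * 2 `^ (p - 1))%R by rewrite mulr_ge0 ?powR_ge0.
have mD := emeasurable_funD mSp mShp.
have n0 x : setT x -> 0 <= S x `^ p + S (tmove x 1 h) `^ p.
  by move=> _; rewrite adde_ge0 ?poweR_ge0.
apply: (@le_trans _ _ (\int[mu]_x ((K `^ p * 2 `^ (p - 1))%:E * (S x `^ p + S (tmove x 1 h) `^ p)))).
  have n1 x : setT x -> 0 <= (`|u x| `^ p)%:E by move=> _; rewrite lee_fin powR_ge0.
  have m1 : measurable_fun setT (fun x : Rn => (`|u x| `^ p)%:E).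
    apply/measurable_EFinP; apply: (measurableT_comp (measurable_powR p)).
    exact: measurableT_comp.
  have n3 x : setT x -> 0 <= (K `^ p * 2 `^ (p - 1))%:E * (S x `^ p + S (tmove x 1 h) `^ p).
    by move=> h0; apply: mule_ge0; [rewrite lee_fin|exact: n0].
  have m3 := measurable_funeM (K `^ p * 2 `^ (p - 1))%:E mD.
  apply: (ae_ge0_le_integral measurableT n1 m1 n3 m3).
  move: ae1; apply: filterS => x hx _.
  have a0 : 0 <= (`|u x|)%:E by rewrite lee_fin.
  have := le_poweR (ltW p0) a0 hx.
  rewrite poweR_EFin => /le_trans; apply.
  rewrite poweRM ?lee_fin ?(adde_ge0 (S0 _) (S0 _))// poweR_EFin EFinM -muleA.
  apply: lee_wpmul2l; first by rewrite lee_fin powR_ge0.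
  exact: (poweR_addD p1 (S0 _) (S0 _)).
rewrite (ge0_integralZl_EFin mu measurableT n0 mD k0).
rewrite (ge0_integralD mu measurableT (fun x _ => poweR_ge0 _ _) mSp (fun x _ => poweR_ge0 _ _) mShp).
rewrite (int_shift muL 1 h mSp (fun x => poweR_ge0 _ _)).
set T := \int[mu]_x _; have T0 : 0 <= T by apply: integral_ge0 => x _; exact: poweR_ge0.
rewrite -[X in _ * (X + X) <= _]mul1e -ge0_muleDl// muleA -EFinD -EFinM.
apply: lee_wpmul2r => //; rewrite lee_fin powRM// [(2 `^ p * _)%R]mulrC -mulrA.
rewrite ler_wpM2l ?powR_ge0//.
have -> : (1 + 1 = 2 :> R)%R by lra.
by rewrite mulrC mulr_powRB1.
Qed.

End shift_norm.

(** * The modulus of continuity at one scale *)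

Section difference_norm.
Context {R : realType} {n : nat}.
Notation Rn := (n.-tuple R).
Variable mu : {measure set Rn -> \bar R}.
Hypothesis muL : is_lebesgue_n mu.
Variables (f : 'rV[R]_n -> R) (g : 'I_n -> 'rV[R]_n -> R).
Hypothesis fW : in_Wdot1n mu f g.
Variables (p rho J : R).
Hypotheses (n2 : (2 <= n)%N) (np : (n%:R < p)%R) (rho01 : (0 < rho < 1)%R).
Hypothesis JE : (\int[mu]_x (grad_norm g x ^+ n)%:E = J%:E)%E.
Local Open Scope ereal_scope.

Let G := grad_norm g.
Let G0 : forall x, (0 <= G x)%R := grad_norm_ge0 g.
Let mG : measurable_fun setT G := measurable_grad_norm fW.

Let p1 : (1 < p)%R. Proof. by apply: lt_trans np; rewrite ltr1n. Qed.
Let p0 : (0 < p)%R. Proof. exact: lt_trans p1. Qed.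
Let r01 : (0 < n%:R / p <= 1)%R.
Proof. by rewrite divr_gt0 ?ltr0n ?(leq_trans _ n2)//= ler_pdivrMr// mul1r ltW. Qed.

Definition weighted_sum (s : R) : \bar R :=
  \sum_(l <oo) ((rho ^- n) ^+ l * (s * 2^-1 ^+ l) ^+ n * avg_bound mu (grad_norm g) p (s * 2^-1 ^+ l))%:E.

Lemma weighted_sum_ge0 (s : R) : (0 < s)%R -> 0 <= weighted_sum s.
Proof.
move=> s0; apply: nneseries_ge0 => l _ _; have /andP[q0 _] := rho01.
rewrite lee_fin; apply: mulr_ge0; last exact: avg_bound_ge0.
by rewrite !mulr_ge0 ?exprn_ge0 ?invr_ge0 ?exprn_ge0 ?(ltW q0) ?(ltW s0) ?mulr_ge0 ?exprn_ge0 ?(ltW s0).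
Qed.

(** Hoelder over scales, then the subadditive power n/p. As (1 - p) n/p >= -n and both bases are
    below 1, the weights become at most (1 - rho)^-n and rho^(-n l), free of p. *)
Lemma integral_scale_sum (s : R) : (0 < s)%R ->
  (\int[mu]_x (scale_sum mu g s x) `^ p) `^ (n%:R / p) <= ((1 - rho) ^- n)%:E * weighted_sum s.
Proof.
move=> s0; have /andP[r0 r1] := r01; have /andP[q0 q1] := rho01.
pose sl (l : nat) : R := (s * 2^-1 ^+ l)%R.
have sl0 l : (0 < sl l)%R by rewrite mulr_gt0// exprn_gt0.
pose term l x := (sl l)%:E * avg mu (sl l) G x.
have term0 l x : 0 <= term l x.
  by apply: mule_ge0; [rewrite lee_fin ltW|exact: avg_ge0].
set C : R := ((1 - rho) `^ (1 - p))%R; set k : R := (rho `^ (1 - p))%R.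
have C0 : (0 <= C)%R by rewrite powR_ge0.
have k0 : (0 <= k)%R by rewrite powR_ge0.
pose X l := \int[mu]_x (avg mu (sl l) G x) `^ p.
have X0 l : 0 <= X l by apply: integral_ge0 => x _; exact: poweR_ge0.
have mterm l : measurable_fun setT (fun x => (k ^+ l)%:E * term l x `^ p).
  apply: measurable_funeM; apply: (measurableT_comp (measurable_poweR p)).
  by apply: measurable_funeM; exact: (measurable_avg muL).
have t0 l x : 0 <= (k ^+ l)%:E * term l x `^ p.
  by apply: mule_ge0; [rewrite lee_fin exprn_ge0|exact: poweR_ge0].
have mavgp l : measurable_fun setT (fun x => avg mu (sl l) G x `^ p).
  by apply: (measurableT_comp (measurable_poweR p)); exact: (measurable_avg muL).
have intterm l : \int[mu]_x ((k ^+ l)%:E * term l x `^ p) = (k ^+ l * sl l `^ p)%:E * X l.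
  rewrite -(ge0_integralZl_EFin mu measurableT (fun x _ => poweR_ge0 _ _) (mavgp l)); last first.
    by rewrite mulr_ge0 ?exprn_ge0 ?powR_ge0.
  apply: eq_integral => x _; rewrite /term poweRM ?lee_fin ?(ltW (sl0 l))//; last exact: avg_ge0.
  by rewrite poweR_EFin muleA -EFinM.
have bound : \int[mu]_x (scale_sum mu g s x) `^ p <= C%:E * \sum_(l <oo) ((k ^+ l * sl l `^ p)%:E * X l).
  apply: (@le_trans _ _ (\int[mu]_x (C%:E * \sum_(l <oo) ((k ^+ l)%:E * term l x `^ p)))).
    apply: le_ge0_integral => x _; first exact: poweR_ge0.
    exact: (poweR_sum_le p1 rho01 (fun l => term0 l x)).
  rewrite ge0_integralZl_EFin//; last 2 first.
  - by move=> x _; apply: nneseries_ge0 => l _ _; exact: t0.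
  - apply: (@ge0_emeasurable_sum _ _ _ setT (fun l x => (k ^+ l)%:E * term l x `^ p) xpredT).
    + by move=> l x _ _; exact: t0.
    + by move=> l _; exact: mterm.
  rewrite (integral_nneseries mu measurableT mterm (fun l x _ => t0 l x)).
  apply: lee_wpmul2l; first by rewrite lee_fin.
  by apply: lee_nneseries => [l _ _|l _]; [apply: integral_ge0 => x _; exact: t0|rewrite intterm].
have S0 : 0 <= \sum_(l <oo) ((k ^+ l * sl l `^ p)%:E * X l).
  by apply: nneseries_ge0 => l _ _; rewrite mule_ge0// lee_fin mulr_ge0 ?exprn_ge0 ?powR_ge0.
have I0 : 0 <= \int[mu]_x (scale_sum mu g s x) `^ p by apply: integral_ge0 => x _; exact: poweR_ge0.
apply: (le_trans (le_poweR (ltW r0) I0 bound)).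
rewrite poweRM ?lee_fin// poweR_EFin.
have Cr : (C `^ (n%:R / p) <= (1 - rho) ^- n)%R.
  rewrite /C -powRrM -powR_invn; last by lra.
  apply: ger_powR; first by lra.
  rewrite mulrBl mul1r [(p * _)%R]mulrC divfK ?gt_eqF//.
  by rewrite -[leLHS]add0r lerD2r ltW.
apply: (@le_trans _ _ (((1 - rho) ^- n)%:E * (\sum_(l <oo) ((k ^+ l * sl l `^ p)%:E * X l)) `^ (n%:R / p))).
  by apply: lee_wpmul2r; [exact: poweR_ge0|rewrite lee_fin].
apply: lee_wpmul2l; first by rewrite lee_fin invr_ge0 exprn_ge0//; lra.
apply: (le_trans (poweR_sum_subadd r01 _)).
  by move=> l; rewrite mule_ge0// lee_fin mulr_ge0 ?exprn_ge0 ?powR_ge0.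
apply: lee_nneseries => [l _ _|l _]; first exact: poweR_ge0.
rewrite poweRM ?lee_fin ?mulr_ge0 ?exprn_ge0 ?powR_ge0// poweR_EFin.
rewrite [leRHS]EFinM; apply: lee_pmul; rewrite ?lee_fin ?powR_ge0 ?poweR_ge0//.
  rewrite powRM ?exprn_ge0 ?powR_ge0// -powRrM [(p * _)%R]mulrC divfK ?gt_eqF//.
  rewrite powR_mulrn ?(ltW (sl0 l))// ler_wpM2r ?exprn_ge0 ?(ltW (sl0 l))//.
  rewrite -powR_mulrn// powRAC powR_mulrn ?powR_ge0//.
  rewrite lerXn2r ?nnegrE ?powR_ge0 ?invr_ge0 ?exprn_ge0 ?(ltW q0)//.
  rewrite /k -powRrM -powR_invn ?(ltW q0)//; apply: ger_powR; first by lra.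
  rewrite mulrBl mul1r [(p * _)%R]mulrC divfK ?gt_eqF//.
  by rewrite -[leLHS]add0r lerD2r ltW.
exact: (integral_avg_bound muL n2 mG G0 JE np (sl0 l)).
Qed.

(** The constant of the almost everywhere bound divided by the lower bound 2^-n for the mass. *)
Let K1 : R := (2 * (n%:R * 72 ^+ n) * 2 ^+ n)%R.

Lemma diffLp_bound (s : R) (h : Rn) : (0 < s)%R -> (forall i, `|tnth h i| <= s)%R ->
  (diffLp mu f p (rowt h)) `^ (n%:R / p) <=
  ((2 * (2 * (n%:R * 72 ^+ n) * 2 ^+ n)) ^+ n * (1 - rho) ^- n)%:E * weighted_sum s.
Proof.
move=> s0 hs; have /andP[r0 r1] := r01.
have K10 : (0 <= K1)%R by rewrite !mulr_ge0 ?exprn_ge0.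
have mF : measurable_fun setT (fun x : Rn => f (rowt x)) by case: fW.
have S0 x : 0 <= scale_sum mu g s x by exact: scale_sum_ge0.
have mS := measurable_scale_sum muL fW s0.
have ae1 : {ae mu, forall x, (`|f (rowt (tmove x 1 h)) - f (rowt x)|)%:E <=
    K1%:E * (scale_sum mu g s x + scale_sum mu g s (tmove x 1 h))}.
  have := ae_difference_bound muL fW s0 hs; apply: filterS => x.
  set d := `|_|%R; set S := _ + _ => hx.
  have d0 : (0 <= d)%R by exact: normr_ge0.
  have : (2^-1 ^+ n * d)%:E <= (2 * (n%:R * 72 ^+ n))%:E * S.
    by apply: le_trans hx; rewrite lee_fin ler_wpM2r// mass_ge.
  have c0 : 0 <= (2 ^+ n)%:E :> \bar R by rewrite lee_fin exprn_ge0.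
  have e : (2 ^+ n)%:E * (2^-1 ^+ n * d)%:E = d%:E.
    by rewrite -EFinM mulrA -exprMn mulfV// expr1n mul1r.
  move=> /(lee_wpmul2l c0); rewrite e.
  by move=> /le_trans; apply; rewrite muleA -EFinM mulrC.
have bound : diffLp mu f p (rowt h) <=
    ((2 * K1) `^ p)%:E * \int[mu]_x (scale_sum mu g s x) `^ p.
  rewrite [leLHS](_ : _ = \int[mu]_x (`|f (rowt (tmove x 1 h)) - f (rowt x)| `^ p)%:E).
    apply: (ae_shift_powR_le muL p1 K10 S0 mS) ae1.
    by apply: measurable_funB => //; exact: (measurableT_comp mF (measurable_tmovel _ _)).
  by apply: eq_integral => x _; rewrite rowt_tmove scale1r.
have D0 : 0 <= diffLp mu f p (rowt h) by apply: integral_ge0 => x _; rewrite lee_fin powR_ge0.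
apply: (le_trans (le_poweR (ltW r0) D0 bound)).
have T0 : 0 <= \int[mu]_x (scale_sum mu g s x) `^ p by apply: integral_ge0 => x _; exact: poweR_ge0.
rewrite poweRM ?lee_fin ?powR_ge0// poweR_EFin -powRrM [(p * _)%R]mulrC divfK ?gt_eqF//.
rewrite powR_mulrn ?mulr_ge0// EFinM -muleA; apply: lee_wpmul2l.
  by rewrite lee_fin exprn_ge0// mulr_ge0.
exact: integral_scale_sum.
Qed.

Let cD : R := ((2 * (2 * (n%:R * 72 ^+ n) * 2 ^+ n)) ^+ n * (1 - rho) ^- n)%R.

Let cD_ge0 : (0 <= cD)%R.
Proof.
have /andP[q0 q1] := rho01.
by rewrite mulr_ge0 ?invr_ge0 ?exprn_ge0//; lra.
Qed.

(** A box of side 1/(n + 1) with a corner at the origin lies in the unit ball, because n < (n +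
    1)^2. *)
Lemma omega_n_ge : (n.+1%:R ^- n <= omega_n mu)%R.
Proof.
pose b : R := (n.+1%:R^-1)%R.
have b0 : (0 < b)%R by rewrite invr_gt0.
have ballE : measurable [set x : Rn | (enorm (rowt x) < 1)%R] by exact: measurable_ball_enorm.
have ball_box : [set x : Rn | (enorm (rowt x) < 1)%R] `<=` box (fun=> -1)%R (fun=> 1)%R.
  move=> x /= hx i; have := coord_le_enorm (rowt x) i; rewrite mxE.
  by move=> /le_lt_trans /(_ hx); rewrite ltr_norml => /andP[/ltW -> ->].
have fin : mu [set x : Rn | (enorm (rowt x) < 1)%R] \is a fin_num.
  rewrite ge0_fin_numE//; apply: (@le_lt_trans _ _ (mu (box (fun=> -1)%R (fun=> 1)%R))).
    by apply: le_measure; rewrite ?inE//; exact: measurable_box.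
  by rewrite muL ?ltry// => i; lra.
rewrite -lee_fin fineK// [leLHS](_ : _ = mu (box (fun=> 0)%R (fun=> b)%R)); last first.
  rewrite muL => [|i]; last exact: ltW.
  by under eq_bigr do rewrite subr0; rewrite prodr_const card_ord exprVn.
apply: le_measure; rewrite ?inE//; first exact: measurable_box.
move=> x hx /=.
apply: (@le_lt_trans _ _ (Num.sqrt (n%:R * b ^+ 2))).
  apply: enorm_le_sup => i; rewrite mxE; have /andP[h1 h2] := hx i.
  by rewrite ger0_norm// ltW.
rewrite -[ltRHS]sqrtr1 ltr_sqrt//; rewrite /b exprVn ltr_pdivrMr ?exprn_gt0// mul1r.
have := ler0n R n; rewrite (_ : n.+1%:R = n%:R + 1 :> R)%R; last by rewrite natr1.
by move: (n%:R : R)%R => y y0; rewrite sqrrD expr1n mulr1; have := sqr_ge0 y; lra.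
Qed.

Lemma modulus_bound (s t : R) : (0 < t <= s)%R ->
  (modulus mu f p t) `^ n%:R <= ((2 * n.+1%:R) ^+ n * cD)%:E * weighted_sum s.
Proof.
move=> /andP[t0 ts]; have s0 : (0 < s)%R by lra.
have /andP[r0 r1] := r01.
have pr : (p^-1 * n%:R = n%:R / p)%R by rewrite mulrC.
rewrite /modulus -poweRrM pr.
have W0 := weighted_sum_ge0 s0.
(* Undoing the power n/p gives a bound on [diffLp] that is constant in h over the ball, so its mean
   costs only the ratio of (2 t)^n to t^n omega_n; this ratio is at most (2 (n + 1))^n. *)
pose X := (cD%:E * weighted_sum s) `^ (p / n%:R).
have nn0 : (n%:R != 0 :> R)%R by rewrite pnatr_eq0 -lt0n (leq_trans _ n2).
have omega0 : (0 < omega_n mu)%R.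
  by apply: lt_le_trans omega_n_ge; rewrite invr_gt0 exprn_gt0.
have mball : measurable [set x : Rn | (enorm (rowt x) < t)%R] by exact: measurable_ball_enorm.
have X0 : 0 <= X by exact: poweR_ge0.
have dX (h : Rn) : (enorm (rowt h) < t)%R -> diffLp mu f p (rowt h) <= X.
  move=> ht; have hs i : (`|tnth h i| <= s)%R.
    have := coord_le_enorm (rowt h) i; rewrite mxE => /le_trans; apply.
    by apply: le_trans ts; exact: ltW.
  have D0 : 0 <= diffLp mu f p (rowt h) by apply: integral_ge0 => x _; rewrite lee_fin powR_ge0.
  have := diffLp_bound s0 hs => /(le_poweR (_ : 0 <= p / n%:R)%R (poweR_ge0 _ _)).
  rewrite -poweRrM (_ : (n%:R / p * (p / n%:R) = 1)%R); last by field; rewrite nn0 gt_eqF.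
  rewrite poweRe1//; apply; exact: divr_ge0 (ltW p0) _.
have ball_le : mu [set x : Rn | (enorm (rowt x) < t)%R] <= ((2 * t) ^+ n)%:E.
  rewrite [leRHS](_ : _ = mu (box (fun=> - t)%R (fun=> t)%R)).
    apply: le_measure; rewrite ?inE//; first exact: measurable_box.
    move=> x /= hx i; have := coord_le_enorm (rowt x) i; rewrite mxE.
    by move=> /le_lt_trans /(_ hx); rewrite ltr_norml => /andP[/ltW -> ->].
  rewrite muL => [|i]; last by lra.
  by congr EFin; rewrite (eq_bigr (fun=> 2 * t)%R) ?prodr_const ?card_ord// => i _; ring.
have c0 : (0 <= (t ^+ n * omega_n mu)^-1)%R.
  by rewrite invr_ge0 mulr_ge0 ?exprn_ge0 ?(ltW t0) ?(ltW omega0).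
have Om1 : (1 <= (2 * n.+1%:R) ^+ n :> R)%R.
  by rewrite exprn_ege1//; have := @ler1n R n.+1; rewrite ltn0Sn; lra.
have bound : ((t ^+ n * omega_n mu)^-1)%:E *
     \int[mu]_(h in [set h | (enorm (rowt h) < t)%R]) diffLp mu f p (rowt h)
   <= ((2 * n.+1%:R) ^+ n)%:E * X.
  apply: (@le_trans _ _ (((t ^+ n * omega_n mu)^-1)%:E * (X * ((2 * t) ^+ n)%:E))).
    apply: lee_wpmul2l; first by rewrite lee_fin.
    apply: (@le_trans _ _ (\int[mu]_(h in [set h : Rn | (enorm (rowt h) < t)%R]) cst X h)).
      by apply: le_ge0_integral => h ht; [apply: integral_ge0 => x _; rewrite lee_fin powR_ge0|exact: dX].
    by rewrite integral_cst//; apply: lee_wpmul2l.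
  rewrite muleCA [leLHS]muleC; apply: lee_wpmul2r => //.
  rewrite -EFinM lee_fin !exprMn invfM.
  have tn : (t ^+ n != 0)%R by rewrite expf_neq0// gt_eqF.
  have -> : ((t ^+ n)^-1 / omega_n mu * (2 ^+ n * t ^+ n) = 2 ^+ n / omega_n mu)%R.
    by field; rewrite tn gt_eqF.
  rewrite ler_wpM2l ?exprn_ge0// -[leRHS]invrK lef_pV2 ?posrE ?invr_gt0 ?exprn_gt0//.
  exact: omega_n_ge.
have L0 : 0 <= ((t ^+ n * omega_n mu)^-1)%:E *
     \int[mu]_(h in [set h | (enorm (rowt h) < t)%R]) diffLp mu f p (rowt h).
  apply: mule_ge0; first by rewrite lee_fin.
  by apply: integral_ge0 => h _; apply: integral_ge0 => x _; rewrite lee_fin powR_ge0.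
apply: (le_trans (le_poweR (ltW r0) L0 bound)).
rewrite poweRM ?lee_fin ?exprn_ge0// poweR_EFin /X -poweRrM.
rewrite (_ : (p / n%:R * (n%:R / p) = 1)%R); last by field; rewrite nn0 gt_eqF.
have Y0 : 0 <= cD%:E * weighted_sum s by rewrite mule_ge0// lee_fin.
have -> : ((2 * n.+1%:R) ^+ n * cD)%:E = ((2 * n.+1%:R) ^+ n)%:E * cD%:E by rewrite -EFinM.
rewrite poweRe1// -muleA; apply: lee_wpmul2r => //.
by rewrite lee_fin ler1_powR.
Qed.

End difference_norm.

(** * From dyadic sums to an integral over the half-line *)

Section dyadic_integral.
Context {R : realType}.
Local Open Scope ereal_scope.

Lemma dyadic_ge1 (t : R) : (1 <= t)%R -> exists i : nat, (2 ^+ i <= t < 2 * 2 ^+ i)%R.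
Proof.
move=> t1; have ex : exists i : nat, (t < 2 * 2 ^+ i)%R.
  exists (Num.bound t); have t0 : (0 <= t)%R by exact: le_trans t1.
  apply: (lt_trans (archi_boundP t0)); rewrite -exprS -natrX ltr_nat.
  by apply: (ltn_trans (ltn_expl _ (ltnSn 1))); rewrite ltn_exp2l.
case: (ex_minnP ex) => i ti imin; exists i; rewrite ti andbT.
case: i ti imin => [|i] _ imin; first by rewrite expr0.
by rewrite leNgt; apply/negP; rewrite exprS => /imin; rewrite ltnn.
Qed.

Lemma dyadic_lt1 (t : R) : (0 < t < 1)%R ->
  exists i : nat, (2^-1 ^+ i.+1 <= t < 2 * 2^-1 ^+ i.+1)%R.
Proof.
move=> /andP[t0 t1]; have h i : (2 * 2^-1 ^+ i.+1 = 2^-1 ^+ i :> R)%R.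
  by rewrite exprS mulrA mulfV// mul1r.
have ex : exists i : nat, (2^-1 ^+ i.+1 <= t)%R.
  have t1' : (1 <= t^-1)%R by rewrite invf_ge1// ltW.
  have [i /andP[_ ti]] := dyadic_ge1 t1'; exists i.
  rewrite -[t]invrK exprVn lef_pV2 ?posrE ?invr_gt0 ?exprn_gt0//.
  by rewrite exprS ltW.
case: (ex_minnP ex) => i ti imin; exists i; rewrite ti/= h.
case: i ti imin => [|i] _ imin; first by rewrite expr0.
by rewrite ltNge; apply/negP => /imin; rewrite ltnn.
Qed.

Variables (F a : R -> \bar R) (K : R).
Hypothesis F0 : forall t : R, (0 < t)%R -> 0 <= F t.
Hypothesis a0 : forall s : R, (0 < s)%R -> 0 <= a s.
Hypothesis Fa : forall s t : R, (0 < s)%R -> (s <= t < 2 * s)%R -> F t <= (s^-1)%:E * a s.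
Hypothesis aK : forall (b : R) L, (0 < b)%R -> \sum_(i < L) a (2 ^+ i * b) <= K%:E.

Let D : set R := `]0%R, +oo[.
Let mD : measurable D. Proof. exact: measurable_itv. Qed.
Let step (s t : R) : \bar R := ((s^-1)%:E * a s) * (\1_(`[s, (2 * s)%R[) t)%:E.

Let step_ge0 (s t : R) : (0 < s)%R -> 0 <= step s t.
Proof.
by move=> s0; rewrite !mule_ge0 ?a0// lee_fin ?invr_ge0 ?(ltW s0).
Qed.

Let mstep (s : R) : measurable_fun D (step s).
Proof.
apply: measurable_funeM; apply/measurable_EFinP; apply: measurable_indic.
exact: measurable_itv.
Qed.

Let int_step (s : R) : (0 < s)%R -> \int[lebesgue_measure]_(t in D) step s t = a s.
Proof.
move=> s0; rewrite ge0_integralZl//.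
- rewrite (integral_indic lebesgue_measure mD (measurable_itv _)).
  rewrite setIidl; last first.
    by move=> t; rewrite /D /= !in_itv/= andbT => /andP[st _]; exact: lt_le_trans st.
  have L : lebesgue_measure (`[s, (2 * s)%R[ : set R) = s%:E.
    rewrite lebesgue_measure_itv/= lte_fin; have -> : (s < 2 * s)%R by lra.
    by rewrite -EFinB; congr EFin; ring.
  transitivity ((s^-1)%:E * a s * s%:E); first by congr (_ * _); exact: L.
  by rewrite muleAC -EFinM mulVf ?mul1e// gt_eqF.
- by apply/measurable_EFinP; apply: measurable_indic; exact: measurable_itv.
- by rewrite mule_ge0 ?a0// lee_fin invr_ge0 ltW.
Qed.

(** The dyadic scales on both sides of 1, enumerated two at a time by the natural numbers. *)
Let pair i t := step (2 ^+ i) t + step (2^-1 ^+ i.+1) t.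

Let p2 i : (0 < 2 ^+ i :> R)%R. Proof. by rewrite exprn_gt0. Qed.
Let p2V i : (0 < 2^-1 ^+ i :> R)%R. Proof. by rewrite exprn_gt0. Qed.

Let pair_ge0 i t : 0 <= pair i t.
Proof. by rewrite adde_ge0 ?step_ge0. Qed.

Let F_le_pair t : D t -> exists i, F t <= pair i t.
Proof.
rewrite /D /= in_itv/= andbT => t0; have [t1|t1] := leP 1%R t.
  have [i ti] := dyadic_ge1 t1; exists i; apply: (le_trans (Fa (p2 i) ti)).
  by rewrite /pair {1}/step indicE mem_set ?mule1 ?leeDl ?step_ge0//= in_itv.
have t01 : (0 < t < 1)%R by rewrite t0.
have [i ti] := dyadic_lt1 t01; exists i; apply: (le_trans (Fa (p2V i.+1) ti)).
by rewrite /pair {2}/step indicE mem_set ?mule1 ?leeDr ?step_ge0//= in_itv.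
Qed.

Let sum_pair N : \sum_(i < N) (a (2 ^+ i) + a (2^-1 ^+ i.+1)) <= K%:E.
Proof.
(* A window of 2 N scales starting at 2^-N: its first half, reversed, gives the scales below 1 and
   its second half those from 1 on. *)
apply: le_trans (aK (N + N) (p2V N)); rewrite big_split_ord big_split/= addeC.
have e m : (2 ^+ m * 2^-1 ^+ m = 1 :> R)%R by rewrite -exprMn mulfV// expr1n.
rewrite le_eqVlt; apply/orP; left; apply/eqP; congr (_ + _).
  rewrite (reindex_inj rev_ord_inj)/=; apply: eq_bigr => i _; congr a.
  rewrite subnSK//; have -> : (2^-1 ^+ N = 2^-1 ^+ i * 2^-1 ^+ (N - i) :> R)%R.
    by rewrite -exprD subnKC// ltnW.
  by rewrite mulrA e mul1r.
apply: eq_bigr => i _; congr a.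
by rewrite addnC exprD -mulrA e mulr1.
Qed.

Lemma integral_dyadic_le : \int[lebesgue_measure]_(t in D) F t <= K%:E.
Proof.
apply: (@le_trans _ _ (\int[lebesgue_measure]_(t in D) \sum_(i <oo) pair i t)).
  apply: le_ge0_integral => t Dt.
    by apply: F0; move: Dt; rewrite /D /= in_itv/= andbT.
  have [i /le_trans] := F_le_pair Dt; apply.
  have := sum_le_nneseries i.+1 (pair_ge0^~ t); apply: le_trans.
  by rewrite big_ord_recr/= leeDr// sume_ge0.
rewrite integral_nneseries//; last by move=> i; apply: emeasurable_funD; exact: mstep.
apply: lime_le.
  by apply: is_cvg_nneseries => i _ _; apply: integral_ge0.
apply: nearW => N; rewrite big_mkord; apply: le_trans (sum_pair N).
apply: lee_sum => i _; rewrite (ge0_integralD lebesgue_measure mD (fun t _ => step_ge0 t (p2 i)) (mstep (2 ^+ i))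
  (fun t _ => step_ge0 t (p2V i.+1)) (mstep _)).
by rewrite !int_step.
Qed.

End dyadic_integral.

(** * Summation over all scales *)

Section besov_integral.
Context {R : realType} {n : nat}.
Notation Rn := (n.-tuple R).
Variable mu : {measure set Rn -> \bar R}.
Hypothesis muL : is_lebesgue_n mu.
Variables (f : 'rV[R]_n -> R) (g : 'I_n -> 'rV[R]_n -> R).
Hypothesis fW : in_Wdot1n mu f g.
Variables (p rho J : R).
Hypotheses (n2 : (2 <= n)%N) (np : (n%:R < p)%R) (rho01 : (0 < rho < 1)%R).
Hypothesis JE : (\int[mu]_x (grad_norm g x ^+ n)%:E = J%:E)%E.
Hypothesis rhop : (2 `^ (- (n%:R / p)) <= rho ^+ 2)%R.
Local Open Scope ereal_scope.

Let p0 : (0 < p)%R. Proof. by apply: le_lt_trans np; exact: ler0n. Qed.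
Let r01 : (0 < n%:R / p < 1)%R.
Proof. by rewrite divr_gt0 ?ltr0n ?(leq_trans _ n2)//= ltr_pdivrMr// mul1r. Qed.

Let ex : R := (n%:R / p * n%:R)%R.
Let B (s : R) : R := avg_bound mu (grad_norm g) p s.
Let B0 s : (0 <= B s)%R.
Proof. by apply: avg_bound_ge0 => //; exact: grad_norm_ge0. Qed.

Let E : R := (2 ^+ n * (9 ^+ n) ^+ n * (2 + 2 * 2 ^+ n.-1 + 10 * (2 ^+ n) ^+ 2) /
  (1 - n%:R / p) * J)%R.

Let window (b : R) L : (0 < b)%R ->
  (\sum_(i < L) (2 ^+ i * b) `^ (n%:R * (1 - n%:R / p)) * B (2 ^+ i * b) <= E)%R.
Proof.
move=> b0; apply: (sum_avg_bound n2 (measurable_grad_norm fW) _ JE np) => //.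
exact: grad_norm_ge0.
Qed.

Let E0 : (0 <= E)%R.
Proof. by have := window 0 ltr01; rewrite big_ord0. Qed.

(** Rewriting sg^(-n^2/p) at the finer scale 2 sg 2^-l gains 2^(-l n^2/p), at most rho^(2 n l) by
    [rhop]. Against the weight rho^(-n l) this leaves rho^(n l) <= rho^l. *)
Let term_le (sg : R) (l : nat) : (0 < sg)%R ->
  (sg `^ (- ex) * ((rho ^- n) ^+ l * (2 * sg * 2^-1 ^+ l) ^+ n * B (2 * sg * 2^-1 ^+ l)) <=
   2 ^+ n * rho ^+ l * ((2 * sg * 2^-1 ^+ l) `^ (n%:R * (1 - n%:R / p)) * B (2 * sg * 2^-1 ^+ l)))%R.
Proof.
move=> sg0; have /andP[q0 q1] := rho01; have /andP[r0 r1] := r01.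
set t : R := (2 * sg * 2^-1 ^+ l)%R.
have t0 : (0 < t)%R by rewrite !mulr_gt0// exprn_gt0.
have tE : (t `^ (n%:R * (1 - n%:R / p)) = t ^+ n * t `^ (- ex))%R.
  rewrite -(powR_mulrn n (ltW t0)) -powRD; last by rewrite (gt_eqF t0) implybT.
  by congr (_ `^ _)%R; rewrite /ex; ring.
have sgE : (sg = 2^-1 * (2 ^+ l * t))%R.
  have e : (2 ^+ l * 2^-1 ^+ l = 1 :> R)%R by rewrite -exprMn mulfV// expr1n.
  have -> : (2^-1 * (2 ^+ l * t) = 2^-1 * 2 * (2 ^+ l * 2^-1 ^+ l) * sg)%R by rewrite /t; ring.
  by rewrite e mulVf// !mul1r.
have l0 : (0 < 2 ^+ l :> R)%R by rewrite exprn_gt0.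
have sgp : (sg `^ (- ex) = 2 `^ ex * (2 ^+ l) `^ (- ex) * t `^ (- ex))%R.
  have lt0 : (0 <= 2 ^+ l * t)%R by rewrite mulr_ge0// ltW.
  have h0 : (0 <= 2^-1 :> R)%R by rewrite invr_ge0.
  rewrite {1}sgE (powRM _ h0 lt0) (powRM _ (ltW l0) (ltW t0)) mulrA; congr (_ * _ * _)%R.
  by rewrite powR_inv// powRN invrK.
have two : (2 `^ ex <= 2 ^+ n :> R)%R.
  rewrite -powR_mulrn//; apply: ler_powR; first by lra.
  by rewrite /ex -[leRHS]mul1r ler_wpM2r// ltW.
have geo : ((2 ^+ l) `^ (- ex) * (rho ^- n) ^+ l <= rho ^+ l)%R.
  have -> : ((2 ^+ l) `^ (- ex) = ((2 `^ (- (n%:R / p))) ^+ n) ^+ l :> R)%R.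
    rewrite -(powR_mulrn l)// -powRrM -(powR_mulrn n (powR_ge0 _ _)) -powRrM.
    rewrite -(powR_mulrn l (powR_ge0 _ _)) -powRrM; congr (_ `^ _)%R; rewrite /ex; ring.
  rewrite -exprMn lerXn2r ?nnegrE ?mulr_ge0 ?invr_ge0 ?exprn_ge0 ?powR_ge0 ?(ltW q0)//.
  have qn : (0 < rho ^+ n)%R by rewrite exprn_gt0.
  rewrite ler_pdivrMr//; apply: (@le_trans _ _ ((rho ^+ 2) ^+ n)%R).
    by rewrite lerXn2r ?nnegrE ?powR_ge0 ?exprn_ge0 ?(ltW q0).
  rewrite exprAC expr2; apply: ler_wpM2r; first exact: ltW.
  have n0 : (0 < n)%N by exact: leq_trans n2.
  by rewrite -[leRHS]expr1 ler_wiXn2l ?(ltW q0) ?(ltW q1).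
rewrite sgp tE; set P := (t `^ (- ex))%R; set Q := (t ^+ n)%R.
have P0 : (0 <= P)%R by rewrite powR_ge0.
have Q0 : (0 <= Q)%R by rewrite exprn_ge0// ltW.
move: two geo; set a := (2 `^ ex)%R; set b := ((2 ^+ l) `^ _)%R; set d := ((rho ^- n) ^+ l)%R.
move=> two geo.
have a0 : (0 <= a)%R by rewrite powR_ge0.
have bd0 : (0 <= b * d)%R by rewrite mulr_ge0 ?powR_ge0 ?exprn_ge0 ?invr_ge0 ?exprn_ge0 ?(ltW q0).
have -> : (a * b * P * (d * Q * B t) = a * (b * d) * (Q * P * B t))%R by ring.
apply: ler_wpM2r; first by apply: mulr_ge0 => //; exact: mulr_ge0.
exact: ler_pM.
Qed.

Let M : R := ((2 * n.+1%:R) ^+ n * ((2 * (2 * (n%:R * 72 ^+ n) * 2 ^+ n)) ^+ n * (1 - rho) ^- n))%R.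
Let M0 : (0 <= M)%R.
Proof.
have /andP[q0 q1] := rho01.
by rewrite /M !mulr_ge0 ?exprn_ge0 ?invr_ge0 ?exprn_ge0 ?mulr_ge0 ?exprn_ge0//; lra.
Qed.

Let W := weighted_sum mu g p rho.

Let scaled_W (sg : R) : (0 < sg)%R ->
  (sg `^ (- ex))%:E * W (2 * sg) <=
  \sum_(l <oo) (2 ^+ n * rho ^+ l * ((2 * sg * 2^-1 ^+ l) `^ (n%:R * (1 - n%:R / p)) *
     B (2 * sg * 2^-1 ^+ l)))%:E.
Proof.
move=> sg0; have /andP[q0 _] := rho01.
have t0 l : (0 <= (rho ^- n) ^+ l * (2 * sg * 2^-1 ^+ l) ^+ n * B (2 * sg * 2^-1 ^+ l))%R.
  apply: mulr_ge0; last exact: B0.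
  apply: mulr_ge0; first by rewrite exprn_ge0// invr_ge0 exprn_ge0// ltW.
  by rewrite exprn_ge0// mulr_ge0 ?exprn_ge0// mulr_ge0// ltW.
rewrite /W /weighted_sum -nneseriesZl; last by move=> l _; rewrite lee_fin.
apply: lee_nneseries => [l _ _|l _].
  by apply: mule_ge0; rewrite lee_fin// powR_ge0.
by rewrite -EFinM lee_fin term_le.
Qed.

(** After exchanging the sums, the scales belonging to a fixed l form a dyadic window starting at 2
    b 2^-l, whose sum is at most [E] for every l; the geometric series in l remains. *)
Let sum_scaled_W (b : R) L : (0 < b)%R ->
  \sum_(i < L) ((2 ^+ i * b) `^ (- ex))%:E * W (2 * (2 ^+ i * b)) <= (2 ^+ n * E / (1 - rho))%:E.
Proof.
move=> b0; have /andP[q0 q1] := rho01.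
have bi i : (0 < 2 ^+ i * b)%R by rewrite mulr_gt0// exprn_gt0.
apply: (@le_trans _ _ (\sum_(i < L) \sum_(l <oo) (2 ^+ n * rho ^+ l *
   ((2 * (2 ^+ i * b) * 2^-1 ^+ l) `^ (n%:R * (1 - n%:R / p)) *
     B (2 * (2 ^+ i * b) * 2^-1 ^+ l)))%:E)).
  by apply: lee_sum => i _; exact: scaled_W.
have c0 l : (0 <= 2 ^+ n * rho ^+ l)%R by rewrite mulr_ge0 ?exprn_ge0 ?(ltW q0).
rewrite -nneseries_sum; last first.
  by move=> i l _; rewrite lee_fin; apply: mulr_ge0 => //; apply: mulr_ge0; rewrite ?powR_ge0.
apply: lime_le.
  apply: is_cvg_nneseries => l _ _; apply: sume_ge0 => i _.
  by rewrite lee_fin; apply: mulr_ge0 => //; apply: mulr_ge0; rewrite ?powR_ge0.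
apply: nearW => K; rewrite big_mkord.
apply: (@le_trans _ _ (\sum_(l < K) (2 ^+ n * rho ^+ l * E)%:E)).
  apply: lee_sum => l _; rewrite sumEFin lee_fin -mulr_sumr ler_wpM2l//.
  have bl : (0 < 2 * b * 2^-1 ^+ l)%R by rewrite !mulr_gt0// exprn_gt0.
  apply: le_trans (window L bl); apply: ler_sum => i _.
  by have -> : (2 * (2 ^+ i * b) * 2^-1 ^+ l = 2 ^+ i * (2 * b * 2^-1 ^+ l))%R by ring.
rewrite sumEFin lee_fin -mulr_suml -mulr_sumr.
have geo : (\sum_(l < K) rho ^+ l <= (1 - rho)^-1)%R.
  have q1' : (0 < 1 - rho)%R by lra.
  rewrite -[leRHS]mulr1 ler_pdivlMl//.
  have -> : ((1 - rho) * \sum_(l < K) rho ^+ l = 1 - rho ^+ K)%R.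
    by rewrite -[RHS]opprB subrX1 -mulNr opprB.
  by rewrite gerBl exprn_ge0// ltW.
have -> : (2 ^+ n * E / (1 - rho) = 2 ^+ n * (1 - rho)^-1 * E)%R by ring.
by rewrite ler_wpM2r// ler_wpM2l// exprn_ge0.
Qed.

Let integrand (t : R) : \bar R :=
  (t `^ (- ex))%:E * (modulus mu f p t) `^ n%:R * (t^-1)%:E.

(** For t in [sg, 2 sg) the modulus is controlled at the outer scale 2 sg, while the decreasing
    powers of t are largest at sg. *)
Let shell (sg : R) : \bar R := M%:E * ((sg `^ (- ex))%:E * W (2 * sg)).

Let W0 (s : R) : (0 < s)%R -> 0 <= W s.
Proof. by move=> s0; apply: weighted_sum_ge0. Qed.

Let shell_ge0 (sg : R) : (0 < sg)%R -> 0 <= shell sg.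
Proof.
move=> sg0; apply: mule_ge0; first by rewrite lee_fin.
by apply: mule_ge0; [rewrite lee_fin powR_ge0|apply: W0; rewrite mulr_gt0].
Qed.

Let integrand_le (sg t : R) : (0 < sg)%R -> (sg <= t < 2 * sg)%R ->
  integrand t <= (sg^-1)%:E * shell sg.
Proof.
move=> sg0 /andP[st ts]; have t0 : (0 < t)%R by exact: lt_le_trans st.
have h : (modulus mu f p t) `^ n%:R <= M%:E * W (2 * sg).
  have tt : (0 < t <= 2 * sg)%R by rewrite t0 ltW.
  exact: (modulus_bound muL fW n2 np rho01 JE tt).
have e0 : (0 <= ex)%R by rewrite /ex !mulr_ge0// invr_ge0 ltW.
have ep : (t `^ (- ex) <= sg `^ (- ex))%R.
  rewrite !powRN lef_pV2 ?posrE ?powR_gt0//.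
  by rewrite ge0_ler_powR ?nnegrE ?(ltW t0) ?(ltW sg0).
have iv : (t^-1 <= sg^-1)%R by rewrite lef_pV2 ?posrE.
rewrite /integrand muleC /shell [X in _ <= _ * X]muleCA.
apply: lee_pmul.
- by rewrite lee_fin invr_ge0 ltW.
- by apply: mule_ge0; [rewrite lee_fin powR_ge0|exact: poweR_ge0].
- by rewrite lee_fin.
- by apply: lee_pmul => //; [rewrite lee_fin powR_ge0|rewrite poweR_ge0].
Qed.

Lemma besov_integral_le :
  \int[lebesgue_measure]_(t in `]0%R, +oo[)
    ((t `^ (- (n%:R / p * n%:R)))%:E * (modulus mu f p t) `^ n%:R * (t^-1)%:E) <=
  (M * (2 ^+ n * E / (1 - rho)))%:E.
Proof.
apply: (integral_dyadic_le (a := shell)).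
- move=> t t0; apply: mule_ge0; last by rewrite lee_fin invr_ge0 ltW.
  by apply: mule_ge0; [rewrite lee_fin powR_ge0|exact: poweR_ge0].
- exact: shell_ge0.
- exact: integrand_le.
- move=> b L b0; rewrite -ge0_sume_distrr; last first.
    move=> i _; have bi : (0 < 2 ^+ i * b)%R by rewrite mulr_gt0// exprn_gt0.
    by apply: mule_ge0; [rewrite lee_fin powR_ge0|apply: W0; rewrite mulr_gt0].
  by rewrite [leRHS]EFinM; apply: lee_wpmul2l; [rewrite lee_fin|exact: sum_scaled_W].
Qed.

End besov_integral.

Theorem mainTheorem17 (R : realType) (n : nat) (p0 : R) :
  (2 <= n)%N -> n%:R < p0 ->
  exists c : R,
    forall mu : {measure set (n.-tuple R) -> \bar R}, is_lebesgue_n mu ->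
    forall (p : R) (f : 'rV[R]_n -> R) (g : 'I_n -> 'rV[R]_n -> R),
      n%:R < p -> p < p0 -> in_Wdot1n mu f g ->
      (besov mu f (n%:R / p) p n%:R
        <= (c * (1 - n%:R / p) `^ (- n%:R^-1) * gradLn mu g)%:E)%E.
Proof.
move=> n2 np0.
have n0 : 0 < n%:R :> R by rewrite ltr0n (leq_trans _ n2).
have p00 : 0 < p0 by exact: lt_trans np0.
(* Then rho^2 = 2^(-n/p0) dominates 2^(-n/p) for every p < p0, so a single [rho], and with it [C],
   serves all admissible p. *)
pose rho : R := 2 `^ (- (n%:R / (2 * p0))).
have rho01 : 0 < rho < 1.
  rewrite powR_gt0//= /rho powRN invf_lt1 ?powR_gt0//.
  have e0 : 0 < n%:R / (2 * p0) by rewrite divr_gt0// mulr_gt0.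
  have := @gt0_ltr_powR R _ e0 1 2; rewrite powR1; apply; rewrite ?nnegrE//.
  by rewrite ltr1n.
have /andP[q0 q1] := rho01.
pose M : R := (2 * n.+1%:R) ^+ n * ((2 * (2 * (n%:R * 72 ^+ n) * 2 ^+ n)) ^+ n * (1 - rho) ^- n).
pose A0 : R := 2 ^+ n * (9 ^+ n) ^+ n * (2 + 2 * 2 ^+ n.-1 + 10 * (2 ^+ n) ^+ 2).
pose C : R := M * 2 ^+ n * A0 / (1 - rho).
have C0 : 0 <= C.
  have q1' : 0 <= 1 - rho by rewrite subr_ge0 ltW.
  have M0 : 0 <= M.
    by rewrite /M !mulr_ge0 ?invr_ge0 ?exprn_ge0 ?mulr_ge0 ?exprn_ge0.
  have A00 : 0 <= A0.
    by rewrite /A0 !mulr_ge0 ?exprn_ge0// !addr_ge0 ?mulr_ge0 ?exprn_ge0.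
  by rewrite /C mulr_ge0 ?invr_ge0// mulr_ge0// mulr_ge0 ?exprn_ge0.
exists (C `^ n%:R^-1) => mu muL p f g np pp0 fW.
have p_gt0 : 0 < p by exact: lt_trans np.
have r1 : 0 < 1 - n%:R / p by rewrite subr_gt0 ltr_pdivrMr// mul1r.
have intE : (\int[mu]_x ((enorm (\row_i g i (rowt x))) `^ n%:R)%:E =
             \int[mu]_x (grad_norm g x ^+ n)%:E)%E.
  by apply: eq_integral => x _; rewrite powR_mulrn//; exact: sqrtr_ge0.
have int0 : (0 <= \int[mu]_x (grad_norm g x ^+ n)%:E)%E.
  by apply: integral_ge0 => x _; rewrite lee_fin exprn_ge0// grad_norm_ge0.
have [J J0 JE] : exists2 J : R, 0 <= J & (\int[mu]_x (grad_norm g x ^+ n)%:E = J%:E)%E.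
  have : (\int[mu]_x (grad_norm g x ^+ n)%:E < +oo)%E by rewrite -intE; case: fW => _ [_ [_ [_ [+ _]]]].
  move: int0; case: (\int[mu]_x _)%E => [J J0 _|//|//].
  by exists J.
have rhop : 2 `^ (- (n%:R / p)) <= rho ^+ 2.
  rewrite -powR_mulrn ?(ltW q0)// -powRrM ler_powR//; first by lra.
  have -> : - (n%:R / (2 * p0)) * 2 = - (n%:R / p0) by field; rewrite gt_eqF.
  by rewrite lerN2 ler_pM2l// lef_pV2 ?posrE// ltW.
have := besov_integral_le muL fW n2 np rho01 JE rhop.
rewrite -/M -/A0.
have -> : M * (2 ^+ n * (A0 / (1 - n%:R / p) * J) / (1 - rho)) = C * ((1 - n%:R / p)^-1 * J).
  by rewrite /C; ring.
have I0 : (0 <= \int[lebesgue_measure]_(t in `]0%R, +oo[)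
    ((t `^ (- (n%:R / p * n%:R)))%:E * (modulus mu f p t) `^ n%:R * (t^-1)%:E))%E.
  apply: integral_ge0 => t; rewrite /= in_itv/= andbT => t0.
  apply: mule_ge0; last by rewrite lee_fin invr_ge0 ltW.
  by apply: mule_ge0; [rewrite lee_fin powR_ge0|exact: poweR_ge0].
have nV : 0 <= n%:R^-1 :> R by rewrite invr_ge0 ltW.
move=> /(le_poweR nV I0); rewrite -/(besov mu f (n%:R / p) p n%:R) => /le_trans; apply.
rewrite poweR_EFin lee_fin /gradLn intE JE/=.
have rV : 0 <= (1 - n%:R / p)^-1 by rewrite invr_ge0 ltW.
rewrite (powRM _ C0 (mulr_ge0 rV J0)) (powRM _ rV J0) mulrA.
by rewrite powRN powR_inv ?(ltW r1).
Qed.
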